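(* Let $\mathbb F\in\{\mathbb R,\mathbb C\}$ and let $\mathfrak A$ be a $C^*$-algebra over $\mathbb F$. There is an $\mathscr L$-permutative category structure, natural in $\mathfrak A$, on the Murray–von Neumann category $\mathtt{pr}_{\widetilde{\mathfrak{KA}}}$, defined as follows. For matrices $\boldsymbol U^x=[\upsilon^x_{\mu\nu}\tilde 1+\hat U^x_{\mu\nu}]$ (resp. $\boldsymbol U^i$) over $\widetilde{\mathfrak{KA}}$ and projection matrices $\boldsymbol P^x$, $\boldsymbol P^i$, $\boldsymbol P^{ix}$ of orders $\underline p^x,\underline p^i,\underline p^{ix}$: $$\oplus_{\underline a}\boldsymbol U^x:=\left[\begin{cases}\upsilon^x_{\mu\nu}\tilde1+\hat U^x_{\mu\nu},&x=x'\\0,&x\ne x'\end{cases}\right]_{(x,\mu),(x',\nu)},\qquad \tau^{\oplus,\sigma}_{\underline a,\langle\boldsymbol P^x\rangle}:=\boldsymbol{\sigma(\underline p^x)}\,\oplus_{\underline a}\boldsymbol P^x;$$ for $f\in\mathscr L\underline m$, $$\otimes_f\boldsymbol U^i:=\Big[\prod_{i\in\underline m}\upsilon^i_{\mu^i\nu^i}\tilde1+\sum_{i\in\underline m}\Big(\prod_{i'\neq i}\upsilon^{i'}_{\mu^{i'}\nu^{i'}}\Big)f_i\hat U^i_{\mu^i\nu^i}f_i^*\Big]_{\langle\mu^i\rangle,\langle\nu^i\rangle},\qquad \tau^{\otimes,\sigma}_{f,\langle\boldsymbol P^i\rangle}:=\boldsymbol{\sigma\langle\underline p^i\rangle}\,\otimes_{f\cdot\sigma}\boldsymbol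 P^i;$$ $$\delta_{f,\langle\underline a^i\rangle,\langle\boldsymbol P^{ix}\rangle}:=\boldsymbol{\delta_{\underline m,\langle\underline a^i\rangle,\langle\underline p^{ix}\rangle}}\ \otimes_f\oplus_{\underline a^i}\boldsymbol P^{ix}.$$
   Context: **Index sets.** $\underline p=\{1<\dots<p\}$, $\underline0=\emptyset$. For families of finite ordered sets, $\Sigma_{\underline a}\underline p^x$ (pairs $(x,\mu)$, $\mu\in\underline p^x$) and $\Pi_{\underline m}\underline p^i$ (sequences $\langle\mu^i\rangle$) carry the lexicographic order and are identified with some $\underline q$. For a bijection $\sigma$ of $\underline a$, $\sigma(\underline p^x):\Sigma_{\underline a}\underline p^x\to\Sigma_{\underline a}\underline p^{\sigma^{-1}x}$, $(x,\mu)\mapsto(\sigma x,\mu)$. For a bijection $\sigma$ of $\underline m$, $\sigma\langle\underline p^i\rangle:\Pi_{\underline m}\underline p^i\to\Pi_{\underline m}\underline p^{\sigma^{-1}i}$, $\langle\mu^i\rangle\mapsto\langle\mu^{\sigma^{-1}i}\rangle$. For bijections $\sigma^i$ of $\underline a^i$, $\Pi_{\underline m}\sigma^i:\langle x^i\rangle\mapsto\langle\sigma^ix^i\rangle$. $\delta_{\underline m,\langle\underline a^i\rangle,\langle\underline p^{ix}\rangle}:\Pi_{\underline m}\Sigma_{\underline a^i}\underline p^{ix}\to\Sigma_{\Pi_{\underline m}\underline a^i}\Pi_{\underline m}\underline p^{ix^i}$ is $\langle(x^i,\mu^i)\rangle\mapsto(\langle x^i\rangle,\langle\mu^i\rangle)$.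 A bold bijection $\boldsymbol\sigma$, for $\sigma:\underline p^0\to\underline p^1$, is the permutation matrix $[\delta_{\mu(\sigma\nu)}]$ of size $p^1\times p^0$ (Kronecker delta). **Algebra.** $C^*$-algebras need not be unital. (A real $C^*$-algebra is a real Banach $*$-algebra with the $C^*$-identity and with $\tilde1+A^*A$ invertible in the unitization for all $A$.) $\mathfrak{KA}$ is the norm completion of $\mathrm{colim}_pM_{\underline p}\mathfrak A$ (upper left corner inclusions), so $\mathfrak{KA}\cong\mathfrak A\otimes\mathfrak K\mathbb F$ with $\mathfrak K\mathbb F$ the compact operators on $\ell^2_{\mathbb F}$. $\widetilde{\mathfrak{KA}}=\mathbb F\oplus\mathfrak{KA}$ is the unitization, elements written $\upsilon\tilde1+\hat U$. There is a unique, empty, matrix $0_{\underline0}$ whenever one dimension is $0$. **The category.** For a $C^*$-algebra $\mathfrak B$, $\mathtt{pr}_{\mathfrak B}$ is the topological category whose objects are all projection matrices $P=P^*=P^2\in M_{\underline p}\mathfrak B$, $p\ge 0$, with morphisms $P\to Q$ the matrices $U\in M_{\underline q,\underline p}\mathfrak B$ with $U^*U=P$, $UU^*=Q$, composition given by matrix multiplication and $\mathrm{id}_P=P$. **Operad $\mathscr L$.** $\mathscr L\underline m$ is the space of linear isometries $f=\langle f_i\rangle:\oplus_{\underline m}\mathbb R^\infty\to\mathbb R^\infty$, $f\cdot\sigma=\langle f_{\sigma i}\rangle$, identity $\mathrm{id}_{\mathbb R^\infty}$, composition $f\langle g^i\rangle=\langle f_ig^i_j\rangle$. For an isometry $f_i$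 of $\mathbb R^\infty$, extended to $\ell^2_{\mathbb F}$ with adjoint $f_i^*$, $f_i\hat Uf_i^*$ is conjugation on the factor $\mathfrak K\mathbb F$ of $\mathfrak{KA}\cong\mathfrak A\otimes\mathfrak K\mathbb F$. **$\mathscr G$-categories.** For a topological operad $\mathscr G$, a $\mathscr G$-category is a topological category $\mathcal C$ with functors $\circledast_{\underline m}:\mathscr G\underline m\times\mathcal C^{\underline m}\to\mathcal C$ ($\mathscr G\underline m$ having only identity morphisms; $\circledast_f:=\circledast_{\underline m}(f,-)$) and, for each bijection $\sigma$ of $\underline m$, natural isomorphisms $\tau^{\circledast,\sigma}_{f,\langle P^i\rangle}:\circledast_{f\cdot\sigma}P^i\Rightarrow\circledast_fP^{\sigma^{-1}i}$, such that $\circledast_{f\langle g^i\rangle}=\circledast_f\langle\circledast_{g^i}\rangle$; $\circledast_{\mathbf{id}}=\mathrm{id}_{\mathcal C}$; $\tau^{\circledast,\sigma}_{f,\langle P^{\sigma'^{-1}i}\rangle}\tau^{\circledast,\sigma'}_{f\cdot\sigma,\langle P^i\rangle}=\tau^{\circledast,\sigma\sigma'}_{f,\langle P^i\rangle}$; $\tau^{\circledast,\mathrm{id}}_{f,\langle P^i\rangle}=\mathrm{id}$. $\mathscr C$ denotes the terminal operad, with a single element, denoted $\underline m$, in each arity. **$\mathscr L$-permutative categories** (that is, $(\mathscr C,\mathscr L)$-categories, with $\mathscr L$ acting on $\mathscr C$ by $f\ltimes\langle\underline a^i\rangle=\Pi_{\underline m}\underline a^i$). Such a structure on a topological category $\mathcal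 C$ consists of a $\mathscr C$-category structure $(\oplus_{\underline a},\tau^{\oplus,\sigma}_{\underline a,\langle P^x\rangle})$, an $\mathscr L$-category structure $(\otimes_f,\tau^{\otimes,\sigma}_{f,\langle P^i\rangle})$, and natural transformations (on $\mathscr L\underline m\times\mathcal C^{\Sigma_{\underline m}\underline a^i}$) $$\delta_{f,\langle\underline a^i\rangle,\langle P^{ix}\rangle}:\otimes_f\oplus_{\underline a^i}P^{ix}\Rightarrow\oplus_{\Pi_{\underline m}\underline a^i}\otimes_fP^{ix^i}$$ such that $\otimes_f\oplus_{\underline a^i}=\oplus_{\underline0}$ whenever some $\underline a^i=\underline0$, and: (i) $\tau^{\oplus,\Pi_{\underline m}\sigma^i}_{\langle\otimes_fP^{ix^i}\rangle}\circ\delta_{f,\langle P^{ix}\rangle}=\delta_{f,\langle P^{i(\sigma^{i})^{-1}x}\rangle}\circ\otimes_f\tau^{\oplus,\sigma^i}_{\langle P^{ix}\rangle}$ for bijections $\sigma^i$ of $\underline a^i$; (ii) $\tau^{\oplus,\sigma\langle\underline a^i\rangle}\circ\big(\oplus_{\Pi_{\underline m}\underline a^i}\tau^{\otimes,\sigma}_{f,\langle P^{ix^i}\rangle}\big)\circ\delta_{f\cdot\sigma,\langle P^{ix}\rangle}=\delta_{f,\langle P^{(\sigma^{-1}i)x}\rangle}\circ\tau^{\otimes,\sigma}_{f,\langle\oplus_{\underline a^i}P^{ix}\rangle}$, where $\tau^{\oplus,\sigma\langle\underline a^i\rangle}$ is taken at the objects $\otimes_fP^{(\sigma^{-1}i)x^{\sigma^{-1}i}}$;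 (iii) $\big(\oplus_{\Pi_{\underline m}\underline a^i}\delta_{f,\langle\underline b^{ix^i}\rangle,\langle P^{ix^iy}\rangle}\big)\circ\delta_{f,\langle\underline a^i\rangle,\langle\oplus_{\underline b^{ix}}P^{ixy}\rangle}=\tau^{\oplus,\delta_{\underline m,\langle\underline a^i\rangle,\langle\underline b^{ix}\rangle}}_{\langle\otimes_fP^{ix^iy^i}\rangle}\circ\delta_{f,\langle\Sigma_{\underline a^i}\underline b^{ix}\rangle,\langle P^{ixy}\rangle}$. (Subscripts recording operad elements of $\mathscr C$ are omitted when clear.) *)

(* Defs.v *)
From HB Require Import structures.
From mathcomp Require Import all_boot all_order all_algebra.
From mathcomp Require Import ring complex.
From mathcomp Require Import boolp classical_sets functions reals.
From mathcomp Require Import topology normedtype.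
Set Implicit Arguments.
Unset Strict Implicit.
Unset Printing Implicit Defensive.
Import Order.TTheory GRing.Theory Num.Theory numFieldNormedType.Exports.

Section LexProd.
Variables (m : nat) (p : 'I_m -> nat).

(* The index set of sequences <mu^i>, ordered lexicographically.  [mdigit] and
   [mcode] are the order-preserving identification with {0..q-1}; for sums, the
   corresponding identification is [tagnat] (sigma types are ordered
   lexicographically there). *)
Definition lexprod := {dffun forall i : 'I_m, 'I_(p i)}.
HB.instance Definition _ := Finite.on lexprod.

Definition lexseq (mu : lexprod) : seqlexi nat :=
  [seq val (mu i) | i <- enum 'I_m].

Lemma lexseq_inj : injective lexseq.
Proof.
move=> mu nu /eq_in_map e; apply/ffunP => i; apply/val_inj.
by apply: e; rewrite mem_enum.
Qed.

Definition lexprod_le (mu nu : lexprod) : bool := (lexseq mu <= lexseq nu)%O.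

Lemma lexprod_le_refl : reflexive lexprod_le.
Proof. by move=> mu; exact: lexx. Qed.

Lemma lexprod_le_anti : antisymmetric lexprod_le.
Proof. by move=> mu nu h; exact/lexseq_inj/le_anti. Qed.

Lemma lexprod_le_trans : transitive lexprod_le.
Proof. by move=> nu mu xi; exact: le_trans. Qed.

HB.instance Definition _ := Order.Le_isPOrder.Build (Order.Disp tt tt) lexprod
  lexprod_le_refl lexprod_le_anti lexprod_le_trans.

Lemma lexprod_le_total : total (<=%O : rel lexprod).
Proof. by move=> mu nu; exact: le_total. Qed.

Lemma card_lexprod : #|{: lexprod}| = (\prod_i p i)%N.
Proof.
rewrite card_dep_ffun foldrE big_map -big_enum /=.
by apply: eq_bigr => i _; rewrite card_ord.
Qed.

Definition mdigit : 'I_(\prod_i p i) -> lexprod :=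
  Order.enum_val \o cast_ord (esym card_lexprod).

Definition mrank : lexprod -> 'I_(\prod_i p i) :=
  cast_ord card_lexprod \o Order.enum_rank.

Lemma mdigitK : cancel mdigit mrank.
Proof.
by move=> k; rewrite /mdigit /mrank /= Order.enum_valK cast_ord_comp cast_ord_id.
Qed.

Lemma mrankK : cancel mrank mdigit.
Proof.
by move=> mu; rewrite /mdigit /mrank /= cast_ord_comp cast_ord_id Order.enum_rankK.
Qed.

Lemma le_mdigit : {mono mdigit : k l / (k <= l)%O}.
Proof.
by move=> k l; rewrite /mdigit /= Order.le_enum_val //; exact: lexprod_le_total.
Qed.

Definition mcode (mu : forall i, 'I_(p i)) : 'I_(\prod_i p i) := mrank (finfun mu).

Lemma mdigit_code mu i : mdigit (mcode mu) i = mu i.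
Proof. by rewrite /mcode mrankK ffunE. Qed.

Lemma mcodeK k : mcode (mdigit k) = k.
Proof. by rewrite /mcode -[RHS]mdigitK; congr mrank; apply/ffunP => i; rewrite ffunE. Qed.

Lemma eq_mcode mu nu : (forall i, mu i = nu i) -> mcode mu = mcode nu.
Proof. by move=> e; congr mrank; apply/ffunP => i; rewrite !ffunE. Qed.

End LexProd.

(* Bijections {0..m-1} -> {0..n-1}, where necessarily m = n.  Allowing m and n to
   be different expressions avoids casts between index sets such as those of the
   products of a i and of a (s^-1 j). *)
Record ordbij (m n : nat) := OrdBij {
  ordbij_fun :> 'I_m -> 'I_n;
  ordbij_funP : bijective ordbij_fun }.

Lemma ordbij_inv_ex m n (s : ordbij m n) :
  exists g : 'I_n -> 'I_m, cancel s g /\ cancel g s.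
Proof. by case: (ordbij_funP s) => g fK gK; exists g. Qed.

Definition ordbij_inv_fun m n (s : ordbij m n) : 'I_n -> 'I_m :=
  projT1 (cid (ordbij_inv_ex s)).

Lemma ordbij_inv_funK m n (s : ordbij m n) : cancel s (ordbij_inv_fun s).
Proof. by rewrite /ordbij_inv_fun; case: cid => g []. Qed.

Lemma ordbij_inv_funKV m n (s : ordbij m n) : cancel (ordbij_inv_fun s) s.
Proof. by rewrite /ordbij_inv_fun; case: cid => g []. Qed.

Definition ordbij_inv m n (s : ordbij m n) : ordbij n m :=
  OrdBij (Bijective (ordbij_inv_funKV s) (ordbij_inv_funK s)).

Definition ordbij_id m : ordbij m m :=
  @OrdBij m m id (Bijective (fun=> erefl) (fun=> erefl)).

Definition ordbij_comp m n p (t : ordbij n p) (s : ordbij m n) : ordbij m p :=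
  OrdBij (bij_comp (ordbij_funP t) (ordbij_funP s)).

(* (x, mu) |-> (s x, mu) *)

Section SumBij.
Variables (a b : nat) (s : ordbij a b) (p : 'I_a -> nat).

Definition sum_bij_fun (k : 'I_(\sum_x p x)) : 'I_(\sum_y p (ordbij_inv s y)) :=
  tagnat.Rank (s (tagnat.sig1 k))
    (cast_ord (congr1 p (esym (ordbij_inv_funK s (tagnat.sig1 k)))) (tagnat.sig2 k)).

Lemma sum_bij_bij : bijective sum_bij_fun.
Proof.
apply: inj_card_bij.
  move=> k l /(congr1 val) /eqP; rewrite tagnat.eq_Rank => /andP[/eqP e1 /eqP e2].
  have e1' := can_inj (ordbij_inv_funK s) e1.
  apply/val_inj/eqP; rewrite -[k]tagnat.sig2K -[l]tagnat.sig2K tagnat.eq_Rank.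
  by apply/andP; split; apply/eqP.
rewrite !card_ord (reindex s) /=; last exact/onW_bij/ordbij_funP.
by rewrite leq_eqVlt; apply/orP; left; apply/eqP/eq_bigr => x _; rewrite ordbij_inv_funK.
Qed.

Definition sum_bij := OrdBij sum_bij_bij.

End SumBij.

(* <mu^i>_i |-> <mu^(s^-1 j)>_j *)

Section ProdPermBij.
Variables (m n : nat) (s : ordbij m n) (p : 'I_m -> nat).

Definition prod_perm_fun (k : 'I_(\prod_i p i)) : 'I_(\prod_j p (ordbij_inv s j)) :=
  mcode (fun j => mdigit k (ordbij_inv s j)).

Lemma prod_perm_bij : bijective prod_perm_fun.
Proof.
apply: inj_card_bij.
  move=> k l e; rewrite -[k]mcodeK -[l]mcodeK; apply: eq_mcode => i.
  have := congr1 (fun z => mdigit z (s i)) e; rewrite !mdigit_code /=.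
  by rewrite ordbij_inv_funK.
rewrite !card_ord (reindex s) /=; last exact/onW_bij/ordbij_funP.
by rewrite leq_eqVlt; apply/orP; left; apply/eqP/eq_bigr => x _; rewrite ordbij_inv_funK.
Qed.

Definition prod_perm := OrdBij prod_perm_bij.

End ProdPermBij.

(* <x^i> |-> <s^i x^i> *)

Section ProdBij.
Variables (m : nat) (a b : 'I_m -> nat) (s : forall i, ordbij (a i) (b i)).

Definition prod_bij_fun (k : 'I_(\prod_i a i)) : 'I_(\prod_i b i) :=
  mcode (fun i => s i (mdigit k i)).

Lemma prod_bij_bij : bijective prod_bij_fun.
Proof.
exists (fun l => mcode (fun i => ordbij_inv (s i) (mdigit l i))) => k.
  rewrite -[RHS]mcodeK; apply: eq_mcode => i.
  by rewrite mdigit_code /= ordbij_inv_funK.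
rewrite -[RHS]mcodeK; apply: eq_mcode => i.
by rewrite mdigit_code /= ordbij_inv_funKV.
Qed.

Definition prod_bij := OrdBij prod_bij_bij.

End ProdBij.

(* <(x^i, mu^i)> |-> (<x^i>, <mu^i>) *)

Section DistrBij.
Variables (m : nat) (a : 'I_m -> nat) (b : forall i, 'I_(a i) -> nat).
Arguments b : clear implicits.

Definition distr_fun (k : 'I_(\prod_i \sum_x b i x)) :
    'I_(\sum_(X < \prod_i a i) \prod_i b i (mdigit X i)) :=
  let x i := tagnat.sig1 (mdigit k i) in
  let mu i := tagnat.sig2 (mdigit k i) in
  tagnat.Rank (mcode x)
    (mcode (fun i => cast_ord (congr1 (b i) (esym (mdigit_code x i))) (mu i))).

Definition distr_inv (l : 'I_(\sum_(X < \prod_i a i) \prod_i b i (mdigit X i))) :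
    'I_(\prod_i \sum_x b i x) :=
  mcode (fun i => tagnat.Rank (mdigit (tagnat.sig1 l) i) (mdigit (tagnat.sig2 l) i)).

Lemma eq_mcode_nat X X' (mu : forall i, 'I_(b i (mdigit X i)))
    (nu : forall i, 'I_(b i (mdigit X' i))) :
  X = X' -> (forall i, mu i = nu i :> nat) -> mcode mu = mcode nu :> nat.
Proof.
move=> eX; case: X' / eX in nu * => e.
by congr val; apply: eq_mcode => i; exact/val_inj/e.
Qed.

Lemma distr_bij_bij : bijective distr_fun.
Proof.
exists distr_inv => k.
  rewrite -[RHS]mcodeK; apply: eq_mcode => i.
  rewrite /distr_fun /tagnat.sig1 /tagnat.sig2 /tagnat.Rank !tagnat.rankK /=.
  apply/val_inj/eqP; rewrite -[X in _ == val X]tagnat.sig2K tagnat.eq_Rank.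
  apply/andP; split; first by rewrite mdigit_code.
  by apply/eqP; exact: (etrans (congr1 val (mdigit_code _ i))).
have xE i : tagnat.sig1 (mdigit (distr_inv k) i) = mdigit (tagnat.sig1 k) i.
  by rewrite mdigit_code tagnat.Rank1K.
apply/val_inj/eqP; rewrite -[X in _ == val X]tagnat.sig2K tagnat.eq_Rank.
apply/andP; split; first by apply/eqP; rewrite -[RHS]mcodeK; apply: eq_mcode.
rewrite -[X in _ == val X]mcodeK; apply/eqP/eq_mcode_nat => [|i /=].
  by rewrite -[RHS]mcodeK; apply: eq_mcode.
by rewrite mdigit_code tagnat.Rank2K.
Qed.

Definition distr_bij := OrdBij distr_bij_bij.

End DistrBij.

Local Open Scope classical_set_scope.
Local Open Scope ring_scope.

Section Rinf.
Variable R : realType.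

(* R^infty, the finitely supported real sequences with the Euclidean norm; only
   the module structure of {poly R} is used, and 'X^l is the l-th basis vector. *)
Definition Rinf := {poly R}.
HB.instance Definition _ := GRing.Lmodule.on Rinf.

Implicit Types v w : Rinf.

Definition sqnorm v : R := \sum_(i < size (v : {poly R})) v`_i ^+ 2.

Definition enorm v : R := Num.sqrt (sqnorm v).

Lemma sqnormE v n : (size (v : {poly R}) <= n)%N -> sqnorm v = \sum_(i < n) v`_i ^+ 2.
Proof.
move=> vn; rewrite /sqnorm (big_ord_widen _ (fun i => v`_i ^+ 2) vn).
rewrite big_mkcond /=; apply: eq_bigr => i _; case: ltnP => // vi.
by rewrite nth_default // expr0n.
Qed.

Lemma sqnorm_ge0 v : 0 <= sqnorm v.
Proof. by apply: sumr_ge0 => i _; exact: sqr_ge0. Qed.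

Lemma cauchy_schwarz_sum n (x y : 'I_n -> R) :
  (\sum_i x i * y i) ^+ 2 <= (\sum_i x i ^+ 2) * (\sum_i y i ^+ 2).
Proof.
rewrite -subr_ge0 -(pmulr_rge0 _ (ltr0n R 2)).
suff -> : 2 * ((\sum_i x i ^+ 2) * (\sum_i y i ^+ 2) - (\sum_i x i * y i) ^+ 2) =
          \sum_i \sum_j (x i * y j - x j * y i) ^+ 2.
  by apply: sumr_ge0 => i _; apply: sumr_ge0 => j _; exact: sqr_ge0.
have A : (\sum_i x i ^+ 2) * (\sum_i y i ^+ 2) = \sum_i \sum_j x i ^+ 2 * y j ^+ 2.
  by rewrite mulr_suml; apply: eq_bigr => i _; rewrite mulr_sumr.
have B : (\sum_i x i * y i) ^+ 2 = \sum_i \sum_j x i * y i * (x j * y j).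
  by rewrite expr2 mulr_suml; apply: eq_bigr => i _; rewrite mulr_sumr.
have A' : (\sum_i x i ^+ 2) * (\sum_i y i ^+ 2) = \sum_i \sum_j x j ^+ 2 * y i ^+ 2.
  by rewrite A exchange_big.
rewrite mulrBr mulr2n mulrDl mul1r {1}A A' B -big_split mulr_sumr -sumrB.
apply: eq_bigr => i _; rewrite -big_split mulr_sumr -sumrB.
apply: eq_bigr => j _ /=.
by ring.
Qed.

Lemma enorm_triangle v w : enorm (v + w) <= enorm v + enorm w.
Proof.
rewrite -(@ler_pXn2r _ 2) ?nnegrE ?sqrtr_ge0 ?addr_ge0 ?sqrtr_ge0 //.
rewrite sqrrD !sqr_sqrtr ?sqnorm_ge0 //.
pose n := maxn (size (v : {poly R})) (size (w : {poly R})).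
rewrite (@sqnormE _ n) ?size_polyD // (@sqnormE v n) ?leq_maxl //.
rewrite (@sqnormE w n) ?leq_maxr //.
have -> : \sum_(i < n) (v + w)`_i ^+ 2 = \sum_(i < n) v`_i ^+ 2 +
    (\sum_(i < n) v`_i * w`_i) *+ 2 + \sum_(i < n) w`_i ^+ 2.
  rewrite -sumrMnl -!big_split /=; apply: eq_bigr => i _.
  by rewrite coefD sqrrD.
rewrite lerD2r lerD2l lerMn2r /= -sqrtrM ?sqnorm_ge0 //.
apply: (le_trans (ler_norm _)); rewrite -sqrtr_sqr ler_sqrt; last first.
  by rewrite mulr_ge0 ?sqnorm_ge0.
rewrite (@sqnormE v n) ?leq_maxl // (@sqnormE w n) ?leq_maxr //.
exact: cauchy_schwarz_sum.
Qed.

Lemma enormZ (c : R) v : enorm (c *: v) = `|c| * enorm v.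
Proof.
rewrite -sqrtr_sqr -sqrtrM ?sqr_ge0 //; congr Num.sqrt.
rewrite (@sqnormE _ (size (v : {poly R}))) ?size_scale_leq // mulr_sumr.
by apply: eq_bigr => i _; rewrite coefZ exprMn.
Qed.

Lemma enorm0_eq0 v : enorm v = 0 -> v = 0.
Proof.
move=> /eqP; rewrite sqrtr_eq0 => v0; apply/polyP => i; rewrite coef0.
have [iv|?] := ltnP i (size (v : {poly R})); last by rewrite nth_default.
have /eqP := le_anti (introT andP (conj v0 (sqnorm_ge0 v))).
rewrite psumr_eq0 => [/allP /(_ (Ordinal iv) (mem_index_enum _))|j _].
  by rewrite sqrf_eq0 => /eqP.
exact: sqr_ge0.
Qed.

HB.instance Definition _ :=
  Lmodule_isNormed.Build R Rinf enorm_triangle enormZ enorm0_eq0.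

End Rinf.

Section LinIsom.
Variable R : realType.
Local Notation Rinf := (Rinf R).

(* f stands for the map v |-> sum_i f i (v i) from the m-fold direct sum.  The
   topology on linear isometries is that of pointwise convergence in the
   Euclidean norm.  It is coarser than the one obtained from the colimit topology
   on R^infty, so continuity in f is a stronger requirement here. *)
Definition is_lin_isom m (f : 'I_m -> Rinf -> Rinf) : Prop :=
  (forall i, linear (f i)) /\
  (forall v : 'I_m -> Rinf,
    `|\sum_i f i (v i)| = Num.sqrt (\sum_i `|v i| ^+ 2)).

Definition lin_isom m :=
  set_type [set f : {ptws 'I_m -> {ptws Rinf -> Rinf}} | is_lin_isom f].

Definition licomp m (f : lin_isom m) : 'I_m -> Rinf -> Rinf := val f.

Lemma lin_isomP m (f : lin_isom m) : is_lin_isom (licomp f).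
Proof. exact: set_mem (valP f). Qed.

Definition mk_lin_isom m (f : 'I_m -> Rinf -> Rinf) (h : is_lin_isom f) : lin_isom m :=
  SigSub (mem_set h).

Lemma li_id_subproof : is_lin_isom (fun (_ : 'I_1) (v : Rinf) => v).
Proof.
split=> // v; rewrite !big_ord1.
by rewrite sqrtr_sqr normr_id.
Qed.

Definition li_id := mk_lin_isom li_id_subproof.

Lemma li_comp_subproof m (n : 'I_m -> nat) (f : lin_isom m) (g : forall i, lin_isom (n i)) :
  is_lin_isom (fun (s : 'I_(\sum_i n i)) v =>
    licomp f (tagnat.sig1 s) (licomp (g (tagnat.sig1 s)) (tagnat.sig2 s) v)).
Proof.
have [fl fi] := lin_isomP f.
split=> [s c v w|v].
  have [gl _] := lin_isomP (g (tagnat.sig1 s)).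
  by rewrite gl fl.
rewrite (reindex _ tagnat.rank_bij_on) [in RHS](reindex _ tagnat.rank_bij_on) /=.
pose w i (j : 'I_(n i)) := v (@tagnat.Rank m n i j).
have -> : \sum_(p : {i & 'I_(n i)}) `|v (tagnat.rank p)| ^+ 2 =
    \sum_i \sum_(j < n i) `|w i j| ^+ 2.
  by rewrite sig_big_dep; apply: eq_bigr => p _; rewrite tagnat.rankE.
transitivity `|\sum_i licomp f i (\sum_(j < n i) licomp (g i) j (w i j))|.
  congr `|_|.
  transitivity (\sum_i \sum_(j < n i) licomp f i (licomp (g i) j (w i j))).
    rewrite sig_big_dep; apply: eq_bigr => -[i j] _ /=.
    by rewrite /tagnat.sig1 /tagnat.sig2 tagnat.rankK.
  apply: eq_bigr => i _; pose F : {linear Rinf -> Rinf} := HB.pack (licomp f i)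
    (GRing.isLinear.Build _ _ _ _ _ (fl i)).
  by rewrite -[licomp f i]/(F : _ -> _) linear_sum.
rewrite fi; congr Num.sqrt; apply: eq_bigr => i _.
have [_ ->] := lin_isomP (g i).
by rewrite sqr_sqrtr // sumr_ge0 // => j _; exact: sqr_ge0.
Qed.

Definition li_comp m (n : 'I_m -> nat) (f : lin_isom m) (g : forall i, lin_isom (n i)) :=
  mk_lin_isom (li_comp_subproof f g).

Lemma li_act_subproof m n (f : lin_isom n) (s : ordbij m n) :
  is_lin_isom (fun i => licomp f (s i)).
Proof.
have [fl fi] := lin_isomP f; split=> [i|v]; first exact: fl.
have /= := fi (v \o ordbij_inv s).
rewrite (reindex s) /=; last exact/onW_bij/ordbij_funP.
rewrite [in RHS](reindex s) /=; last exact/onW_bij/ordbij_funP.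
under eq_bigr do rewrite ordbij_inv_funK.
by under [in RHS]eq_bigr do rewrite ordbij_inv_funK.
Qed.

Definition li_act m n (f : lin_isom n) (s : ordbij m n) := mk_lin_isom (li_act_subproof f s).

End LinIsom.

Inductive scalars := RealScalars | ComplexScalars.

Definition fld (R : realType) (k : scalars) : numFieldType :=
  match k with RealScalars => R | ComplexScalars => R[i] end.

Definition sconj (R : realType) (k : scalars) : fld R k -> fld R k :=
  match k with
  | RealScalars => id
  | ComplexScalars => fun z : R[i] => z^*
  end.

Definition of_real (R : realType) (k : scalars) : R -> fld R k :=
  match k with
  | RealScalars => id
  | ComplexScalars => fun x => (x%:C)%C
  end.

(* Multiplication of the unitization: (c, x) stands for c 1 + x. *)
Definition pmul (K : numFieldType) (A : lmodType K) (mul : A -> A -> A)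
    (u v : K * A) : K * A :=
  (u.1 * v.1, u.1 *: v.2 + v.1 *: u.2 + mul u.2 v.2).

(* Possibly non-unital.  [cstar_sym], the invertibility of 1 + x^* x in the
   unitization, is an axiom for real scalars only; for complex scalars it is a
   theorem. *)
Record cstar (R : realType) (k : scalars) := CStar {
  cstar_sort :> completeNormedModType (fld R k);
  cmul : cstar_sort -> cstar_sort -> cstar_sort;
  cadj : cstar_sort -> cstar_sort;
  cmulA : associative cmul;
  cmulDl : left_distributive cmul +%R;
  cmulDr : right_distributive cmul +%R;
  cmulZl : forall (c : fld R k) x y, cmul (c *: x) y = c *: cmul x y;
  cmulZr : forall (c : fld R k) x y, cmul x (c *: y) = c *: cmul x y;
  cnormM : forall x y, `|cmul x y| <= `|x| * `|y|;
  cadjK : involutive cadj;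
  cadjD : {morph cadj : x y / x + y};
  cadjZ : forall (c : fld R k) x, cadj (c *: x) = sconj c *: cadj x;
  cadjM : forall x y, cadj (cmul x y) = cmul (cadj y) (cadj x);
  cstar_id : forall x, `|cmul (cadj x) x| = `|x| ^+ 2;
  cstar_sym : k = RealScalars -> forall x, exists u : fld R k * cstar_sort,
    pmul cmul u (1, cmul (cadj x) x) = (1, 0) /\
    pmul cmul (1, cmul (cadj x) x) u = (1, 0) }.

Record star_hom (R : realType) (k : scalars) (A B : cstar R k) := StarHom {
  shom :> A -> B;
  shom_linear : linear shom;
  shomM : forall x y, shom (cmul x y) = cmul (shom x) (shom y);
  shom_adj : forall x, shom (cadj x) = cadj (shom x) }.

Section CStarTheory.
Variables (R : realType) (k : scalars).
Implicit Type A : cstar R k.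

Lemma cmul0 A x : cmul x (0 : A) = 0.
Proof. by rewrite -(scale0r 0) cmulZr !scale0r. Qed.

Lemma mul0c A x : cmul (0 : A) x = 0.
Proof. by rewrite -(scale0r 0) cmulZl !scale0r. Qed.

Lemma shomD A B (f : star_hom A B) x y : f (x + y) = f x + f y.
Proof. by have := shom_linear f 1 x y; rewrite !scale1r. Qed.

Lemma shom0 A B (f : star_hom A B) : f 0 = 0.
Proof. by apply: (addrI (f 0)); rewrite -shomD !addr0. Qed.

Lemma shomZ A B (f : star_hom A B) c x : f (c *: x) = c *: f x.
Proof. by have := shom_linear f c x 0; rewrite shom0 !addr0. Qed.

End CStarTheory.

Section Unitization.
Variables (R : realType) (k : scalars).
Local Notation K := (fld R k).

(* The product norm is not the C*-norm of the unitization, but it is equivalent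
   to it; only its topology is used. *)
Definition unitization (A : cstar R k) := (K^o * A)%type.
HB.instance Definition _ A := NormedModule.on (unitization A).

Section Ring.
Variable A : cstar R k.
Local Notation U := (unitization A).

Definition umul (u v : U) : U := pmul (@cmul R k A) u v.

Definition uone : U := (1, 0).

Lemma umulA : associative umul.
Proof.
move=> [a x] [b y] [c z]; rewrite /umul /pmul /=; congr (_, _); first exact: mulrA.
rewrite !(scalerDr, cmulDl, cmulDr, cmulZl, cmulZr, scalerA) cmulA !addrA.
rewrite (mulrC c a) (mulrC c b).
by rewrite [LHS](ACl (1*2*4*6*3*5*7)%AC).
Qed.

Lemma umul1l : left_id uone umul.
Proof.
by move=> [a x]; rewrite /umul /pmul /= mul1r scale1r scaler0 mul0c !addr0.
Qed.

Lemma umul1r : right_id uone umul.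
Proof.
by move=> [a x]; rewrite /umul /pmul /= mulr1 scale1r scaler0 cmul0 add0r addr0.
Qed.

Lemma umulDl : left_distributive umul +%R.
Proof.
move=> [a x] [b y] [c z]; rewrite /umul /pmul /=; congr (_, _); first exact: mulrDl.
rewrite !(scalerDr, scalerDl, cmulDl) !addrA.
by rewrite /= ?addrA [LHS](ACl (1*3*5*2*4*6)%AC).
Qed.

Lemma umulDr : right_distributive umul +%R.
Proof.
move=> [a x] [b y] [c z]; rewrite /umul /pmul /=; congr (_, _); first exact: mulrDr.
rewrite !(scalerDr, scalerDl, cmulDr) !addrA.
by rewrite /= ?addrA [LHS](ACl (1*3*5*2*4*6)%AC).
Qed.

HB.instance Definition _ :=
  GRing.Zmodule_isPzRing.Build U umulA umul1l umul1r umulDl umulDr.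

Definition uadj (u : U) : U := (sconj u.1, cadj u.2).

End Ring.

Definition umap (A B : cstar R k) (f : star_hom A B)
  (u : unitization A) : unitization B := (u.1, f u.2).

Lemma umapM A B (f : star_hom A B) u v : umap f (u * v) = umap f u * umap f v.
Proof.
by rewrite /umap /GRing.mul /= /umul /pmul /= !shomD !shomZ shomM.
Qed.

Lemma umapD A B (f : star_hom A B) u v : umap f (u + v) = umap f u + umap f v.
Proof. by rewrite /umap /= shomD. Qed.

Lemma umap0 A B (f : star_hom A B) : umap f 0 = 0.
Proof. by rewrite /umap /= shom0. Qed.

Lemma umap_adj A B (f : star_hom A B) u : umap f (uadj u) = uadj (umap f u).
Proof. by rewrite /umap /uadj /= shom_adj. Qed.

End Unitization.

Definition cmulmx (R : realType) (k : scalars) (A : cstar R k) p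
    (U V : 'M[A]_p) : 'M[A]_p :=
  \matrix_(i, j) \sum_l cmul (U i l) (V l j).

Definition cadjmx (R : realType) (k : scalars) (A : cstar R k) p
    (U : 'M[A]_p) : 'M[A]_p :=
  map_mx (@cadj R k A) U^T.

(* The completion of colim_p M_p(A) along the upper left corner inclusions.
   Each M_p(A) has exactly one C*-norm, for which every injective
   star-homomorphism is isometric; hence a completion of the colimit is a
   C*-algebra with compatible injective star-homomorphisms from the M_p(A) whose
   ranges have a dense union. *)
Record stabilization (R : realType) (k : scalars) (A : cstar R k) := Stabilization {
  stab :> cstar R k;
  stab_in : forall p, 'M[A]_p -> stab;
  stab_in_inj : forall p, injective (@stab_in p);
  stab_inD : forall p (U V : 'M[A]_p), stab_in (U + V) = stab_in U + stab_in V;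
  stab_inZ : forall p (c : fld R k) (U : 'M[A]_p),
    stab_in (map_mx (fun x => c *: x) U) = c *: stab_in U;
  stab_inM : forall p (U V : 'M[A]_p), stab_in (cmulmx U V) = cmul (stab_in U) (stab_in V);
  stab_in_adj : forall p (U : 'M[A]_p), stab_in (cadjmx U) = cadj (stab_in U);
  stab_in_corner : forall p (U : 'M[A]_p),
    stab_in (block_mx U 0 0 (0 : 'M_1)) = stab_in U;
  stab_in_dense : closure (\bigcup_p range (@stab_in p)) = [set: stab] }.

(* The homomorphism KA -> KB induced by phi : A -> B. *)
Definition is_induced (R : realType) (k : scalars) (A B : cstar R k)
    (KA : stabilization A) (KB : stabilization B)
    (phi : star_hom A B) (psi : star_hom KA KB) : Prop :=
  continuous psi /\
  forall p (U : 'M[A]_p), psi (stab_in KA U) = stab_in KB (map_mx phi U).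

(* The q x q corner of f U f^*, where U is in the p x p corner. *)
Definition mxconj (R : realType) (k : scalars) (A : cstar R k)
    (f : Rinf R -> Rinf R) q p (U : 'M[A]_p) : 'M[A]_q :=
  \matrix_(i, j) \sum_(l < p) \sum_(l' < p)
    of_real k ((f 'X^l)`_i * (f 'X^l')`_j) *: U l l'.

(* Conjugation by f on the factor of compact operators: the unique continuous map
   given by f U f^* on matrices.  It exists since, for f a linear isometry, the
   C*-identity shows that U |-> f U f^* is isometric.  The bound on the sizes says
   that f maps the span of the first p basis vectors into that of the first q. *)
Definition is_kconj (R : realType) (k : scalars) (A : cstar R k)
    (KA : stabilization A) (f : Rinf R -> Rinf R) (c : KA -> KA) : Prop :=
  continuous c /\
  forall p q (U : 'M[A]_p),
    (forall l, (l < p)%N -> (size (f 'X^l : {poly R}) <= q)%N) ->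
    c (stab_in KA U) = stab_in KA (mxconj f q U).

Definition kconj (R : realType) (k : scalars) (A : cstar R k)
    (KA : stabilization A) (f : Rinf R -> Rinf R) : KA -> KA :=
  xget (id : KA -> KA) [set c : KA -> KA | is_kconj f c].

Arguments kconj {R k A} KA f _.

Section Matrices.
Variables (R : realType) (k : scalars).
Implicit Type B : cstar R k.

Definition gmx B := {d : nat * nat & 'M[unitization B]_(d.1, d.2)}.
HB.instance Definition _ B := Topological.on (gmx B).

Definition GMx B p q (U : 'M[unitization B]_(p, q)) : gmx B := existT _ (p, q) U.

Definition nrow B (U : gmx B) : nat := (projT1 U).1.

Definition ncol B (U : gmx B) : nat := (projT1 U).2.

Definition mat B (U : gmx B) : 'M[unitization B]_(nrow U, ncol U) := projT2 U.

(* The matrix product when ncol V = nrow U; irrelevant otherwise. *)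
Definition gmul B (V U : gmx B) : gmx B :=
  GMx (mat V *m conform_mx (0 : 'M_(ncol V, ncol U)) (mat U)).

Definition gadj B (U : gmx B) : gmx B := GMx (map_mx (@uadj R k B) (mat U)^T).

Definition gmap B B' (f : star_hom B B') (U : gmx B) : gmx B' :=
  GMx (map_mx (umap f) (mat U)).

(* [gadj P = P] entails that P is square. *)
Definition is_proj B (P : gmx B) : Prop := gadj P = P /\ gmul P P = P.

(* The morphisms P -> Q are the U with U^* U = P and U U^* = Q, so the matrices
   that are morphisms between some projections are these: *)
Definition is_pisom B (U : gmx B) : Prop :=
  is_proj (gmul (gadj U) U) /\ is_proj (gmul U (gadj U)).

Definition pr_ob B := set_type [set P : gmx B | is_proj P].

Definition pr_mor B := set_type [set U : gmx B | is_pisom U].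
HB.instance Definition _ B := Topological.on (pr_ob B).
HB.instance Definition _ B := Topological.on (pr_mor B).

Definition obmx B (P : pr_ob B) : gmx B := set_val P.

Definition mormx B (U : pr_mor B) : gmx B := set_val U.

End Matrices.

(* [cat_cmp V U] is meaningful only when [cat_src V = cat_tgt U]. *)
Record cat_data := CatData {
  cat_ob : topologicalType;
  cat_mor : topologicalType;
  cat_src : cat_mor -> cat_ob;
  cat_tgt : cat_mor -> cat_ob;
  cat_id : cat_ob -> cat_mor;
  cat_cmp : cat_mor -> cat_mor -> cat_mor }.

Record is_topcat (C : cat_data) : Prop := IsTopCat {
  cat_src_cont : continuous (@cat_src C);
  cat_tgt_cont : continuous (@cat_tgt C);
  cat_id_cont : continuous (@cat_id C);
  cat_cmp_cont :
    {within [set z : cat_mor C * cat_mor C | cat_src z.1 = cat_tgt z.2],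
      continuous (fun z => cat_cmp z.1 z.2)};
  cat_src_id : forall P : cat_ob C, cat_src (cat_id P) = P;
  cat_tgt_id : forall P : cat_ob C, cat_tgt (cat_id P) = P;
  cat_src_cmp : forall V U : cat_mor C,
    cat_src V = cat_tgt U -> cat_src (cat_cmp V U) = cat_src U;
  cat_tgt_cmp : forall V U : cat_mor C,
    cat_src V = cat_tgt U -> cat_tgt (cat_cmp V U) = cat_tgt V;
  cat_idl : forall U : cat_mor C, cat_cmp (cat_id (cat_tgt U)) U = U;
  cat_idr : forall U : cat_mor C, cat_cmp U (cat_id (cat_src U)) = U;
  cat_cmpA : forall W V U : cat_mor C,
    cat_src W = cat_tgt V -> cat_src V = cat_tgt U ->
    cat_cmp W (cat_cmp V U) = cat_cmp (cat_cmp W V) U }.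

Section MurrayVonNeumann.
Variables (R : realType) (k : scalars).
Implicit Type B : cstar R k.

Definition pr_src B (U : pr_mor B) : pr_ob B :=
  SigSub (mem_set (set_valP U).1).

Definition pr_tgt B (U : pr_mor B) : pr_ob B :=
  SigSub (mem_set (set_valP U).2).

Lemma pr_id_subproof B (P : pr_ob B) : is_pisom (obmx P).
Proof.
have [Pa PP] : is_proj (obmx P) := set_valP P.
by split; rewrite Pa PP; split.
Qed.

Definition pr_id B (P : pr_ob B) : pr_mor B := SigSub (mem_set (pr_id_subproof P)).

Definition pr_cmp B (V U : pr_mor B) : pr_mor B := 
  insubd (V : set_type _) (gmul (mormx V) (mormx U)).

(* The Murray-von Neumann category of the unitization of B. *)
Definition pr B : cat_data := CatData (@pr_src B) (@pr_tgt B) (@pr_id B) (@pr_cmp B).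

Section Functoriality.
Variables (B B' : cstar R k) (f : star_hom B B').

Lemma gmapM (V U : gmx B) :
  ncol V = nrow U -> gmap f (gmul V U) = gmul (gmap f V) (gmap f U).
Proof.
case: V => [[r q] V]; case: U => [[q' p] U]; rewrite /ncol /nrow /= => e.
case: q' / e U => U; congr existT; rewrite /mat /= !conform_mx_id.
apply/matrixP => i j; rewrite !mxE (big_morph _ (umapD f) (umap0 f)).
by apply: eq_bigr => l _; rewrite umapM !mxE.
Qed.

Lemma gmap_adj (U : gmx B) : gmap f (gadj U) = gadj (gmap f U).
Proof.
by congr existT; apply/matrixP => i j; rewrite !mxE umap_adj.
Qed.

Lemma gmap_proj (P : gmx B) : is_proj P -> is_proj (gmap f P).
Proof.
move=> [Pa PP]; split; first by rewrite -gmap_adj Pa.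
by rewrite -gmapM ?PP // -{1}Pa.
Qed.

Lemma gmap_pisom (U : gmx B) : is_pisom U -> is_pisom (gmap f U).
Proof.
by move=> [UP UQ]; split; rewrite -gmap_adj -gmapM //; exact: gmap_proj.
Qed.

(* The functor pr_B -> pr_B' induced by f. *)
Definition pr_map_ob (P : pr_ob B) : pr_ob B' :=
  SigSub (mem_set (gmap_proj (set_valP P))).

Definition pr_map_mor (U : pr_mor B) : pr_mor B' :=
  SigSub (mem_set (gmap_pisom (set_valP U))).

End Functoriality.

End MurrayVonNeumann.

(* Only the two operads below are used, so the operad laws are not recorded. *)
Record operad_data := OperadData {
  op_sp :> nat -> topologicalType;
  op_id : op_sp 1;
  op_cmp : forall m (n : 'I_m -> nat),
    op_sp m -> (forall i, op_sp (n i)) -> op_sp (\sum_i n i);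
  op_act : forall m n, op_sp n -> ordbij m n -> op_sp m }.

Definition comm_operad : operad_data :=
  @OperadData (fun=> discrete_topology unit : topologicalType) (tt : unit) (fun _ _ _ _ => tt) (fun _ _ _ _ => tt).

Definition lin_operad (R : realType) : operad_data :=
  @OperadData (fun m => lin_isom R m : topologicalType) (li_id R) (@li_comp R) (@li_act R).

(* [gob f] and [gmor f] are the object and morphism maps of the functor of f; as the
   operad has only identity morphisms, joint functoriality is functoriality for
   each f together with joint continuity.  [gtau f s P] is the component at P of
   the natural isomorphism of s, from [gob (f . s) P] to [gob f (P \o s^-1)]. *)
Record gcat (G : operad_data) (C : cat_data) := GCat {
  gcat_topcat : is_topcat C;
  gob : forall m, G m -> ('I_m -> cat_ob C) -> cat_ob C;
  gmor : forall m, G m -> ('I_m -> cat_mor C) -> cat_mor C;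
  gob_cont : forall m,
    continuous (fun z : G m * {ptws 'I_m -> cat_ob C} => gob z.1 z.2);
  gmor_cont : forall m,
    continuous (fun z : G m * {ptws 'I_m -> cat_mor C} => gmor z.1 z.2);
  gmor_src : forall m (f : G m) (U : 'I_m -> cat_mor C),
    cat_src (gmor f U) = gob f (fun i => cat_src (U i));
  gmor_tgt : forall m (f : G m) (U : 'I_m -> cat_mor C),
    cat_tgt (gmor f U) = gob f (fun i => cat_tgt (U i));
  gmor_id : forall m (f : G m) (P : 'I_m -> cat_ob C),
    gmor f (fun i => cat_id (P i)) = cat_id (gob f P);
  gmor_cmp : forall m (f : G m) (V U : 'I_m -> cat_mor C),
    (forall i, cat_src (V i) = cat_tgt (U i)) ->
    gmor f (fun i => cat_cmp (V i) (U i)) = cat_cmp (gmor f V) (gmor f U);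
  gtau : forall m n, G n -> ordbij m n -> ('I_m -> cat_ob C) -> cat_mor C;
  gtau_cont : forall m n (s : ordbij m n),
    continuous (fun z : G n * {ptws 'I_m -> cat_ob C} => gtau z.1 s z.2);
  gtau_src : forall m n (f : G n) (s : ordbij m n) (P : 'I_m -> cat_ob C),
    cat_src (gtau f s P) = gob (op_act f s) P;
  gtau_tgt : forall m n (f : G n) (s : ordbij m n) (P : 'I_m -> cat_ob C),
    cat_tgt (gtau f s P) = gob f (fun i => P (ordbij_inv s i));
  gtau_nat : forall m n (f : G n) (s : ordbij m n) (U : 'I_m -> cat_mor C),
    cat_cmp (gtau f s (fun i => cat_tgt (U i))) (gmor (op_act f s) U) =
    cat_cmp (gmor f (fun i => U (ordbij_inv s i))) (gtau f s (fun i => cat_src (U i)));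
  gtau_iso : forall m n (f : G n) (s : ordbij m n) (P : 'I_m -> cat_ob C),
    exists V : cat_mor C,
      [/\ cat_src V = cat_tgt (gtau f s P), cat_tgt V = cat_src (gtau f s P),
          cat_cmp V (gtau f s P) = cat_id (cat_src (gtau f s P)) &
          cat_cmp (gtau f s P) V = cat_id (cat_tgt (gtau f s P))];
  gob_op_cmp : forall m (n : 'I_m -> nat) (f : G m) (g : forall i, G (n i))
      (P : 'I_(\sum_i n i) -> cat_ob C),
    gob (op_cmp f g) P = gob f (fun i => gob (g i) (fun j => P (tagnat.Rank i j)));
  gmor_op_cmp : forall m (n : 'I_m -> nat) (f : G m) (g : forall i, G (n i))
      (U : 'I_(\sum_i n i) -> cat_mor C),
    gmor (op_cmp f g) U = gmor f (fun i => gmor (g i) (fun j => U (tagnat.Rank i j)));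
  gob_op_id : forall P : cat_ob C, gob (op_id G) (fun=> P) = P;
  gmor_op_id : forall U : cat_mor C, gmor (op_id G) (fun=> U) = U;
  gtau_cmp : forall m n p (f : G p) (t : ordbij n p) (s : ordbij m n) (P : 'I_m -> cat_ob C),
    cat_cmp (gtau f t (fun i => P (ordbij_inv s i))) (gtau (op_act f t) s P) =
    gtau f (ordbij_comp t s) P;
  gtau_id : forall m (f : G m) (P : 'I_m -> cat_ob C),
    gtau f (ordbij_id m) P = cat_id (gob f P) }.

Record lperm (R : realType) (C : cat_data) := LPerm {
  oplus : gcat comm_operad C;
  otimes : gcat (lin_operad R) C;
  ldelta : forall m (f : lin_isom R m) (a : 'I_m -> nat),
    (forall i, 'I_(a i) -> cat_ob C) -> cat_mor C;
  ldelta_cont : forall m (a : 'I_m -> nat),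
    continuous (fun z : lin_isom R m * {ptws {i : 'I_m & 'I_(a i)} -> cat_ob C} =>
      ldelta z.1 (fun i x => z.2 (existT _ i x)));
  ldelta_src : forall m (f : lin_isom R m) (a : 'I_m -> nat)
      (P : forall i, 'I_(a i) -> cat_ob C),
    cat_src (ldelta f P) = gob otimes f (fun i => gob oplus tt (P i));
  ldelta_tgt : forall m (f : lin_isom R m) (a : 'I_m -> nat)
      (P : forall i, 'I_(a i) -> cat_ob C),
    cat_tgt (ldelta f P) =
    gob oplus tt (fun X : 'I_(\prod_i a i) => gob otimes f (fun i => P i (mdigit X i)));
  ldelta_nat : forall m (f : lin_isom R m) (a : 'I_m -> nat)
      (U : forall i, 'I_(a i) -> cat_mor C),
    cat_cmp (ldelta f (fun i x => cat_tgt (U i x)))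
      (gmor otimes f (fun i => gmor oplus tt (U i))) =
    cat_cmp
      (gmor oplus tt
        (fun X : 'I_(\prod_i a i) => gmor otimes f (fun i => U i (mdigit X i))))
      (ldelta f (fun i x => cat_src (U i x)));
  lzero_ob : forall m (f : lin_isom R m) (a : 'I_m -> nat)
      (P : forall i, 'I_(a i) -> cat_ob C) (Q : 'I_0 -> cat_ob C),
    (exists i, a i = 0%N) ->
    gob otimes f (fun i => gob oplus tt (P i)) = gob oplus tt Q;
  lzero_mor : forall m (f : lin_isom R m) (a : 'I_m -> nat)
      (U : forall i, 'I_(a i) -> cat_mor C) (V : 'I_0 -> cat_mor C),
    (exists i, a i = 0%N) ->
    gmor otimes f (fun i => gmor oplus tt (U i)) = gmor oplus tt V;
  ldelta_oplus : forall m (f : lin_isom R m) (a b : 'I_m -> nat)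
      (s : forall i, ordbij (a i) (b i)) (P : forall i, 'I_(a i) -> cat_ob C),
    cat_cmp
      (gtau oplus tt (prod_bij s) (fun X => gob otimes f (fun i => P i (mdigit X i))))
      (ldelta f P) =
    cat_cmp
      (ldelta f (fun i y => P i (ordbij_inv (s i) y)))
      (gmor otimes f (fun i => gtau oplus tt (s i) (P i)));
  ldelta_otimes : forall m n (f : lin_isom R n) (s : ordbij m n) (a : 'I_m -> nat)
      (P : forall i, 'I_(a i) -> cat_ob C),
    cat_cmp
      (gtau oplus tt (prod_perm s a)
        (fun X => gob otimes f (fun j => P (ordbij_inv s j) (mdigit X (ordbij_inv s j)))))
      (cat_cmp
        (gmor oplus tt
          (fun X : 'I_(\prod_i a i) => gtau otimes f s (fun i => P i (mdigit X i))))
        (ldelta (li_act f s) P)) =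
    cat_cmp
      (ldelta f (fun j => P (ordbij_inv s j)))
      (gtau otimes f s (fun i => gob oplus tt (P i)));
  ldelta_ldelta : forall m (f : lin_isom R m) (a : 'I_m -> nat)
      (b : forall i, 'I_(a i) -> nat) (P : forall i x, 'I_(b i x) -> cat_ob C),
    cat_cmp
      (gmor oplus tt
        (fun X : 'I_(\prod_i a i) => ldelta f (fun i => P i (mdigit X i))))
      (ldelta f (fun i x => gob oplus tt (P i x))) =
    cat_cmp
      (gtau oplus tt (distr_bij b)
        (fun k => gob otimes f
          (fun i => P i (tagnat.sig1 (mdigit k i)) (tagnat.sig2 (mdigit k i)))))
      (ldelta f (fun i (z : 'I_(\sum_x b i x)) =>
        P i (tagnat.sig1 z) (tagnat.sig2 z))) }.

(* Continuous functors (FO, FM) that preserve the whole structure strictly. *)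
Record lperm_morphism (R : realType) (C D : cat_data) (S : lperm R C) (T : lperm R D)
    (FO : cat_ob C -> cat_ob D) (FM : cat_mor C -> cat_mor D) : Prop := LPermMorphism {
  lmor_ob_cont : continuous FO;
  lmor_mor_cont : continuous FM;
  lmor_src : forall U, cat_src (FM U) = FO (cat_src U);
  lmor_tgt : forall U, cat_tgt (FM U) = FO (cat_tgt U);
  lmor_id : forall P, FM (cat_id P) = cat_id (FO P);
  lmor_cmp : forall V U, cat_src V = cat_tgt U ->
    FM (cat_cmp V U) = cat_cmp (FM V) (FM U);
  lmor_oplus_ob : forall a (P : 'I_a -> cat_ob C),
    FO (gob (oplus S) tt P) = gob (oplus T) tt (fun x => FO (P x));
  lmor_oplus_mor : forall a (U : 'I_a -> cat_mor C),
    FM (gmor (oplus S) tt U) = gmor (oplus T) tt (fun x => FM (U x));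
  lmor_oplus_tau : forall a b (s : ordbij a b) (P : 'I_a -> cat_ob C),
    FM (gtau (oplus S) tt s P) = gtau (oplus T) tt s (fun x => FO (P x));
  lmor_otimes_ob : forall m (f : lin_isom R m) (P : 'I_m -> cat_ob C),
    FO (gob (otimes S) f P) = gob (otimes T) f (fun i => FO (P i));
  lmor_otimes_mor : forall m (f : lin_isom R m) (U : 'I_m -> cat_mor C),
    FM (gmor (otimes S) f U) = gmor (otimes T) f (fun i => FM (U i));
  lmor_otimes_tau : forall m n (f : lin_isom R n) (s : ordbij m n) (P : 'I_m -> cat_ob C),
    FM (gtau (otimes S) f s P) = gtau (otimes T) f s (fun i => FO (P i));
  lmor_delta : forall m (f : lin_isom R m) (a : 'I_m -> nat)
      (P : forall i, 'I_(a i) -> cat_ob C),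
    FM (ldelta S f P) = ldelta T f (fun i x => FO (P i x)) }.

Section Operations.
Variables (R : realType) (k : scalars).

Definition bijmx (B : cstar R k) p q (s : ordbij p q) : gmx B :=
  GMx (\matrix_(mu < q, nu < p) (mu == s nu)%:R).

(* [conform_mx] only casts here, as y is equal to x where it is used. *)
Definition mxoplus (B : cstar R k) a (U : 'I_a -> gmx B) : gmx B :=
  GMx (\mxblock_(x < a, y < a)
    if x == y then conform_mx (0 : 'M_(nrow (U x), ncol (U y))) (mat (U x)) else 0).

Definition mxotimes (A : cstar R k) (KA : stabilization A) m (f : lin_isom R m)
    (U : 'I_m -> gmx KA) : gmx KA :=
  GMx (\matrix_(mu < \prod_i nrow (U i), nu < \prod_i ncol (U i))
    let u i := mat (U i) (mdigit mu i) (mdigit nu i) in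
    ((\prod_i (u i).1,
      \sum_i (\prod_(j | j != i) (u j).1) *: kconj KA (licomp f i) (u i).2)
     : unitization KA)).

End Operations.

(* Main.v *)
Require Import Defs.
From HB Require Import structures.
From mathcomp Require Import all_boot all_order all_algebra.
From mathcomp Require Import ring complex.
From mathcomp Require Import boolp classical_sets functions reals.
From mathcomp Require Import topology normedtype.
Set Implicit Arguments.
Unset Strict Implicit.
Unset Printing Implicit Defensive.
Import Order.TTheory GRing.Theory Num.Theory numFieldNormedType.Exports.

(** Conjugation by a linear isometry f of R^infty is isometric on each matrix corner
    of the stabilization, by the C*-identity, and compatible with the inclusions of
    corners; so it extends to the completion ([kconj_ex]).  The extension is a
    homomorphism, it is functorial in f, and it depends jointly continuously on f and
    on the element ([kconj_joint]): on a matrix, the difference of two conjugations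
    is bounded through a Gram matrix of inner products in R^infty ([kconj_near]).
    Conjugates by orthogonal isometries annihilate each other.

    Hence the formula for an entry of a tensor product is the product, over the
    factors, of conjugated elements of the unitization ([tensu_prod]), and it
    respects products, sums and adjoints.  So direct sums and tensor products of
    matrices respect matrix products and adjoints.  They restrict to projections,
    and also to partial isometries, because these are the matrices U with U U^* U = U
    ([is_pisomE]).  The latter rests on the fact that X^* X = 0 implies X = 0 for
    matrices over the unitization ([definite_stab]), which follows from a monotonicity
    of the norm that is obtained by stacking matrices inside a larger corner
    ([norm_stm_sum]).

    All structure maps are permutation matrices times identity morphisms.  By
    equivariance ([bijm_intertwine], [distr_entry]) they are natural isomorphisms with
    the stated sources and targets, and the coherence laws become identities between
    bijections of index sets ([distr_prod_bij], [distr_prod_perm], [distr_distr]).  The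
    laws that must hold strictly, such as compatibility with operad composition,
    regroup indices in a way that respects the lexicographic orders; since finite
    chains are rigid ([homo_ord_val]), nothing moves.

    Spaces of matrices are the disjoint unions over all dimensions.  Hence continuity is
    continuity of the entries with fixed dimensions ([cvg_gmx]).  A
    homomorphism that is induced on the stabilizations commutes with the conjugations
    and fixes scalars, hence preserves the whole structure. *)

(** * Lexicographic enumerations *)

(** Strict equalities between regrouped direct sums or tensor products rest on this
    rigidity of finite chains: a regrouping of indices that respects the lexicographic
    orders moves no number, so it leaves matrices unchanged. *)
Lemma homo_ord_val m n (f : 'I_m -> 'I_n) : m = n ->
  (forall k l : 'I_m, (k < l)%N -> (f k < f l)%N) -> forall k, f k = k :> nat.
Proof.
move=> e; case: n / e f => f hf k.
suff -> : f =1 id by [].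
apply: (Order.mono_unique (f := f) (g := id)) => //; first exact: le_total.
by apply: le_mono => i j; exact: hf.
Qed.

(** The first difference decides.  The range is an arbitrary increasing list because
    the induction removes its head. *)
Lemma lt_lexi_map (r : seq nat) (f g : nat -> nat) : sorted ltn r ->
  (([seq f i | i <- r] : seqlexi nat) < [seq g i | i <- r])%O <->
  exists i, [/\ i \in r, (f i < g i)%N &
                forall j, j \in r -> (j < i)%N -> f j = g j].
Proof.
elim: r => [|x r IH] sr; first by split=> // -[i []].
have gtx : {in r, forall y, (x < y)%N}.
  by have := order_path_min ltn_trans sr => /allP.
have {}IH := IH (path_sorted sr).
rewrite /= ltxi_cons leEnat; split.
- case: ltngtP => //= [lfg _|efg /IH[i [ir lti lt]]].
    exists x; split=> //; first exact: mem_head.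
    move=> j; rewrite inE => /orP[/eqP->|/gtx xj jx]; first by rewrite ltnn.
    by have := ltn_trans xj jx; rewrite ltnn.
  exists i; split=> //; first by rewrite inE ir orbT.
  by move=> j; rewrite inE => /orP[/eqP-> _ //|]; exact: lt.
- case=> i [+ lti lt]; rewrite inE => /orP[/eqP ix|ir].
    by rewrite -ix (ltnW lti) leqNgt lti.
  have -> : f x = g x by apply: lt; [exact: mem_head | exact: gtx].
  rewrite leqnn /=; apply/IH; exists i; split=> // j jr.
  by apply: lt; rewrite inE jr orbT.
Qed.

Section Mcode.
Variables (m : nat) (p : 'I_m -> nat).

Lemma ltn_mdigitP (k l : 'I_(\prod_i p i)) :
  (k < l)%N <-> exists i : 'I_m, (mdigit k i < mdigit l i)%N /\
    forall j : 'I_m, (j < i)%N -> mdigit k j = mdigit l j.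
Proof.
pose d (k : 'I_(\prod_i p i)) (i : nat) : nat :=
  if insub i is Some i' then val (mdigit k i') else 0%N.
have dE k' (i : 'I_m) : d k' i = mdigit k' i by rewrite /d valK.
have seqE k' : lexseq (mdigit k') = [seq d k' i | i <- iota 0 m].
  by rewrite /lexseq -val_enum_ord -map_comp; apply: eq_map => i /=; rewrite dE.
have -> : (k < l)%N = (lexseq (mdigit k) < lexseq (mdigit l))%O.
  transitivity (k < l)%O; first by [].
  by rewrite !ltNge -le_mdigit.
rewrite !seqE; split.
- move/(lt_lexi_map _ _ (iota_ltn_sorted 0 m)) => [i []].
  rewrite mem_iota /= add0n => im; pose i' := Ordinal im.
  have -> : i = val i' by []; rewrite !dE => lti lt; exists i'; split=> // j ji.
  by have := lt j; rewrite mem_iota /= add0n ltn_ord !dE => /(_ isT ji)/val_inj.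
- move=> [i [lti lt]].
  apply/(lt_lexi_map _ _ (iota_ltn_sorted 0 m)); exists (val i); split=> [||j].
  + by rewrite mem_iota /= add0n.
  + by rewrite !dE.
  + rewrite mem_iota /= add0n => jm ji; have -> : j = val (Ordinal jm) by []; rewrite !dE.
    by rewrite lt.
Qed.

Lemma mdigit_inj (k l : 'I_(\prod_i p i)) :
  (forall i, mdigit k i = mdigit l i :> nat) -> k = l.
Proof. by move=> e; rewrite -[k]mcodeK -[l]mcodeK; apply: eq_mcode => i; exact/val_inj/e. Qed.

End Mcode.

(** Index types depend on dimensions that are often equal only provably; comparing
    the underlying numbers, here and below, avoids casts. *)
Lemma mcode_val m (p p' : 'I_m -> nat) (mu : forall i, 'I_(p i))
    (nu : forall i, 'I_(p' i)) :
  p =1 p' -> (forall i, mu i = nu i :> nat) -> mcode mu = mcode nu :> nat.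
Proof.
move=> /funext e; case: p' / e nu => nu e.
by congr val; apply: eq_mcode => i; exact/val_inj/e.
Qed.

Lemma mdigit_val m (p p' : 'I_m -> nat) (k : 'I_(\prod_i p i))
    (l : 'I_(\prod_i p' i)) i :
  p =1 p' -> k = l :> nat -> mdigit k i = mdigit l i :> nat.
Proof. by move=> /funext e; case: p' / e l => l /val_inj->. Qed.

Lemma Rank_val a (p p' : 'I_a -> nat) x x' (mu : 'I_(p x)) (nu : 'I_(p' x')) :
  p =1 p' -> x = x' -> mu = nu :> nat ->
  tagnat.Rank x mu = tagnat.Rank x' nu :> nat.
Proof.
move=> /funext e; case: p' / e nu => nu e; case: x' / e nu => nu /val_inj->.
by [].
Qed.

Lemma sig1_val a (p p' : 'I_a -> nat) (k : 'I_(\sum_x p x)) (l : 'I_(\sum_x p' x)) :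
  p =1 p' -> k = l :> nat -> tagnat.sig1 k = tagnat.sig1 l.
Proof. by move=> /funext e; case: p' / e l => l /val_inj->. Qed.

Lemma sig2_val a (p p' : 'I_a -> nat) (k : 'I_(\sum_x p x)) (l : 'I_(\sum_x p' x)) :
  p =1 p' -> k = l :> nat -> tagnat.sig2 k = tagnat.sig2 l :> nat.
Proof. by move=> /funext e; case: p' / e l => l /val_inj->. Qed.

Lemma Rank2_val a (p : 'I_a -> nat) x (mu : 'I_(p x)) :
  tagnat.sig2 (tagnat.Rank x mu) = mu :> nat.
Proof. by rewrite tagnat.Rank2K. Qed.

Lemma ltn_RankE a (p : 'I_a -> nat) x x' (mu : 'I_(p x)) (nu : 'I_(p x')) :
  (tagnat.Rank x mu < tagnat.Rank x' nu)%N =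
  (x < x')%N || (x == x') && (mu < nu)%N.
Proof.
transitivity (tagnat.Rank x mu < tagnat.Rank x' nu)%O; first by [].
rewrite /tagnat.Rank tagnat.lt_rank Order.SigmaOrder.Exports.ltEsig /= leEord.
case: ltngtP => //= [gxx|/val_inj exx].
- by have -> : (x == x') = false by apply/eqP => exx; rewrite exx ltnn in gxx.
- by case: x' / exx nu => nu; rewrite eqxx /= tagged_asE.
Qed.

Lemma ltn_sumE a (p : 'I_a -> nat) (k l : 'I_(\sum_x p x)) :
  (k < l)%N = (tagnat.sig1 k < tagnat.sig1 l)%N ||
    (tagnat.sig1 k == tagnat.sig1 l) && (tagnat.sig2 k < tagnat.sig2 l)%N.
Proof. by rewrite -ltn_RankE !tagnat.sig2K. Qed.

Section NestedSums.
Variables (m : nat) (n : 'I_m -> nat) (p : 'I_(\sum_i n i) -> nat).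

Lemma sumn_nested : (\sum_s p s = \sum_i \sum_(j < n i) p (tagnat.Rank i j))%N.
Proof.
rewrite (reindex _ (@tagnat.rank_bij_on m n)) /= sig_big_dep /=.
by apply: eq_bigr => s _; rewrite tagnat.rankE.
Qed.

Lemma prodn_nested : (\prod_s p s = \prod_i \prod_(j < n i) p (tagnat.Rank i j))%N.
Proof.
rewrite (reindex _ (@tagnat.rank_bij_on m n)) /= sig_big_dep /=.
by apply: eq_bigr => s _; rewrite tagnat.rankE.
Qed.

Definition sum_nest (k : 'I_(\sum_s p s)) :
    'I_(\sum_i \sum_(j < n i) p (tagnat.Rank i j)) :=
  @tagnat.Rank m (fun i => \sum_(j < n i) p (tagnat.Rank i j))%N
    (tagnat.sig1 (tagnat.sig1 k))
    (@tagnat.Rank _ (fun j => p (tagnat.Rank (tagnat.sig1 (tagnat.sig1 k)) j))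
      (tagnat.sig2 (tagnat.sig1 k))
      (cast_ord (congr1 p (esym (tagnat.sig2K (tagnat.sig1 k)))) (tagnat.sig2 k))).

Lemma ltn_RankRankE i i' (j : 'I_(n i)) (j' : 'I_(n i'))
    (mu : 'I_(p (tagnat.Rank i j))) (nu : 'I_(p (tagnat.Rank i' j'))) :
  (@tagnat.Rank m (fun i => \sum_(j < n i) p (tagnat.Rank i j))%N i
     (@tagnat.Rank _ (fun j => p (tagnat.Rank i j)) j mu) <
   @tagnat.Rank m (fun i => \sum_(j < n i) p (tagnat.Rank i j))%N i'
     (@tagnat.Rank _ (fun j => p (tagnat.Rank i' j)) j' nu))%N =
  (i < i')%N || (i == i') && ((j < j')%N || (j == j' :> nat) && (mu < nu)%N).
Proof.
rewrite ltn_RankE; case: eqP => // e; case: i' / e j' nu => j' nu.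
by rewrite ltn_RankE.
Qed.

(** Grouped or not, the triples of digits are ordered lexicographically. *)
Lemma sum_nest_val k : sum_nest k = k :> nat.
Proof.
apply: homo_ord_val k => [|k l]; first exact: sumn_nested.
rewrite ltn_sumE /sum_nest ltn_RankRankE /= => /orP[|/andP[/eqP e lt2]].
  by rewrite ltn_sumE => /orP[->//|/andP[-> ->]]; rewrite orbT.
have -> : tagnat.sig1 (tagnat.sig1 k) == tagnat.sig1 (tagnat.sig1 l) by rewrite e.
have -> : tagnat.sig2 (tagnat.sig1 k) == tagnat.sig2 (tagnat.sig1 l) :> nat by rewrite e.
by rewrite lt2 /= !orbT.
Qed.

Definition prod_nest (k : 'I_(\prod_s p s)) :
    'I_(\prod_i \prod_(j < n i) p (tagnat.Rank i j)) :=
  @mcode m (fun i => \prod_(j < n i) p (tagnat.Rank i j))%N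
    (fun i => mcode (fun j => mdigit k (tagnat.Rank i j))).

Lemma prod_nestE k i j :
  mdigit (mdigit (prod_nest k) i) j = mdigit k (tagnat.Rank i j).
Proof. by rewrite /prod_nest mdigit_code mdigit_code. Qed.

(** Comparing block by block, and inside the first block that differs digit by digit,
    is comparing digit by digit. *)
Lemma prod_nest_val k : prod_nest k = k :> nat.
Proof.
apply: homo_ord_val k => [|k l]; first exact: prodn_nested.
move=> /ltn_mdigitP[s [lts lt]]; apply/ltn_mdigitP.
exists (tagnat.sig1 s); split=> [|i lti].
  apply/ltn_mdigitP; exists (tagnat.sig2 s); split=> [|j ltj].
    by rewrite !prod_nestE tagnat.sig2K.
  rewrite !prod_nestE lt // -[X in (_ < nat_of_ord X)%N]tagnat.sig2K ltn_RankE.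
  by rewrite eqxx ltj orbT.
apply: mdigit_inj => j; rewrite !prod_nestE lt //.
by rewrite -[X in (_ < nat_of_ord X)%N]tagnat.sig2K ltn_RankE lti.
Qed.

End NestedSums.

Lemma mcode1_val (p : nat) (k : 'I_(\prod_(i < 1) p)) : mdigit k ord0 = k :> nat.
Proof.
apply: (@homo_ord_val _ _ (fun k : 'I_(\prod_(i < 1) p) => mdigit k ord0)).
  by rewrite big_ord1.
by move=> {}k l /ltn_mdigitP[i []]; rewrite (ord1 i).
Qed.

Lemma sum1_val (p : nat) (k : 'I_(\sum_(i < 1) p)) : tagnat.sig2 k = k :> nat.
Proof. by rewrite [RHS]tagnat.rect big1 ?add0n // => i; rewrite (ord1 (tagnat.sig1 k)). Qed.

(** * Index bijections *)

Lemma sum_val_ext a (p p' : 'I_a -> nat) (k : 'I_(\sum_x p x)) (l : 'I_(\sum_x p' x)) :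
  p =1 p' -> tagnat.sig1 k = tagnat.sig1 l -> tagnat.sig2 k = tagnat.sig2 l :> nat ->
  k = l :> nat.
Proof. by move=> e e1 e2; rewrite -[k]tagnat.sig2K -[l]tagnat.sig2K; exact: Rank_val. Qed.

Lemma prod_val_ext m (p p' : 'I_m -> nat) (k : 'I_(\prod_i p i)) (l : 'I_(\prod_i p' i)) :
  p =1 p' -> (forall i, mdigit k i = mdigit l i :> nat) -> k = l :> nat.
Proof. by move=> e ed; rewrite -[k]mcodeK -[l]mcodeK; exact: mcode_val. Qed.

Lemma ordbij_eq p q (s : ordbij p q) : p = q.
Proof. by have := bij_eq_card (ordbij_funP s); rewrite !card_ord. Qed.

Lemma ordbij_inv_comp m n p (t : ordbij n p) (s : ordbij m n) z :
  ordbij_inv (ordbij_comp t s) z = ordbij_inv s (ordbij_inv t z).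
Proof.
apply: (bij_inj (ordbij_funP (ordbij_comp t s))).
by rewrite /= !ordbij_inv_funKV; exact: (ordbij_inv_funKV (ordbij_comp t s)).
Qed.

Lemma ordbij_inv_id m z : ordbij_inv (ordbij_id m) z = z.
Proof. by rewrite -{2}[z](ordbij_inv_funKV (ordbij_id m)). Qed.

Lemma sum_bij1 a b (s : ordbij a b) (p : 'I_a -> nat) k :
  tagnat.sig1 (sum_bij s p k) = s (tagnat.sig1 k).
Proof. exact: tagnat.Rank1K. Qed.

Lemma sum_bij2 a b (s : ordbij a b) (p : 'I_a -> nat) k :
  tagnat.sig2 (sum_bij s p k) = tagnat.sig2 k :> nat.
Proof. exact: Rank2_val. Qed.

Lemma prod_permE m n (s : ordbij m n) (p : 'I_m -> nat) k j :
  mdigit (prod_perm s p k) j = mdigit k (ordbij_inv s j).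
Proof. exact: mdigit_code. Qed.

Lemma prod_bijE m (a b : 'I_m -> nat) (s : forall i, ordbij (a i) (b i)) k i :
  mdigit (prod_bij s k) i = s i (mdigit k i).
Proof. exact: mdigit_code. Qed.

Section SumMap.
Variables (a : nat) (p q : 'I_a -> nat) (t : forall x, ordbij (p x) (q x)).

Definition sum_map_fun (k : 'I_(\sum_x p x)) : 'I_(\sum_x q x) :=
  tagnat.Rank (tagnat.sig1 k) (t (tagnat.sig1 k) (tagnat.sig2 k)).

Lemma sum_map_bij : bijective sum_map_fun.
Proof.
apply: inj_card_bij.
  move=> k l /(congr1 val) /eqP; rewrite tagnat.eq_Rank => /andP[/eqP e1 /eqP e2].
  rewrite -[k]tagnat.sig2K -[l]tagnat.sig2K; move: e2.
  move: (tagnat.sig1 k) (tagnat.sig1 l) e1 (tagnat.sig2 k) (tagnat.sig2 l).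
  move=> x y e; case: y / e => mu nu /val_inj/(bij_inj (ordbij_funP (t x))).
  by move=> ->.
rewrite !card_ord leq_eqVlt; apply/orP; left; apply/eqP/eq_bigr => x _.
by have := bij_eq_card (ordbij_funP (t x)); rewrite !card_ord.
Qed.

Definition sum_map := OrdBij sum_map_bij.

Lemma sum_map1 k : tagnat.sig1 (sum_map k) = tagnat.sig1 k.
Proof. exact: tagnat.Rank1K. Qed.

Lemma sum_map2 k : tagnat.sig2 (sum_map k) = t _ (tagnat.sig2 k) :> nat.
Proof. exact: Rank2_val. Qed.

End SumMap.

Lemma distr1 m (a : 'I_m -> nat) (b : forall i, 'I_(a i) -> nat) k i :
  mdigit (tagnat.sig1 (distr_bij b k)) i = tagnat.sig1 (mdigit k i).
Proof. by rewrite /= /distr_fun tagnat.Rank1K mdigit_code. Qed.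

Lemma distr2 m (a : 'I_m -> nat) (b : forall i, 'I_(a i) -> nat) k i :
  mdigit (tagnat.sig2 (distr_bij b k)) i = tagnat.sig2 (mdigit k i) :> nat.
Proof.
have h (X : 'I_(\prod_i a i)) (u : 'I_(\prod_i b i (mdigit X i))) :
    mdigit (tagnat.sig2 (@tagnat.Rank _ (fun X => \prod_i b i (mdigit X i))%N X u)) i
    = mdigit u i :> nat.
  apply: mdigit_val => [j|]; last exact: Rank2_val.
  by rewrite tagnat.Rank1K.
by rewrite h; exact: (etrans (congr1 val (mdigit_code _ i))).
Qed.

Lemma sum_bij_comp a b c (t : ordbij b c) (s : ordbij a b) (p : 'I_a -> nat) k :
  sum_bij t (fun y => p (ordbij_inv s y)) (sum_bij s p k) =
  sum_bij (ordbij_comp t s) p k :> nat.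
Proof.
apply: sum_val_ext => [z||]; first by rewrite ordbij_inv_comp.
  by rewrite !sum_bij1.
by rewrite !sum_bij2.
Qed.

Lemma sum_bij_id a (p : 'I_a -> nat) k : sum_bij (ordbij_id a) p k = k :> nat.
Proof.
apply: sum_val_ext => [z||]; first by rewrite ordbij_inv_id.
  by rewrite sum_bij1.
by rewrite sum_bij2.
Qed.

Lemma mdigit_idx m (p : 'I_m -> nat) (k : 'I_(\prod_i p i)) i j :
  i = j -> mdigit k i = mdigit k j :> nat.
Proof. by move=> ->. Qed.

Lemma prod_perm_comp m n r (t : ordbij n r) (s : ordbij m n) (p : 'I_m -> nat) k :
  prod_perm t (fun y => p (ordbij_inv s y)) (prod_perm s p k) =
  prod_perm (ordbij_comp t s) p k :> nat.
Proof.
apply: prod_val_ext => [z|z]; first by rewrite ordbij_inv_comp.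
by rewrite !prod_permE; apply: mdigit_idx; rewrite ordbij_inv_comp.
Qed.

Lemma prod_perm_id m (p : 'I_m -> nat) k : prod_perm (ordbij_id m) p k = k :> nat.
Proof.
apply: prod_val_ext => [z|z]; first by rewrite ordbij_inv_id.
by rewrite prod_permE; apply: mdigit_idx; rewrite ordbij_inv_id.
Qed.

(** The three laws of distributivity, read on index sets: this identity, and the
    ones below for permuted factors and for iterated sums.  Structure maps are
    permutation matrices times identity morphisms, so that these identities carry
    the coherence laws of the category. *)
Lemma distr_prod_bij m (a b : 'I_m -> nat) (s : forall i, ordbij (a i) (b i))
    (p : forall i, 'I_(a i) -> nat) k :
  sum_bij (prod_bij s) (fun X => \prod_i p i (mdigit X i))%N (distr_bij p k) =
  distr_bij (fun i y => p i (ordbij_inv (s i) y))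
    (prod_bij (fun i => sum_bij (s i) (p i)) k) :> nat.
Proof.
apply: sum_val_ext => [Y||].
- apply: eq_bigr => i _; congr p.
  by rewrite -[in RHS](ordbij_inv_funKV (prod_bij s) Y) prod_bijE /= ordbij_inv_funK.
- rewrite sum_bij1; apply: mdigit_inj => i.
  by rewrite prod_bijE !distr1 prod_bijE sum_bij1.
- rewrite sum_bij2; apply: prod_val_ext => i.
  + by rewrite !distr1 prod_bijE sum_bij1 /= ordbij_inv_funK.
  + by rewrite !distr2 prod_bijE sum_bij2.
Qed.

Lemma distr_prod_perm m n (s : ordbij m n) (a : 'I_m -> nat)
    (p : forall i, 'I_(a i) -> nat) k :
  sum_bij (prod_perm s a)
    (fun X => \prod_j p (ordbij_inv s j) (mdigit X (ordbij_inv s j)))%N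
    (sum_map (fun X => prod_perm s (fun i => p i (mdigit X i))) (distr_bij p k)) =
  distr_bij (fun j => p (ordbij_inv s j)) (prod_perm s (fun i => \sum_x p i x)%N k)
  :> nat.
Proof.
apply: sum_val_ext => [Y||].
- apply: eq_bigr => j _; congr p.
  by rewrite -[in RHS](ordbij_inv_funKV (prod_perm s a) Y) prod_permE.
- rewrite sum_bij1 sum_map1; apply: mdigit_inj => j.
  by rewrite prod_permE !distr1 prod_permE.
- rewrite sum_bij2 sum_map2; apply: prod_val_ext => j.
  + by rewrite !distr1 prod_permE.
  + by rewrite prod_permE !distr2 prod_permE.
Qed.

Lemma curry_sig a (b : 'I_a -> nat) (p : forall x, 'I_(b x) -> nat) x y :
  p (tagnat.sig1 (tagnat.Rank x y)) (tagnat.sig2 (tagnat.Rank x y)) = p x y.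
Proof. by rewrite /tagnat.sig1 /tagnat.sig2 /tagnat.Rank tagnat.rankK. Qed.

(** The number has digits x, (y, mu) on one side and (x, y), mu on the other; as
    regrouping respects the order, these are the same x, y and mu. *)
Lemma nested_digits a (b : 'I_a -> nat) (p : forall x, 'I_(b x) -> nat)
    (k : 'I_(\sum_x \sum_y p x y))
    (l : 'I_(\sum_(z < \sum_x b x) p (tagnat.sig1 z) (tagnat.sig2 z))) :
  k = l :> nat ->
  [/\ tagnat.sig1 k = tagnat.sig1 (tagnat.sig1 l),
      tagnat.sig1 (tagnat.sig2 k) = tagnat.sig2 (tagnat.sig1 l) :> nat &
      tagnat.sig2 (tagnat.sig2 k) = tagnat.sig2 l :> nat].
Proof.
move=> kl; set P := fun z : 'I_(\sum_x b x) => p (tagnat.sig1 z) (tagnat.sig2 z).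
have eP x : (\sum_y p x y = \sum_y P (tagnat.Rank x y))%N.
  by apply: eq_bigr => y _; rewrite /P curry_sig.
have kn : k = @sum_nest a b P l :> nat by rewrite sum_nest_val.
have e1 : tagnat.sig1 k = tagnat.sig1 (tagnat.sig1 l).
  by rewrite (sig1_val eP kn) tagnat.Rank1K.
have e2 := etrans (sig2_val eP kn) (Rank2_val _).
have eb : b (tagnat.sig1 k) = b (tagnat.sig1 (tagnat.sig1 l)) by rewrite e1.
split=> //; move: (tagnat.sig2 k) e2; rewrite e1 => u e2.
  by rewrite (sig1_val _ e2) ?tagnat.Rank1K // => y; rewrite /P curry_sig.
by rewrite (sig2_val _ e2) ?Rank2_val // => y; rewrite /P curry_sig.
Qed.

Lemma nested_ext a (b : 'I_a -> nat) (p : forall x, 'I_(b x) -> nat)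
    (q : 'I_(\sum_x b x) -> nat)
    (k : 'I_(\sum_x \sum_y p x y)) (l : 'I_(\sum_z q z)) :
  (forall x y, p x y = q (tagnat.Rank x y)) ->
  tagnat.sig1 k = tagnat.sig1 (tagnat.sig1 l) ->
  tagnat.sig1 (tagnat.sig2 k) = tagnat.sig2 (tagnat.sig1 l) :> nat ->
  tagnat.sig2 (tagnat.sig2 k) = tagnat.sig2 l :> nat -> k = l :> nat.
Proof.
move=> e e1 e2 e3; rewrite -(sum_nest_val l).
rewrite -[k]tagnat.sig2K -[tagnat.sig2 k]tagnat.sig2K /sum_nest.
move: (tagnat.sig1 k) (tagnat.sig2 k) e1 e2 e3 => x u /esym e1; case: x / e1 u => u.
move=> e2 e3; apply: Rank_val => // [x|]; first by apply: eq_bigr => y _; rewrite e.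
by apply: Rank_val => //; exact/val_inj.
Qed.

(** Rewriting of a digit whose range depends on another digit, when the two ranges
    are not convertible. *)
Lemma dep_val (I : Type) (F : I -> nat) (G : forall x, 'I_(F x) -> nat) x x'
    (v : 'I_(F x)) (w : 'I_(F x')) : x = x' -> v = w :> nat -> G x v = G x' w.
Proof. by move=> e; case: x' / e w => w /val_inj->. Qed.

Lemma sum_map_distr m (a : 'I_m -> nat) (b : forall i, 'I_(a i) -> nat)
    (p : forall i x, 'I_(b i x) -> nat)
    (k : 'I_(\sum_(X < \prod_i a i) \prod_i \sum_y p i (mdigit X i) y)) i
    (s := sum_map (fun X => distr_bij (fun i y => p i (mdigit X i) y)) k) :
  mdigit (tagnat.sig1 (tagnat.sig2 s)) i = tagnat.sig1 (mdigit (tagnat.sig2 k) i)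
    :> nat /\
  mdigit (tagnat.sig2 (tagnat.sig2 s)) i = tagnat.sig2 (mdigit (tagnat.sig2 k) i)
    :> nat.
Proof.
have e1 := sum_map1 (fun X => distr_bij (fun i y => p i (mdigit X i) y)) k.
have e2 := sum_map2 (fun X => distr_bij (fun i y => p i (mdigit X i) y)) k.
pose F X := (\sum_(Y < \prod_i b i (mdigit X i)) \prod_i p i (mdigit X i) (mdigit Y i))%N.
split.
  rewrite -(distr1 (b := fun i y => p i (mdigit (tagnat.sig1 k) i) y)).
  exact: (dep_val (F := F) (fun X v => nat_of_ord (mdigit (tagnat.sig1 v) i)) e1 e2).
rewrite -(distr2 (b := fun i y => p i (mdigit (tagnat.sig1 k) i) y)).
exact: (dep_val (F := F) (fun X v => nat_of_ord (mdigit (tagnat.sig2 v) i)) e1 e2).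
Qed.

Lemma distr_distr m (a : 'I_m -> nat) (b : forall i, 'I_(a i) -> nat)
    (p : forall i x, 'I_(b i x) -> nat)
    (k : 'I_(\prod_i \sum_x \sum_y p i x y))
    (l : 'I_(\prod_i \sum_(z < \sum_x b i x) p i (tagnat.sig1 z) (tagnat.sig2 z))) :
  k = l :> nat ->
  sum_map (fun X => distr_bij (fun i y => p i (mdigit X i) y))
    (distr_bij (fun i x => \sum_y p i x y)%N k) =
  sum_bij (distr_bij b)
    (fun K => \prod_i p i (tagnat.sig1 (mdigit K i)) (tagnat.sig2 (mdigit K i)))%N
    (distr_bij (fun i z => p i (tagnat.sig1 z) (tagnat.sig2 z)) l) :> nat.
Proof.
move=> kl.
have eS i : (\sum_x \sum_y p i x y =
    \sum_(z < \sum_x b i x) p i (tagnat.sig1 z) (tagnat.sig2 z))%N.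
  rewrite sumn_nested; apply: eq_bigr => x _; apply: eq_bigr => y _.
  by rewrite curry_sig.
have d i := nested_digits (mdigit_val i eS kl).
have e1 : tagnat.sig1 (distr_bij (fun i x => \sum_y p i x y)%N k) =
    tagnat.sig1 (distr_bij b
      (tagnat.sig1 (distr_bij (fun i z => p i (tagnat.sig1 z) (tagnat.sig2 z)) l))).
  by apply: mdigit_inj => i; rewrite !distr1; case: (d i) => e _ _; rewrite e.
have e3 i := @sum_map_distr m a b p (distr_bij (fun i x => \sum_y p i x y)%N k) i.
have g1 i : tagnat.sig1 (mdigit (tagnat.sig2
      (distr_bij (fun i x => \sum_y p i x y)%N k)) i) =
    tagnat.sig2 (tagnat.sig1 (mdigit l i)) :> nat.
  case: (d i) => _ <- _; pose F x := (\sum_y p i x y)%N.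
  apply: (dep_val (F := F) (fun x v => nat_of_ord (tagnat.sig1 v))).
    by rewrite distr1.
  by rewrite distr2.
have g2 i : tagnat.sig2 (mdigit (tagnat.sig2
      (distr_bij (fun i x => \sum_y p i x y)%N k)) i) =
    tagnat.sig2 (mdigit l i) :> nat.
  case: (d i) => _ _ <-; pose F x := (\sum_y p i x y)%N.
  apply: (dep_val (F := F) (fun x v => nat_of_ord (tagnat.sig2 v))).
    by rewrite distr1.
  by rewrite distr2.
apply: (@nested_ext _ (fun X => \prod_i b i (mdigit X i))%N
  (fun X Y => \prod_i p i (mdigit X i) (mdigit Y i))%N).
- move=> X Y; apply: eq_bigr => i _.
  set Z := ordbij_inv _ _; pose F X := (\prod_i b i (mdigit X i))%N.
  have eZ : distr_bij b Z = tagnat.Rank X Y by exact: (ordbij_inv_funKV (distr_bij b)).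
  have e4 : tagnat.sig1 (mdigit Z i) = mdigit X i.
    by rewrite -distr1 eZ tagnat.Rank1K.
  have e5 : tagnat.sig2 (mdigit Z i) = mdigit Y i :> nat.
    rewrite -(distr2 _ i) eZ.
    exact: (dep_val (F := F) (fun X v => nat_of_ord (mdigit v i)) (tagnat.Rank1K _)
      (Rank2_val _)).
  by rewrite (dep_val (p i) e4 e5).
- by rewrite sum_map1 sum_bij1.
- rewrite sum_bij1; apply: prod_val_ext => i.
    by rewrite sum_map1 e1.
  by rewrite (e3 i).1 g1 distr2 distr1.
- rewrite sum_bij2; apply: prod_val_ext => i; last by rewrite (e3 i).2 g2 distr2.
  rewrite distr1; apply: dep_val; first by rewrite sum_map1 e1 !distr1.
  by rewrite (e3 i).1 g1.
Qed.


Local Open Scope classical_set_scope.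
Local Open Scope ring_scope.

(** * Matrices over the unitization *)

Section Conjugation.
Variables (R : realType) (k : scalars).
Local Notation K := (fld R k).

Lemma sconjK : involutive (@sconj R k).
Proof. by case: k => //= x; rewrite conjCK. Qed.

Lemma sconjD : {morph @sconj R k : x y / x + y}.
Proof. by case: k => //= x y; rewrite rmorphD. Qed.

Lemma sconj0 : sconj (0 : K) = 0.
Proof. by apply: (addrI (sconj 0)); rewrite -sconjD !addr0. Qed.

Lemma sconjM : {morph @sconj R k : x y / x * y}.
Proof. by case: k => //= x y; rewrite rmorphM. Qed.

Lemma sconj1 : sconj (1 : K) = 1.
Proof. by case: k => //=; rewrite rmorph1. Qed.

Lemma of_realD : {morph @of_real R k : x y / x + y}.
Proof. by case: k => //= x y; rewrite rmorphD. Qed.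

Lemma of_realM : {morph @of_real R k : x y / x * y}.
Proof. by case: k => //= x y; rewrite rmorphM. Qed.

Lemma of_real0 : of_real k (0 : R) = 0.
Proof. by case: k. Qed.

Lemma of_real1 : of_real k (1 : R) = 1.
Proof. by case: k. Qed.

Lemma sconj_of_real (x : R) : sconj (of_real k x) = of_real k x.
Proof. by case: k => //=; rewrite conj_Creal //; apply/complex_realP; exists x. Qed.

Lemma norm_of_real (x : R) : `|of_real k x| = of_real k `|x|.
Proof. by case: k => //=; rewrite normc_def /= expr0n /= addr0 sqrtr_sqr. Qed.

Lemma of_real_ge0 (x : R) : (0 <= of_real k x) = (0 <= x).
Proof. by case: k => //=; rewrite lecR. Qed.

Lemma of_real_le (x y : R) : (of_real k x <= of_real k y) = (x <= y).
Proof. by case: k => //=; rewrite lecR. Qed.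

Lemma of_real_pos (e : K) : 0 < e -> exists2 r : R, 0 < r & of_real k r = e.
Proof.
case: k e => /= e e0; first by exists e.
have /complex_realP[r er] : e \is Num.real by rewrite realE ltW.
by exists r => //; move: e0; rewrite er ltcR.
Qed.

End Conjugation.

Section UnitizationAdj.
Variables (R : realType) (k : scalars) (B : cstar R k).
Local Notation U := (unitization B).

Lemma cadj0 : cadj (0 : B) = 0.
Proof. by apply: (addrI (cadj 0)); rewrite -cadjD !addr0. Qed.

(** The C*-identity and submultiplicativity give that the square of the norm of x is
    at most the product of the norms of the adjoint of x and x. *)
Lemma norm_cadj (x : B) : `|cadj x| = `|x|.
Proof.
suff h y : `|y : B| <= `|cadj y|.
  by apply/le_anti; rewrite h andbT; have := h (cadj x); rewrite cadjK.
have [->|y0] := eqVneq y 0; first by rewrite normr0 normr_ge0.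
rewrite -(ler_pM2r (x := `|y|)) ?normr_gt0 // -expr2 -cstar_id.
exact: cnormM.
Qed.

Lemma uadjK : involutive (@uadj R k B).
Proof. by case=> c x; rewrite /uadj /= sconjK cadjK. Qed.

Lemma uadjD : {morph @uadj R k B : u v / u + v}.
Proof. by move=> [c x] [d y]; congr (_, _); rewrite /= ?sconjD ?cadjD. Qed.

Lemma uadj0 : uadj (0 : U) = 0.
Proof. by congr (_, _); rewrite /= ?sconj0 ?cadj0. Qed.

Lemma uadj1 : uadj (1 : U) = 1.
Proof. by congr (_, _); rewrite /= ?sconj1 ?cadj0. Qed.

Lemma uadjM (u v : U) : uadj (u * v) = uadj v * uadj u.
Proof.
case: u v => [c x] [d y]; congr (_, _) => /=; first by rewrite sconjM mulrC.
rewrite !cadjD !cadjZ cadjM; congr (_ + _).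
by rewrite addrC.
Qed.

Lemma uadj_sum I (r : seq I) (P : pred I) (F : I -> U) :
  uadj (\sum_(i <- r | P i) F i) = \sum_(i <- r | P i) uadj (F i).
Proof. exact: (big_morph _ uadjD uadj0). Qed.

Lemma uadj_nat n : uadj (n%:R : U) = n%:R.
Proof. by elim: n => [|n IH]; rewrite ?uadj0 // -addn1 natrD uadjD uadj1 IH. Qed.

End UnitizationAdj.

Section Adjoints.
Variables (R : realType) (k : scalars) (B : cstar R k).
Local Notation U := (unitization B).

Definition adjm p q (X : 'M[U]_(p, q)) : 'M[U]_(q, p) := map_mx (@uadj R k B) X^T.

Lemma adjmE p q (X : 'M[U]_(p, q)) i j : adjm X i j = uadj (X j i).
Proof. by rewrite !mxE. Qed.

Lemma adjmK p q (X : 'M[U]_(p, q)) : adjm (adjm X) = X.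
Proof. by apply/matrixP => i j; rewrite !adjmE uadjK. Qed.

Lemma adjmM p q r (X : 'M[U]_(p, q)) (Y : 'M[U]_(q, r)) :
  adjm (X *m Y) = adjm Y *m adjm X.
Proof.
apply/matrixP => i j; rewrite adjmE !mxE uadj_sum.
by apply: eq_bigr => l _; rewrite uadjM !adjmE.
Qed.

Lemma adjmD p q (X Y : 'M[U]_(p, q)) : adjm (X + Y) = adjm X + adjm Y.
Proof. by apply/matrixP => i j; rewrite [RHS]mxE !adjmE mxE uadjD. Qed.

Lemma GMx_ext p q p' q' (X : 'M[U]_(p, q)) (Y : 'M[U]_(p', q')) :
  p = p' -> q = q' ->
  (forall (i : 'I_p) (j : 'I_q) (i' : 'I_p') (j' : 'I_q'),
     i = i' :> nat -> j = j' :> nat -> X i j = Y i' j') ->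
  GMx X = GMx Y.
Proof.
move=> e1 e2; case: p' / e1 Y; case: q' / e2 => Y e.
by congr GMx; apply/matrixP => i j; exact: e.
Qed.

Lemma matK (X : gmx B) : GMx (mat X) = X.
Proof. by case: X => [[p q] X]. Qed.

Lemma gmulE p q r (X : 'M[U]_(p, q)) (Y : 'M[U]_(q, r)) :
  gmul (GMx X) (GMx Y) = GMx (X *m Y).
Proof. by rewrite /gmul /= conform_mx_id. Qed.

Lemma gadjE p q (X : 'M[U]_(p, q)) : gadj (GMx X) = GMx (adjm X).
Proof. by []. Qed.

Lemma GMx_inj p q : injective (@GMx R k B p q).
Proof. by move=> X Y /eqP; rewrite eq_Tagged => /eqP. Qed.

Lemma is_projE p (P : 'M[U]_p) :
  is_proj (GMx P) <-> adjm P = P /\ P *m P = P.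
Proof.
rewrite /is_proj gadjE gmulE; split=> -[e1 e2]; last by rewrite e1 e2.
by split; apply: GMx_inj.
Qed.

(** Positivity, in the only form that is used: it holds for the stabilizations. *)
Definition definite := forall p q (X : 'M[U]_(p, q)), adjm X *m X = 0 -> X = 0.

Hypothesis defB : definite.

(** If P = X^* X is a projection, then Y = X P - X satisfies Y^* Y = 0.  The single
    equation on the right is preserved by every operation on matrices that is
    compatible with products and adjoints, which is how direct sums and tensor
    products come to act on morphisms. *)
Lemma is_pisomE p q (X : 'M[U]_(p, q)) :
  is_pisom (GMx X) <-> X *m adjm X *m X = X.
Proof.
rewrite /is_pisom gadjE !gmulE !is_projE !adjmM adjmK; split; last first.
  move=> h; split; split=> //; first by rewrite -mulmxA (mulmxA X) h.
  by rewrite mulmxA h.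
move=> [[_ h] _]; apply/eqP; rewrite -subr_eq0; apply/eqP/defB.
set P := adjm X *m X in h *.
have -> : X *m adjm X *m X - X = X *m (P - 1%:M) by rewrite mulmxBr mulmx1 -mulmxA.
have aP : adjm P = P by rewrite /P adjmM adjmK.
rewrite adjmM -mulmxA (mulmxA (adjm X)) -/P (mulmxBr P) mulmx1 h subrr mulmx0.
by [].
Qed.

End Adjoints.

Section Bijm.
Variables (R : realType) (k : scalars) (B : cstar R k).
Local Notation U := (unitization B).

Definition bijm p q (s : ordbij p q) : 'M[U]_(q, p) :=
  \matrix_(mu < q, nu < p) (mu == s nu)%:R.

Lemma bijmxE p q (s : ordbij p q) : bijmx B s = GMx (bijm s).
Proof. by []. Qed.

Lemma mul_bijm p q r (s : ordbij p q) (X : 'M[U]_(p, r)) i j :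
  (bijm s *m X) (s i) j = X i j.
Proof.
rewrite mxE (bigD1 i) //= mxE eqxx mul1r big1 ?addr0 // => l li.
by rewrite mxE (inj_eq (bij_inj (ordbij_funP s))) eq_sym (negbTE li) mul0r.
Qed.

Lemma mul_mx_bijm p q r (s : ordbij p q) (X : 'M[U]_(r, q)) i j :
  (X *m bijm s) i j = X i (s j).
Proof.
rewrite mxE (bigD1 (s j)) //= mxE eqxx mulr1 big1 ?addr0 // => l lsj.
by rewrite mxE (negbTE lsj) mulr0.
Qed.

Lemma adjm_bijm p q (s : ordbij p q) : adjm (bijm s) *m bijm s = 1%:M.
Proof.
apply/matrixP => i j; rewrite mul_mx_bijm adjmE !mxE uadj_nat.
by rewrite (inj_eq (bij_inj (ordbij_funP s))) eq_sym.
Qed.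

Lemma bijm_adjm p q (s : ordbij p q) : bijm s *m adjm (bijm s) = 1%:M.
Proof.
apply/matrixP => i j; rewrite -[ i ](ordbij_inv_funKV s) mul_bijm adjmE !mxE uadj_nat.
by rewrite eq_sym.
Qed.

Lemma bijm_intertwine p q p' q' (s : ordbij p p') (t : ordbij q q')
    (X : 'M[U]_(p, q)) (Y : 'M[U]_(p', q')) :
  (forall i j, Y (s i) (t j) = X i j) -> bijm s *m X = Y *m bijm t.
Proof.
move=> e; apply/matrixP => i j.
by rewrite -[ i ](ordbij_inv_funKV s) mul_bijm mul_mx_bijm e.
Qed.

Lemma bijm_comp p q r (t : ordbij q r) (s : ordbij p q) :
  bijm t *m bijm s = bijm (ordbij_comp t s).
Proof. by apply/matrixP => i j; rewrite mul_mx_bijm !mxE. Qed.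

End Bijm.

(** * Norm estimates in a stabilization *)

Section RealMatrices.
Variables (R : realType) (k : scalars) (A : cstar R k).
Local Notation U := (unitization A).

Definition ureal (x : R) : U := (of_real k x, 0).

Lemma uaddE (u v : U) : u + v = (u.1 + v.1, u.2 + v.2).
Proof. by []. Qed.

Lemma umulE (u v : U) :
  u * v = (u.1 * v.1, u.1 *: v.2 + v.1 *: u.2 + cmul u.2 v.2).
Proof. by []. Qed.

Lemma urealD : {morph ureal : x y / x + y}.
Proof. by move=> x y; rewrite uaddE /ureal of_realD /= addr0. Qed.

Lemma urealM : {morph ureal : x y / x * y}.
Proof. by move=> x y; rewrite umulE /ureal of_realM /= !scaler0 cmul0 !addr0. Qed.

Lemma ureal0 : ureal 0 = 0.
Proof. by rewrite /ureal of_real0. Qed.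

Lemma ureal1 : ureal 1 = 1.
Proof. by rewrite /ureal of_real1. Qed.

Lemma urealC x u : u * ureal x = ureal x * u.
Proof.
by rewrite !umulE /ureal /= cmul0 mul0c !scaler0 !addr0 !add0r mulrC.
Qed.

Lemma ureal_mul2 x u : (ureal x * u).2 = of_real k x *: u.2.
Proof. by rewrite umulE /ureal /= mul0c scaler0 !addr0. Qed.

Lemma uadj_real x : uadj (ureal x) = ureal x.
Proof. by rewrite /uadj /= sconj_of_real cadj0. Qed.

(** Real matrices act on matrices over the algebra through the scalars of its
    unitization, as the algebra itself need not have a unit. *)
Definition rmx p q (T : 'M[R]_(p, q)) : 'M[U]_(p, q) := map_mx ureal T.

Lemma rmxM p q r (S : 'M[R]_(p, q)) (T : 'M[R]_(q, r)) :
  rmx (S *m T) = rmx S *m rmx T.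
Proof.
apply/matrixP => i j; rewrite !mxE (big_morph _ urealD ureal0).
by apply: eq_bigr => l _; rewrite urealM !mxE.
Qed.

Lemma rmxD p q (S T : 'M[R]_(p, q)) : rmx (S + T) = rmx S + rmx T.
Proof. by apply/matrixP => i j; rewrite [RHS]mxE !mxE urealD. Qed.

Lemma rmxB p q (S T : 'M[R]_(p, q)) : rmx (S - T) = rmx S - rmx T.
Proof. by apply: (addIr (rmx T)); rewrite -rmxD !subrK. Qed.

Lemma rmx1 p : rmx (1%:M : 'M[R]_p) = 1%:M.
Proof.
by apply/matrixP => i j; rewrite !mxE; case: eqP => _; rewrite ?ureal1 ?ureal0.
Qed.

Lemma rmx0 p q : rmx (0 : 'M[R]_(p, q)) = 0.
Proof. by apply/matrixP => i j; rewrite !mxE ureal0. Qed.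

Lemma adjm_rmx p q (T : 'M[R]_(p, q)) : adjm (rmx T) = rmx T^T.
Proof. by apply/matrixP => i j; rewrite adjmE !mxE uadj_real. Qed.

Definition inmx p q (X : 'M[A]_(p, q)) : 'M[U]_(p, q) := map_mx (fun x => (0, x)) X.

(** Matrices over the algebra are treated as matrices over its unitization without
    scalar part, in order to multiply them with real matrices. *)
Definition inideal p q (X : 'M[U]_(p, q)) := forall i j, (X i j).1 = 0.

Lemma inideal_in p q (X : 'M[A]_(p, q)) : inideal (inmx X).
Proof. by move=> i j; rewrite !mxE. Qed.

Lemma inmx_snd p q (X : 'M[U]_(p, q)) : inideal X -> inmx (map_mx snd X) = X.
Proof. by move=> iX; apply/matrixP => i j; rewrite !mxE -(iX i j) -surjective_pairing. Qed.

Lemma snd_inmx p q (X : 'M[A]_(p, q)) : map_mx snd (inmx X) = X.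
Proof. by apply/matrixP => i j; rewrite !mxE. Qed.

Lemma ufst_sum I (r : seq I) (P : pred I) (F : I -> U) :
  (\sum_(i <- r | P i) F i).1 = \sum_(i <- r | P i) (F i).1.
Proof. exact: (big_morph (fun u : U => u.1) (fun _ _ => erefl) erefl). Qed.

Lemma usnd_sum I (r : seq I) (P : pred I) (F : I -> U) :
  (\sum_(i <- r | P i) F i).2 = \sum_(i <- r | P i) (F i).2.
Proof. exact: (big_morph (fun u : U => u.2) (fun _ _ => erefl) erefl). Qed.

Lemma inidealMl p q r (X : 'M[U]_(p, q)) (Y : 'M[U]_(q, r)) :
  inideal Y -> inideal (X *m Y).
Proof.
by move=> iY i j; rewrite mxE ufst_sum big1 // => l _; rewrite umulE iY mulr0.
Qed.

Lemma inidealMr p q r (X : 'M[U]_(p, q)) (Y : 'M[U]_(q, r)) :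
  inideal X -> inideal (X *m Y).
Proof.
by move=> iX i j; rewrite mxE ufst_sum big1 // => l _; rewrite umulE iX mul0r.
Qed.

Lemma inideal_adj p q (X : 'M[U]_(p, q)) : inideal X -> inideal (adjm X).
Proof. by move=> iX i j; rewrite adjmE /= iX sconj0. Qed.

Lemma inidealD p q (X Y : 'M[U]_(p, q)) : inideal X -> inideal Y -> inideal (X + Y).
Proof. by move=> iX iY i j; rewrite mxE /= iX iY addr0. Qed.

Lemma inidealB p q (X Y : 'M[U]_(p, q)) : inideal X -> inideal Y -> inideal (X - Y).
Proof.
move=> iX iY i j; have -> : (X - Y) i j = X i j - Y i j by rewrite !mxE.
by rewrite -[LHS]/((X i j).1 - (Y i j).1) iX iY subrr.
Qed.

End RealMatrices.

Arguments ureal {R k} A x.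
Arguments rmx {R k} A {p q} T.

Section Stab.
Variables (R : realType) (k : scalars) (A : cstar R k) (KA : stabilization A).
Local Notation K := (fld R k).
Local Notation U := (unitization A).

Definition stm p (X : 'M[U]_p) : KA := stab_in KA (map_mx snd X).

Lemma stm_in p (X : 'M[A]_p) : stm (inmx X) = stab_in KA X.
Proof. by rewrite /stm snd_inmx. Qed.

Lemma stmD p (X Y : 'M[U]_p) : stm (X + Y) = stm X + stm Y.
Proof.
by rewrite /stm -stab_inD; congr stab_in; apply/matrixP => i j; rewrite !mxE.
Qed.

Lemma stm0 p : stm (0 : 'M[U]_p) = 0.
Proof. by apply: (addrI (stm (0 : 'M[U]_p))); rewrite -stmD !addr0. Qed.

Lemma stmN p (X : 'M[U]_p) : stm (- X) = - stm X.
Proof. by apply: (addrI (stm X)); rewrite -stmD !subrr stm0. Qed.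

Lemma stmB p (X Y : 'M[U]_p) : stm (X - Y) = stm X - stm Y.
Proof. by rewrite stmD stmN. Qed.

Lemma stm_adj p (X : 'M[U]_p) : stm (adjm X) = cadj (stm X).
Proof.
rewrite /stm -stab_in_adj; congr stab_in; apply/matrixP => i j.
by rewrite !mxE.
Qed.

Lemma stmM p (X Y : 'M[U]_p) : inideal X -> inideal Y ->
  stm (X *m Y) = cmul (stm X) (stm Y).
Proof.
move=> iX iY; rewrite /stm -stab_inM; congr stab_in; apply/matrixP => i j.
rewrite !mxE usnd_sum; apply: eq_bigr => l _.
by rewrite umulE /= iX iY !scale0r !add0r !mxE.
Qed.

(** The square of the norm of a rectangular matrix as an element of a Hilbert module:
    X^* X is square even if X is not, as happens for isometries between corners of
    different sizes. *)
Definition hnorm p q (X : 'M[U]_(p, q)) : K := `|stm (adjm X *m X)|.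

Lemma hnorm_square p (X : 'M[U]_p) : inideal X -> hnorm X = `|stm X| ^+ 2.
Proof.
by move=> iX; rewrite /hnorm stmM ?stm_adj ?cstar_id //; exact: inideal_adj.
Qed.

Definition inclmx q p : 'M[R]_(q, p) := \matrix_(i, j) (i == j :> nat)%:R.

Lemma inclmxM n q p : (p <= q)%N -> (inclmx n q) *m (inclmx q p) = inclmx n p.
Proof.
move=> pq; apply/matrixP => i j; rewrite !mxE.
rewrite (bigD1 (widen_ord pq j)) //= !mxE /= eqxx mulr1.
rewrite big1 ?addr0 // => l lj; rewrite !mxE.
by rewrite -val_eqE /= in lj; rewrite (negbTE lj) mulr0.
Qed.

Lemma inclmx1 p : inclmx p p = 1%:M.
Proof. by apply/matrixP => i j; rewrite !mxE. Qed.

Lemma inclmxT q p : (inclmx q p)^T = inclmx p q.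
Proof. by apply/matrixP => i j; rewrite !mxE eq_sym. Qed.

Lemma inclmxK q p : (p <= q)%N -> (inclmx q p)^T *m inclmx q p = 1%:M.
Proof. by move=> pq; rewrite inclmxT inclmxM // inclmx1. Qed.

Lemma inclmx_mull p q r (X : 'M[U]_(p, r)) (l : 'I_p) (i : 'I_q) j : i = l :> nat ->
  (rmx A (inclmx q p) *m X) i j = X l j.
Proof.
move=> e; rewrite mxE (bigD1 l) //= !mxE e eqxx ureal1 mul1r big1 ?addr0 //.
move=> l' l'l; rewrite !mxE e eq_sym.
by rewrite -val_eqE /= in l'l; rewrite (negbTE l'l) ureal0 mul0r.
Qed.

Lemma inclmx_mull0 p q r (X : 'M[U]_(p, r)) (i : 'I_q) j : (p <= i)%N ->
  (rmx A (inclmx q p) *m X) i j = 0.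
Proof.
move=> pi; rewrite mxE big1 // => l _; rewrite !mxE.
have /negbTE-> : i != l :> nat by rewrite gtn_eqF // (leq_trans (ltn_ord l)).
by rewrite ureal0 mul0r.
Qed.

Lemma stm_corner p q (X : 'M[U]_p) : (p <= q)%N ->
  stm (rmx A (inclmx q p) *m X *m rmx A (inclmx p q)) = stm X.
Proof.
move=> /subnK <-; elim: (q - p)%N => [|d IH].
  by rewrite add0n inclmx1 rmx1 mul1mx mulmx1.
have pd : (p <= d + p)%N by rewrite leq_addl.
have e1 := inclmxM (d.+1 + p) pd.
have e2 : inclmx p (d + p) *m inclmx (d + p) (d.+1 + p) = inclmx p (d.+1 + p).
  by rewrite -!(inclmxT _ (d + p)) -!(inclmxT _ p) -trmx_mul e1.
rewrite -e1 -e2 !rmxM !mulmxA.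
rewrite -{}IH; set Y := (X in stm X = _).
set Z := rmx A (inclmx (d + p) p) *m X *m rmx A (inclmx p (d + p)).
have -> : Y = rmx A (inclmx (d.+1 + p) (d + p)) *m Z *m
   rmx A (inclmx (d + p) (d.+1 + p)).
  by rewrite /Y /Z !mulmxA.
move: Z; rewrite addSn -addn1 => Z; move: (d + p)%N Z => n Z {Y pd}.
rewrite /stm -[RHS]stab_in_corner; congr stab_in; apply/matrixP => i j.
have adjE (T : 'M[U]_(n + 1, n)) : (T *m rmx A (inclmx n (n + 1))) =
  adjm (rmx A (inclmx (n + 1) n) *m adjm T).
  by rewrite adjmM adjmK adjm_rmx inclmxT.
rewrite [LHS]mxE [RHS]mxE; case: (splitP i) => i' ei.
  rewrite [RHS]mxE; case: (splitP j) => j' ej.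
    rewrite adjE adjmE (inclmx_mull _ _ ej) adjmE uadjK.
    by rewrite (inclmx_mull _ _ ei) mxE.
  by rewrite adjE adjmE inclmx_mull0 ?uadj0 ?mxE // ej leq_addr.
rewrite -mulmxA inclmx_mull0 ?ei ?leq_addr //.
by rewrite mxE; case: (splitP j) => j' ej; rewrite mxE.
Qed.

(** Padded with zeros to a square matrix, X has the norm of its adjoint. *)
Lemma hnorm_adj p q (X : 'M[U]_(p, q)) : inideal X -> hnorm (adjm X) = hnorm X.
Proof.
move=> iX; have [lp lq] : (p <= p + q /\ q <= p + q)%N by rewrite leq_addr leq_addl.
pose n := (p + q)%N.
pose Y := rmx A (inclmx n p) *m X *m rmx A (inclmx q n).
have iY : inideal Y by apply/inidealMr/inidealMl.
have aY : adjm Y = rmx A (inclmx n q) *m adjm X *m rmx A (inclmx p n).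
  by rewrite /Y !adjmM !adjm_rmx !inclmxT mulmxA.
have h r s (Z : 'M[U]_(r, s)) : (r <= n)%N -> (s <= n)%N ->
    hnorm (rmx A (inclmx n r) *m Z *m rmx A (inclmx s n)) = hnorm Z.
  move=> rn sn; rewrite /hnorm; congr `|_|.
  rewrite !adjmM !adjm_rmx !inclmxT.
  rewrite !mulmxA -(mulmxA _ (rmx A (inclmx r n))) -rmxM inclmxM // inclmx1 rmx1.
  by rewrite mulmx1 -(mulmxA _ (adjm Z)) stm_corner.
rewrite -(h _ _ X) // -(h _ _ (adjm X)) // -aY -/Y !hnorm_square //; last first.
  exact: inideal_adj.
by rewrite stm_adj norm_cadj.
Qed.

Lemma eq_sqr_norm (x y : K) : 0 <= x -> 0 <= y -> x ^+ 2 = y ^+ 2 -> x = y.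
Proof. by move=> x0 y0 /eqP; rewrite eqrXn2 // => /eqP. Qed.

(** The C*-identity cancels V^T V on either side: V X V^T has the norm of X V^T, hence
    of V X^*, hence of X^*. *)
Lemma norm_stm_isometry p q (V : 'M[R]_(q, p)) (X : 'M[U]_p) :
  V^T *m V = 1%:M -> inideal X ->
  `|stm (rmx A V *m X *m rmx A V^T)| = `|stm X|.
Proof.
move=> VV iX; apply: eq_sqr_norm; rewrite ?normr_ge0 //.
have iVX : inideal (rmx A V *m X *m rmx A V^T) by apply/inidealMr/inidealMl.
rewrite -!hnorm_square //.
transitivity (hnorm (X *m rmx A V^T)).
  rewrite /hnorm !adjmM !adjm_rmx !trmxK !mulmxA -(mulmxA _ (rmx A V^T)).
  by rewrite -rmxM VV rmx1 mulmx1.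
rewrite -(hnorm_adj (X := X)) // -hnorm_adj; last exact: inidealMr.
rewrite /hnorm !adjmK adjmM adjm_rmx trmxK mulmxA -(mulmxA X) -rmxM VV rmx1.
by rewrite mulmx1.
Qed.

(** For Y = e X one has Y^* Y = X^* Y, whose norm is at most the product of those of X
    and Y. *)
Lemma norm_stm_proj p (e : 'M[R]_p) (X : 'M[U]_p) : e^T = e -> e *m e = e ->
  inideal X -> `|stm (rmx A e *m X)| <= `|stm X|.
Proof.
move=> eT ee iX; have iE : inideal (rmx A e *m X) by exact: inidealMl.
have [->|n0] := eqVneq (stm (rmx A e *m X)) 0; first by rewrite normr0 normr_ge0.
rewrite -(ler_pM2r (x := `|stm (rmx A e *m X)|)) ?normr_gt0 // -expr2 -hnorm_square //.
rewrite /hnorm adjmM adjm_rmx eT mulmxA -(mulmxA (adjm X)) -rmxM ee -mulmxA.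
rewrite stmM //; last exact: inideal_adj.
by rewrite (le_trans (cnormM _ _)) // stm_adj norm_cadj.
Qed.

(** Up to the isometric conjugation by V, the compression is multiplication by the
    projection V V^T on both sides. *)
Lemma norm_stm_compress p q (V : 'M[R]_(q, p)) (X : 'M[U]_q) :
  V^T *m V = 1%:M -> inideal X ->
  `|stm (rmx A V^T *m X *m rmx A V)| <= `|stm X|.
Proof.
move=> VV iX; rewrite -(norm_stm_isometry VV); last by apply/inidealMr/inidealMl.
pose e := V *m V^T.
have eT : e^T = e by rewrite /e trmx_mul trmxK.
have ee : e *m e = e by rewrite /e mulmxA -(mulmxA V) VV mulmx1.
have -> : rmx A V *m (rmx A V^T *m X *m rmx A V) *m rmx A V^T =
    rmx A e *m X *m rmx A e by rewrite /e !rmxM !mulmxA.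
rewrite -mulmxA (le_trans (norm_stm_proj eT ee _)) //; first exact: inidealMr.
rewrite -norm_cadj -stm_adj adjmM adjm_rmx eT.
rewrite (le_trans (norm_stm_proj eT ee _)) //; first exact: inideal_adj.
by rewrite stm_adj norm_cadj.
Qed.

(** X X^* is a corner of Z Z^* for the column Z of X and Y, and Z Z^* has the norm of
    Z^* Z.  This monotonicity takes the place of the order on positive elements. *)
Lemma norm_stm_sum p (X Y : 'M[U]_p) : inideal X -> inideal Y ->
  `|stm X| ^+ 2 <= `|stm (adjm X *m X + adjm Y *m Y)|.
Proof.
move=> iX iY; pose Z := col_mx X Y; pose V : 'M[R]_(p + p, p) := col_mx 1%:M 0.
have iZ : inideal Z.
  by move=> i j; rewrite mxE; case: splitP => l _; rewrite ?iX ?iY.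
have VV : V^T *m V = 1%:M.
  by rewrite /V tr_col_mx mul_row_col trmx1 mulmx1 mulmx0 addr0.
have VZ : rmx A V^T *m Z = X.
  rewrite /V tr_col_mx trmx1 trmx0 /rmx map_row_mx mul_row_col.
  by rewrite -!/(rmx A _) rmx1 rmx0 mul1mx mul0mx addr0.
have aZ : adjm Z *m Z = adjm X *m X + adjm Y *m Y.
  by rewrite /adjm /Z tr_col_mx map_row_mx mul_row_col.
rewrite -hnorm_square // -hnorm_adj // -aZ -/(hnorm Z) -(hnorm_adj iZ).
rewrite /hnorm !adjmK -VZ adjmM adjm_rmx trmxK mulmxA -(mulmxA _ Z).
exact/norm_stm_compress/inidealMr.
Qed.

(** Controls X^* H X through the entries of H, see [hnorm_le]. *)
Definition stm_bound p (X : 'M[U]_p) : K :=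
  \sum_l \sum_l' `|stm (adjm X *m rmx A (delta_mx l l') *m X)|.

Lemma stm_bound_ge0 p (X : 'M[U]_p) : 0 <= stm_bound X.
Proof. by apply: sumr_ge0 => l _; apply: sumr_ge0 => l' _; exact: normr_ge0. Qed.

(** Only the Gram matrix of T enters, so that the bound does not depend on the number
    of rows of T. *)
Lemma hnorm_le p q (T : 'M[R]_(q, p)) (X : 'M[U]_p) (c : R) :
  (forall l l', `|(T^T *m T) l l'| <= c) ->
  hnorm (rmx A T *m X) <= of_real k c * stm_bound X.
Proof.
move=> Tc; rewrite /hnorm adjmM adjm_rmx mulmxA -(mulmxA (adjm X)) -rmxM.
set H := _ *m _ in Tc *; move: H Tc => H Tc.
have -> : rmx A H = \sum_l \sum_l' rmx A (H l l' *: delta_mx l l').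
  rewrite {1}[H]matrix_sum_delta (big_morph _ (@rmxD _ _ _ _ _) (rmx0 _ _ _)).
  by apply: eq_bigr => l _; rewrite (big_morph _ (@rmxD _ _ _ _ _) (rmx0 _ _ _)).
rewrite mulmx_sumr mulmx_suml (big_morph _ (@stmD _) (stm0 _)).
rewrite (le_trans (ler_norm_sum _ _ _)) // /stm_bound mulr_sumr ler_sum // => l _.
rewrite mulmx_sumr mulmx_suml (big_morph _ (@stmD _) (stm0 _)).
rewrite (le_trans (ler_norm_sum _ _ _)) // mulr_sumr ler_sum // => l' _.
have -> : stm (adjm X *m rmx A (H l l' *: delta_mx l l') *m X) =
    of_real k (H l l') *: stm (adjm X *m rmx A (delta_mx l l') *m X).
  rewrite /stm -stab_inZ; congr stab_in; apply/matrixP => i j.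
  rewrite [LHS]mxE [RHS]mxE [in RHS]mxE.
  have -> : (adjm X *m rmx A (H l l' *: delta_mx l l') *m X) i j =
      ureal A (H l l') * (adjm X *m rmx A (delta_mx l l') *m X) i j.
    rewrite mxE [in RHS]mxE mulr_sumr; apply: eq_bigr => s _.
    rewrite mulrA; congr (_ * _); rewrite mxE [in RHS]mxE mulr_sumr.
    apply: eq_bigr => t _.
    rewrite [rmx _ _ _ _]mxE [(_ *: _ : 'M_p) _ _]mxE urealM mulrA (urealC (H l l')) -mulrA.
    by congr (_ * (_ * _)); rewrite [RHS]mxE.
  by rewrite ureal_mul2.
by rewrite normrZ ler_wpM2r ?normr_ge0 // norm_of_real of_real_le.
Qed.

End Stab.

(** * Isometries of R^infty and their matrices *)

Section InnerProduct.
Variable R : realType.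
Local Notation Rinf := (Rinf R).
Implicit Types v w : Rinf.

Definition ip v w : R := \sum_(i < size (v : {poly R})) v`_i * w`_i.

Lemma ipEl v w n : (size (v : {poly R}) <= n)%N -> ip v w = \sum_(i < n) v`_i * w`_i.
Proof.
move=> vn; rewrite /ip (big_ord_widen _ (fun i => v`_i * w`_i) vn).
rewrite big_mkcond /=; apply: eq_bigr => i _; case: ltnP => // vi.
by rewrite nth_default // mul0r.
Qed.

Lemma ipC v w : ip v w = ip w v.
Proof.
rewrite (@ipEl v w (maxn (size (v : {poly R})) (size (w : {poly R})))) ?leq_maxl //.
rewrite (@ipEl w v (maxn (size (v : {poly R})) (size (w : {poly R})))) ?leq_maxr //.
by apply: eq_bigr => i _; rewrite mulrC.
Qed.

Lemma ipEr v w n : (size (w : {poly R}) <= n)%N -> ip v w = \sum_(i < n) v`_i * w`_i.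
Proof. by rewrite ipC => /ipEl ->; apply: eq_bigr => i _; rewrite mulrC. Qed.

Lemma ipDl u v w : ip (u + v) w = ip u w + ip v w.
Proof.
rewrite !(@ipEr _ w (size (w : {poly R}))) // -big_split; apply: eq_bigr => i _.
by rewrite coefD mulrDl.
Qed.

Lemma ipDr u v w : ip w (u + v) = ip w u + ip w v.
Proof. by rewrite !(ipC w) ipDl. Qed.

Lemma ip_norm v : ip v v = `|v| ^+ 2.
Proof.
by rewrite [RHS]sqr_sqrtr ?sqnorm_ge0.
Qed.

Lemma ip_le v w : `|ip v w| <= `|v| * `|w|.
Proof.
rewrite -(@ler_pXn2r _ 2) ?nnegrE ?mulr_ge0 ?normr_ge0 // exprMn -!ip_norm.
rewrite real_normK ?num_real //.
pose n := maxn (size (v : {poly R})) (size (w : {poly R})).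
rewrite (@ipEl v w n) ?(@ipEl v v n) ?(@ipEl w w n) ?leq_maxl ?leq_maxr //.
exact: cauchy_schwarz_sum.
Qed.

Lemma ip_Xn l l' : ip 'X^l 'X^l' = (l == l')%:R.
Proof.
rewrite /ip size_polyXn (bigD1 ord_max) //= !coefXn eqxx mul1r big1 ?addr0 //.
move=> i; rewrite -val_eqE /= => il; rewrite coefXn (negbTE il) mul0r.
by [].
Qed.

Lemma ip_polar v w : `|v + w| ^+ 2 = `|v| ^+ 2 + `|w| ^+ 2 + ip v w *+ 2.
Proof. by rewrite -!ip_norm ipDl !ipDr (ipC w v) mulr2n !addrA [LHS](ACl (1*4*2*3)%AC). Qed.

End InnerProduct.

Section Isometries.
Variable R : realType.
Local Notation Rinf := (Rinf R).

Definition isometry (f : Rinf -> Rinf) :=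
  linear f /\ forall v w, ip (f v) (f w) = ip v w.

Definition orthogonal (f g : Rinf -> Rinf) := forall v w, ip (f v) (g w) = 0.

Lemma linear_scale (f : Rinf -> Rinf) : linear f -> forall c v, f (c *: v) = c *: f v.
Proof.
move=> lf c v; have f0 : f 0 = 0.
  by have := lf (-1) 0 0; rewrite scaler0 addr0 scaleN1r addNr.
by have := lf c v 0; rewrite f0 !addr0.
Qed.

Lemma linear_add (f : Rinf -> Rinf) : linear f -> forall v w, f (v + w) = f v + f w.
Proof. by move=> lf v w; have := lf 1 v w; rewrite !scale1r. Qed.

Lemma licomp_linear m (f : lin_isom R m) i : linear (licomp f i).
Proof. by case: (lin_isomP f). Qed.

Lemma licomp0 m (f : lin_isom R m) i : licomp f i 0 = 0.
Proof. by rewrite -(scale0r 0) linear_scale ?scale0r //; exact: licomp_linear. Qed.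

Lemma licomp_norm m (f : lin_isom R m) i v : `|licomp f i v| = `|v|.
Proof.
have [_ nf] := lin_isomP f; have := nf (fun j => if j == i then v else 0).
rewrite (bigD1 i) //= eqxx big1 ?addr0; last by move=> j /negbTE ->; exact: licomp0.
move=> ->; rewrite (bigD1 i) //= eqxx big1 ?addr0 ?sqrtr_sqr ?normr_id //.
by move=> j /negbTE ->; rewrite normr0 expr0n.
Qed.

(** By polarization. *)
Lemma licomp_isometry m (f : lin_isom R m) i : isometry (licomp f i).
Proof.
have lf := licomp_linear f i; split=> // v w; apply: (@mulIf _ 2); first by rewrite pnatr_eq0.
have := ip_polar (licomp f i v) (licomp f i w).
rewrite -linear_add // !licomp_norm ip_polar => /addrI.
by rewrite !mulr_natr.
Qed.

Lemma licomp_orthogonal m (f : lin_isom R m) i j : i != j ->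
  orthogonal (licomp f i) (licomp f j).
Proof.
move=> ij v w; have [_ nf] := lin_isomP f.
have ji : (j == i) = false by rewrite eq_sym (negbTE ij).
have := nf (fun l => if l == i then v else if l == j then w else 0).
rewrite (bigD1 i) //= eqxx (bigD1 j) ?ji //= eqxx big1 ?addr0; last first.
  by move=> l /andP[/negbTE -> /negbTE ->]; exact: licomp0.
rewrite (bigD1 i) //= eqxx (bigD1 j) ?ji //= eqxx big1 ?addr0; last first.
  by move=> l /andP[/negbTE -> /negbTE ->]; rewrite normr0 expr0n.
move=> e; have : `|licomp f i v + licomp f j w| ^+ 2 = `|v| ^+ 2 + `|w| ^+ 2.
  by rewrite e sqr_sqrtr // addr_ge0 ?sqr_ge0.
rewrite ip_polar !licomp_norm => /eqP; rewrite -subr_eq0 addrAC subrr add0r.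
by rewrite mulrn_eq0 => /eqP.
Qed.

(** The columns are the images of the first p basis vectors; no coordinate is lost
    when [fits f q p]. *)
Definition frame (f : Rinf -> Rinf) q p : 'M[R]_(q, p) :=
  \matrix_(i, l) (f 'X^l)`_i.

Definition fits (f : Rinf -> Rinf) q p :=
  forall l, (l < p)%N -> (size (f 'X^l : {poly R}) <= q)%N.

Lemma fits_ex f p n : exists2 q, (n <= q)%N & fits f q p.
Proof.
exists (maxn n (\max_(l < p) size (f 'X^l : {poly R}))); first exact: leq_maxl.
move=> l lp; apply: leq_trans (leq_maxr _ _).
exact: (leq_bigmax (F := fun l : 'I_p => size (f 'X^l : {poly R})) (Ordinal lp)).
Qed.

Lemma fitsW f q q' p p' : fits f q p -> (q <= q')%N -> (p' <= p)%N -> fits f q' p'.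
Proof. by move=> h qq pp l lp; exact: leq_trans (h _ (leq_trans lp pp)) qq. Qed.

Lemma frame_gram f g q p p' (l : 'I_p) (l' : 'I_p') : fits f q p ->
  ((frame f q p)^T *m frame g q p') l l' = ip (f 'X^l) (g 'X^l').
Proof.
move=> h; rewrite (@ipEl _ _ _ q) ?h ?ltn_ord // mxE.
by apply: eq_bigr => i _; rewrite !mxE.
Qed.

Lemma frame_isometry f q p : isometry f -> fits f q p ->
  (frame f q p)^T *m frame f q p = 1%:M.
Proof.
by move=> [_ hf] h; apply/matrixP => l l'; rewrite frame_gram // hf ip_Xn mxE.
Qed.

Lemma frame_orthogonal f g q p p' : orthogonal f g -> fits f q p ->
  (frame f q p)^T *m frame g q p' = 0.
Proof.
by move=> hf h; apply/matrixP => l l'; rewrite frame_gram // hf mxE.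
Qed.

Lemma frame_id q p : frame id q p = inclmx R q p.
Proof. by apply/matrixP => i l; rewrite !mxE coefXn. Qed.

Lemma frame_incl f q n p : (p <= n)%N -> frame f q n *m inclmx R n p = frame f q p.
Proof.
move=> pn; apply/matrixP => i l; rewrite mxE (bigD1 (widen_ord pn l)) //= !mxE /=.
rewrite eqxx mulr1 big1 ?addr0 // => j; rewrite -val_eqE /= => jl.
by rewrite !mxE (negbTE jl) mulr0.
Qed.

Lemma frame_comp f g q n p : linear f -> fits g n p ->
  frame f q n *m frame g n p = frame (f \o g) q p.
Proof.
move=> lf h; apply/matrixP => i l; rewrite !mxE /=.
have -> : g 'X^l = \sum_(j < n) (g 'X^l)`_j *: 'X^j :> {poly R}.
  rewrite -poly_def; apply/polyP => j; rewrite coef_poly.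
  by case: ltnP => // nj; rewrite nth_default // (leq_trans (h _ _)).
pose F : {linear Rinf -> Rinf} := HB.pack f (GRing.isLinear.Build _ _ _ _ _ lf).
have -> : f (\sum_(j < n) (g 'X^l)`_j *: 'X^j) = \sum_(j < n) (g 'X^l)`_j *: f 'X^j.
  by rewrite -[f]/(F : _ -> _) linear_sum; apply: eq_bigr => j _; rewrite linearZ.
rewrite coef_sum; apply: eq_bigr => j _; rewrite !mxE coefZ mulrC.
by [].
Qed.

Lemma incl_frame f q n p : fits f n p -> inclmx R q n *m frame f n p = frame f q p.
Proof. by move=> h; rewrite -frame_id frame_comp. Qed.

End Isometries.

(** * Conjugation by isometries on a stabilization *)

(** The map to be extended is a relation because an element of the stabilization
    is represented by matrices of many sizes. *)
Section IsometricExtension.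
Variables (K : numFieldType) (V W : completeNormedModType K) (G : V -> W -> Prop).
Hypothesis G_iso : forall x y x' y', G x y -> G x' y' -> `|y - y'| = `|x - x'|.
Hypothesis G_dense : forall (x : V) (P : set V), nbhs x P -> exists x' y', G x' y' /\ P x'.

(** The images of the points near x generate a Cauchy filter. *)
Lemma graph_limit (x : V) : exists z : W, forall e : K, 0 < e ->
  \forall x' \near x, forall y, G x' y -> `|z - y| < e.
Proof.
pose F : set_system W := [set B | \forall x' \near x, forall y, G x' y -> B y].
have FF : ProperFilter F.
  split; first by case/G_dense => x' [y [Gxy /(_ y)]]; apply.
  split; first by rewrite /F /=; apply: nearW.
    move=> P Q fP fQ; apply: (@filterS2 _ (nbhs x) _ _ _ _ _ fP fQ) => x' hP hQ y Gy.
    by split; [exact: hP|exact: hQ].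
  by move=> P Q PQ; apply: (@filterS _ (nbhs x)) => x' hP y Gy; apply: PQ; exact: hP.
have cF : cvg F.
  apply: cauchy_cvg; apply: cauchy_exP => e e0.
  have e20 : 0 < e / 2 by rewrite divr_gt0.
  have [x0 [y0 [Gxy0 x0P]]] := G_dense (nbhsx_ballx x (e / 2) e20).
  exists y0; apply: filterS (nbhsx_ballx x (e / 2) e20) => x' xx' y Gxy.
  move: x0P xx'; rewrite -!ball_normE /ball_ /= => x0P xx'.
  rewrite (G_iso Gxy0 Gxy) (splitr e).
  by rewrite (le_lt_trans (ler_distD x _ _)) // ltrD // distrC.
exists (lim F) => e e0.
have : F (ball (lim F) e) by apply: cF; exact: nbhsx_ballx.
apply: (@filterS _ (nbhs x)) => x' h y /h.
by rewrite -ball_normE.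
Qed.

Lemma isometric_extension : exists c : V -> W,
  (forall x y, `|c x - c y| <= `|x - y|) /\ forall x y, G x y -> c x = y.
Proof.
have [c hc] := choice graph_limit.
have near1 x e : 0 < e -> exists x' y', [/\ G x' y', `|x - x'| < e & `|c x - y'| < e].
  move=> e0; have xe : nbhs x (ball x e) by exact: nbhsx_ballx.
  have [x' [y' [Gxy [h1 h2]]]] := G_dense (filterI (hc x e e0) xe).
  by exists x', y'; split=> //; [move: h2; rewrite -ball_normE | exact: h1].
have c_graph x y v : G y v -> `|c x - v| <= `|x - y|.
  move=> Gy; apply/ler_addgt0Pr => e e0; have e20 : 0 < e / 2 by rewrite divr_gt0.
  have [x' [u [Gx xx' cu]]] := near1 x _ e20.
  rewrite (le_trans (ler_distD u _ _)) // (G_iso Gx Gy).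
  rewrite (le_trans (lerD (ltW cu) (ler_distD x _ _))) // addrA addrC lerD //.
  by rewrite [leRHS]splitr lerD // ltW // distrC.
exists c; split=> [x y|x y Gxy]; last first.
  by apply/eqP; rewrite -subr_eq0 -normr_le0 (le_trans (c_graph _ _ _ Gxy)) // subrr normr0.
apply/ler_addgt0Pr => e e0; have e20 : 0 < e / 2 by rewrite divr_gt0.
have [y' [v [Gy yy' cv]]] := near1 y _ e20.
rewrite (le_trans (ler_distD v _ _)) //.
rewrite (le_trans (lerD (c_graph x _ _ Gy) (lexx _))) //.
rewrite (le_trans (lerD (ler_distD y _ _) (lexx _))) // -addrA lerD //.
by rewrite [leRHS]splitr lerD // ltW // distrC.
Qed.

End IsometricExtension.

Lemma dist_cvg (K : numFieldType) (V : pseudoMetricNormedZmodType K) (T : Type)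
    (F : set_system T) (FF : Filter F) (f : T -> V) (a : V) (h : T -> K) :
  (forall t, `|a - f t| <= h t) -> h t @[t --> F] --> (0 : K) -> f t @[t --> F] --> a.
Proof.
move=> fh /cvgrPdist_lt h0; apply/cvgrPdist_lt => e e0.
apply: filterS (h0 _ e0) => t; rewrite sub0r normrN; apply: le_lt_trans.
by rewrite ger0_norm // (le_trans _ (fh t)).
Qed.

Section CstarContinuity.
Variables (R : realType) (k : scalars) (B : cstar R k).
Local Notation K := (fld R k).

Lemma cmulDB (x y z : B) : cmul (x - y) z = cmul x z - cmul y z.
Proof. by rewrite cmulDl -scaleN1r cmulZl scaleN1r. Qed.

Lemma cmulBD (x y z : B) : cmul z (x - y) = cmul z x - cmul z y.
Proof. by rewrite cmulDr -scaleN1r cmulZr scaleN1r. Qed.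

Lemma cmul_cvg (T : Type) (F : set_system T) (FF : Filter F) (f g : T -> B) (a b : B) :
  f t @[t --> F] --> a -> g t @[t --> F] --> b ->
  cmul (f t) (g t) @[t --> F] --> cmul a b.
Proof.
move=> fa gb.
apply: (@dist_cvg K B T F FF _ _ (fun t => `|a| * `|b - g t| + `|a - f t| * `|g t|)) => [t|].
  have -> : cmul a b - cmul (f t) (g t) = cmul a (b - g t) + cmul (a - f t) (g t).
    by rewrite cmulBD cmulDB addrA subrK.
  by rewrite (le_trans (ler_normD _ _)) // lerD // cnormM.
have d0 h c : h t @[t --> F] --> (c : B) -> `|c - h t| @[t --> F] --> (0 : K).
  move=> hc; rewrite -(normr0 B) -(subrr c); apply: cvg_norm.
  by apply: cvgB => //; exact: cvg_cst.
have -> : (0 : K) = `|a| * 0 + 0 * `|b| by rewrite mulr0 mul0r addr0.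
apply: cvgD; first by apply: cvgM; [exact: cvg_cst | exact: d0].
by apply: cvgM; [exact: d0 | exact: cvg_norm].
Qed.

Lemma cadj_cvg (T : Type) (F : set_system T) (FF : Filter F) (f : T -> B) (a : B) :
  f t @[t --> F] --> a -> cadj (f t) @[t --> F] --> cadj a.
Proof.
move=> fa; apply: (@dist_cvg K B T F FF _ _ (fun t => `|a - f t|)) => [t|].
  have -> : cadj a - cadj (f t) = cadj (a - f t).
    by apply: (addIr (cadj (f t))); rewrite -cadjD !subrK.
  by rewrite norm_cadj.
rewrite -(normr0 B) -(subrr a); apply: cvg_norm.
by apply: cvgB => //; exact: cvg_cst.
Qed.

End CstarContinuity.

Section StabDense.
Variables (R : realType) (k : scalars) (A : cstar R k) (KA : stabilization A).
Local Notation K := (fld R k).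
Local Notation U := (unitization A).

Lemma stab_near (x : KA) (P : set KA) : nbhs x P ->
  exists p (X : 'M[A]_p), P (stab_in KA X).
Proof.
move=> xP; have : closure (\bigcup_p range (@stab_in _ _ _ KA p)) x.
  by rewrite stab_in_dense.
by move=> /(_ _ xP) [_ [[p _ [X _ <-]] PX]]; exists p, X.
Qed.

Lemma stab_ext (W : normedModType K) (h1 h2 : KA -> W) :
  continuous h1 -> continuous h2 ->
  (forall p (X : 'M[A]_p), h1 (stab_in KA X) = h2 (stab_in KA X)) -> h1 =1 h2.
Proof.
move=> c1 c2 e x; apply/eqP; rewrite -subr_eq0 -normr_le0.
apply/ler_addgt0Pr => d d0; rewrite add0r.
have d20 : 0 < d / 2 by rewrite divr_gt0.
have /cvgrPdist_lt/(_ _ d20) n1 := c1 x.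
have /cvgrPdist_lt/(_ _ d20) n2 := c2 x.
have [p [X [l1 l2]]] := stab_near (filterI n1 n2).
rewrite (le_trans (ler_distD (h1 (stab_in KA X)) _ _)) // [X in _ + `|X - _|]e [leRHS]splitr.
by rewrite lerD // ltW // distrC.
Qed.

Lemma stab_common p q (X : 'M[A]_p) (Y : 'M[A]_q) n : (p <= n)%N -> (q <= n)%N ->
  exists X' Y' : 'M[U]_n, [/\ inideal X', inideal Y', stab_in KA X = stm KA X' &
    stab_in KA Y = stm KA Y'].
Proof.
move=> pn qn.
exists (rmx A (inclmx R n p) *m inmx X *m rmx A (inclmx R p n)).
exists (rmx A (inclmx R n q) *m inmx Y *m rmx A (inclmx R q n)).
split; try exact/inidealMr/inidealMl/inideal_in.
  by rewrite stm_corner // stm_in.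
by rewrite stm_corner // stm_in.
Qed.

End StabDense.

Section Conjugation.
Variables (R : realType) (k : scalars) (A : cstar R k) (KA : stabilization A).
Local Notation K := (fld R k).
Local Notation U := (unitization A).

Definition conjm f q p (X : 'M[U]_p) : 'M[U]_q :=
  rmx A (frame f q p) *m X *m rmx A (frame f q p)^T.

Lemma inideal_conjm f q p (X : 'M[U]_p) : inideal X -> inideal (conjm f q X).
Proof. by move=> iX; apply/inidealMr/inidealMl. Qed.

Lemma stm_mxconj f q p (X : 'M[A]_p) :
  stab_in KA (mxconj f q X) = stm KA (conjm f q (inmx X)).
Proof.
rewrite /stm; congr stab_in; apply/matrixP => i j.
rewrite [LHS]mxE [RHS]mxE mxE usnd_sum exchange_big; apply: eq_bigr => l' _.
rewrite mxE mulr_suml usnd_sum; apply: eq_bigr => l _.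
by rewrite !mxE urealC mulrA -urealM ureal_mul2 /= mulrC.
Qed.

Lemma conjm_incl f q p P Q (X : 'M[U]_p) : (p <= P)%N -> (q <= Q)%N -> fits f q p ->
  stm KA (conjm f Q (rmx A (inclmx R P p) *m X *m rmx A (inclmx R p P))) =
  stm KA (conjm f q X).
Proof.
move=> pP qQ h; rewrite -[RHS](stm_corner _ _ qQ); congr stm.
rewrite /conjm -(inclmxT _ P) -(inclmxT _ Q) !mulmxA -rmxM frame_incl //.
by rewrite -!mulmxA -!rmxM -!trmx_mul frame_incl // !mulmxA -!rmxM incl_frame.
Qed.

(** On each corner, conjugation by the matrix of f is isometric, and it is compatible
    with the inclusions of corners; so it extends to the completion. *)
Lemma kconj_ex f : isometry f -> exists c : KA -> KA, is_kconj f c.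
Proof.
move=> hf.
pose G (x y : KA) := exists p q (X : 'M[A]_p),
  [/\ fits f q p, x = stab_in KA X & y = stab_in KA (mxconj f q X)].
have G_iso x y x' y' : G x y -> G x' y' -> `|y - y'| = `|x - x'|.
  move=> [p [q [X [h -> ->]]]] [p' [q' [X' [h' -> ->]]]].
  have [n [pn pn']] : exists n, (p <= n)%N /\ (p' <= n)%N.
    by exists (p + p')%N; rewrite leq_addr leq_addl.
  have [r qr fr] := fits_ex f n (q + q')%N.
  have lq : (q <= r)%N by apply: leq_trans qr; exact: leq_addr.
  have lq' : (q' <= r)%N by apply: leq_trans qr; exact: leq_addl.
  rewrite !stm_mxconj -(conjm_incl _ pn lq) // -(conjm_incl _ pn' lq') //.
  rewrite -!(stm_in KA) -(stm_corner _ _ pn) -(stm_corner _ _ pn').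
  rewrite -!stmB /conjm -mulmxBl -mulmxBr norm_stm_isometry //.
    exact: frame_isometry.
  by apply: inidealB; apply/inidealMr/inidealMl/inideal_in.
have G_dense (x : KA) P : nbhs x P -> exists x' y', G x' y' /\ P x'.
  move=> /stab_near[p [X PX]]; have [q _ fq] := fits_ex f p 0.
  exists (stab_in KA X), (stab_in KA (mxconj f q X)); split=> //.
  by exists p, q, X.
have [c [c_lip cG]] := isometric_extension G_iso G_dense.
exists c; split=> [x|p q X fqp]; last by apply: cG; exists p, q, X.
apply: (@dist_cvg K KA KA (nbhs x) _ _ _ (fun t => `|x - t|)) => [t|]; first exact: c_lip.
rewrite -(normr0 KA) -(subrr x); apply: cvg_norm.
by apply: cvgB; [exact: cvg_cst | exact: cvg_id].
Qed.

End Conjugation.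

Section KconjTheory.
Variables (R : realType) (k : scalars) (A : cstar R k) (KA : stabilization A).
Local Notation K := (fld R k).
Local Notation U := (unitization A).
Implicit Types (f g : Rinf R -> Rinf R) (x y : KA).

Lemma kconjP f : isometry f -> is_kconj f (kconj KA f).
Proof. by move=> /(kconj_ex KA)[c hc]; apply: xgetPex; exists c. Qed.

Lemma kconj_cont f : isometry f -> continuous (kconj KA f).
Proof. by move=> /kconjP[]. Qed.

Lemma kconj_in f q p (X : 'M[A]_p) : isometry f -> fits f q p ->
  kconj KA f (stab_in KA X) = stab_in KA (mxconj f q X).
Proof. by move=> /kconjP[_ e]; exact: e. Qed.

Lemma kconj_stm f q p (X : 'M[U]_p) : isometry f -> fits f q p -> inideal X ->
  kconj KA f (stm KA X) = stm KA (conjm f q X).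
Proof.
move=> hf h iX; by rewrite {1}/stm (kconj_in _ hf h) stm_mxconj inmx_snd.
Qed.

Lemma kconj_stab f p (X : 'M[A]_p) : isometry f -> exists2 q, fits f q p &
  kconj KA f (stab_in KA X) = stm KA (conjm f q (inmx X)).
Proof.
move=> hf; have [q _ h] := fits_ex f p 0; exists q => //.
by rewrite -stm_in (kconj_stm hf h) //; exact: inideal_in.
Qed.

Lemma cvg_kconj f (T : Type) (F : set_system T) (FF : Filter F) (h : T -> KA) x :
  isometry f -> h t @[t --> F] --> x -> kconj KA f (h t) @[t --> F] --> kconj KA f x.
Proof. by move=> hf hx; apply: (cvg_comp _ _ hx); exact: kconj_cont. Qed.

(** An identity between continuous expressions in two variables need only be checked
    on matrices, which may moreover be taken of the same size. *)
Lemma stab_ext2 (W : normedModType K) (h1 h2 : KA -> KA -> W) :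
  (forall x, continuous (h1 x)) -> (forall x, continuous (h2 x)) ->
  (forall y, continuous (h1^~ y)) -> (forall y, continuous (h2^~ y)) ->
  (forall p (X Y : 'M[U]_p), inideal X -> inideal Y ->
    h1 (stm KA X) (stm KA Y) = h2 (stm KA X) (stm KA Y)) ->
  forall x y, h1 x y = h2 x y.
Proof.
move=> c1 c2 d1 d2 e x y; apply: (stab_ext (d1 y) (d2 y)) => p X {x}.
apply: (stab_ext (c1 _) (c2 _)) => q Y {y}.
have [X' [Y' [iX iY -> ->]]] := stab_common KA X Y (leq_addr q p) (leq_addl p q).
exact: e.
Qed.

Lemma kconjD f x y : isometry f ->
  kconj KA f (x + y) = kconj KA f x + kconj KA f y.
Proof.
move=> hf; move: x y; apply: stab_ext2 => [x y|x y|y x|y x|p X Y iX iY].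
- by apply: cvg_kconj => //; apply: cvgD; [exact: cvg_cst|exact: cvg_id].
- by apply: cvgD; [exact: cvg_cst|exact: kconj_cont].
- by apply: cvg_kconj => //; apply: cvgD; [exact: cvg_id|exact: cvg_cst].
- by apply: cvgD; [exact: kconj_cont|exact: cvg_cst].
have [q _ h] := fits_ex f p 0.
rewrite -stmD !(kconj_stm hf h) //; last exact: inidealD.
by rewrite -stmD /conjm mulmxDr mulmxDl.
Qed.

Lemma kconj0 f : isometry f -> kconj KA f 0 = 0.
Proof. by move=> hf; apply: (addrI (kconj KA f 0)); rewrite -kconjD // !addr0. Qed.

Lemma kconjN f x : isometry f -> kconj KA f (- x) = - kconj KA f x.
Proof.
by move=> hf; apply: (addrI (kconj KA f x)); rewrite -kconjD // !subrr kconj0.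
Qed.

Lemma kconj_sum f I (r : seq I) (P : pred I) (F : I -> KA) : isometry f ->
  kconj KA f (\sum_(i <- r | P i) F i) = \sum_(i <- r | P i) kconj KA f (F i).
Proof. by move=> hf; apply: big_morph => [x y|]; [exact: kconjD|exact: kconj0]. Qed.

Lemma kconjZ f (c : K) x : isometry f -> kconj KA f (c *: x) = c *: kconj KA f x.
Proof.
move=> hf; move: x; apply: stab_ext => [x|x|p X].
- by apply: cvg_kconj => //; apply: cvgZ; [exact: cvg_cst|exact: cvg_id].
- by apply: cvgZ; [exact: cvg_cst|exact: kconj_cont].
have [q _ h] := fits_ex f p 0.
rewrite -stab_inZ !(kconj_in _ hf h) -stab_inZ; congr stab_in.
apply/matrixP => i j; rewrite !mxE scaler_sumr; apply: eq_bigr => l _.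
rewrite scaler_sumr; apply: eq_bigr => l' _.
by rewrite !mxE !scalerA mulrC.
Qed.

Lemma kconj_norm f x : isometry f -> `|kconj KA f x| = `|x|.
Proof.
move=> hf; move: x; apply: (@stab_ext _ _ _ KA K^o) => [x|x|p X].
- by apply: cvg_norm; exact: kconj_cont.
- by apply: cvg_norm; exact: cvg_id.
have [q fq ->] := kconj_stab X hf.
rewrite -stm_in norm_stm_isometry //; first exact: frame_isometry.
exact: inideal_in.
Qed.

Lemma kconj_dist f x y : isometry f -> `|kconj KA f x - kconj KA f y| = `|x - y|.
Proof. by move=> hf; rewrite -kconjN // -kconjD // kconj_norm. Qed.

Lemma kconjM f x y : isometry f ->
  kconj KA f (cmul x y) = cmul (kconj KA f x) (kconj KA f y).
Proof.
move=> hf; move: x y; apply: stab_ext2 => [x y|x y|y x|y x|p X Y iX iY].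
- by apply: cvg_kconj => //; apply: cmul_cvg; [exact: cvg_cst|exact: cvg_id].
- by apply: cmul_cvg; [exact: cvg_cst|exact: kconj_cont].
- by apply: cvg_kconj => //; apply: cmul_cvg; [exact: cvg_id|exact: cvg_cst].
- by apply: cmul_cvg; [exact: kconj_cont|exact: cvg_cst].
have [q _ h] := fits_ex f p 0.
rewrite -stmM // !(kconj_stm hf h) //; last exact: inidealMr.
rewrite -stmM; try exact: inideal_conjm.
rewrite /conjm !mulmxA -(mulmxA _ (rmx A _^T) (rmx A (frame f q p))) -rmxM.
by rewrite frame_isometry // rmx1 mulmx1.
Qed.

(** The matrices F and G of f and g satisfy F^T G = 0. *)
Lemma kconj_orthogonal f g x y : isometry f -> isometry g -> orthogonal f g ->
  cmul (kconj KA f x) (kconj KA g y) = 0.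
Proof.
move=> hf hg fg; move: x y; apply: stab_ext2 => [x y|x y|y x|y x|p X Y iX iY].
- by apply: cmul_cvg; [exact: cvg_cst|exact: kconj_cont].
- exact: cvg_cst.
- by apply: cmul_cvg; [exact: kconj_cont|exact: cvg_cst].
- exact: cvg_cst.
have [q' _ fq'] := fits_ex f p 0; have [q lq gq] := fits_ex g p q'.
have fq := fitsW fq' lq (leqnn p).
rewrite !(@kconj_stm _ q) // -stmM; try exact: inideal_conjm.
rewrite /conjm !mulmxA -(mulmxA _ (rmx A _^T) (rmx A (frame g q p))) -rmxM.
by rewrite frame_orthogonal // rmx0 mulmx0 !mul0mx stm0.
Qed.

Lemma kconj_adj f x : isometry f -> kconj KA f (cadj x) = cadj (kconj KA f x).
Proof.
move=> hf; move: x; apply: stab_ext => [x|x|p X].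
- by apply: cvg_kconj => //; apply: cadj_cvg; exact: cvg_id.
- by apply: cadj_cvg; exact: kconj_cont.
have [q _ h] := fits_ex f p 0; have iX := inideal_in X.
rewrite -stm_in -stm_adj !(kconj_stm hf h) //; last exact: inideal_adj.
by rewrite -stm_adj /conjm !adjmM !adjm_rmx trmxK mulmxA.
Qed.

Lemma isometry_comp f g : isometry f -> isometry g -> isometry (f \o g).
Proof.
move=> [lf hf] [lg hg]; split=> [c v w|v w] /=; first by rewrite lg lf.
by rewrite hf hg.
Qed.

Lemma kconj_comp f g x : isometry f -> isometry g ->
  kconj KA (f \o g) x = kconj KA f (kconj KA g x).
Proof.
move=> hf hg; have hfg := isometry_comp hf hg.
move: x; apply: stab_ext => [x|x|p X]; first exact: kconj_cont.
  by apply: cvg_kconj => //; exact: kconj_cont.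
have iX := inideal_in X.
have [n _ gn] := fits_ex g p 0; have [q' _ fq'] := fits_ex f n 0.
have [q lq fgq] := fits_ex (f \o g) p q'.
have fq := fitsW fq' lq (leqnn n).
rewrite -stm_in (kconj_stm hg gn) // (kconj_stm hf fq) //; last exact: inideal_conjm.
rewrite (kconj_stm hfg fgq) // /conjm -(frame_comp _ (proj1 hf) gn).
by rewrite trmx_mul !rmxM !mulmxA.
Qed.

Lemma isometry_id : isometry (fun v : Rinf R => v).
Proof. by split. Qed.

Lemma kconj_id x : kconj KA (fun v => v) x = x.
Proof.
move: x; apply: stab_ext => [x|x|p X]; first exact/kconj_cont/isometry_id.
  exact: cvg_id.
have h : fits (fun v : Rinf R => v) p p by move=> l lp; rewrite size_polyXn.
rewrite -stm_in (kconj_stm isometry_id h) //; last exact: inideal_in.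
by rewrite /conjm (frame_id R p p) inclmx1 trmx1 rmx1 mul1mx mulmx1.
Qed.

Lemma norm_stm_mul q p (T G : 'M[R]_(q, p)) (X : 'M[U]_p) : G^T *m G = 1%:M ->
  inideal X -> `|stm KA (rmx A T *m X *m rmx A G^T)| ^+ 2 = hnorm KA (rmx A T *m X).
Proof.
move=> GG iX; rewrite -hnorm_square; last by apply/inidealMr/inidealMl.
rewrite /hnorm -(norm_stm_isometry _ GG (X := adjm (rmx A T *m X) *m (rmx A T *m X))).
  by rewrite adjmM adjm_rmx trmxK !mulmxA.
by apply/inidealMl/inidealMl.
Qed.

(** Let T = F - G for the matrices F and G of f and g.  Then F X F^T - G X G^T is the
    sum of T X G^T and the adjoint of T X^* F^T.  Both are bounded through the Gram
    matrix of T, whose entries are small although F and G may need arbitrarily many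
    rows.  The radius makes each summand at most e: the squared norm of either is at
    most d^2 times a bound that depends on X. *)
Lemma kconj_near f p (X : 'M[U]_p) (e : K) : isometry f -> inideal X -> 0 < e ->
  exists2 d : R, 0 < d & forall g, isometry g ->
    (forall l, (l < p)%N -> `|g 'X^l - f 'X^l : Rinf R| <= d) ->
    `|kconj KA f (stm KA X) - kconj KA g (stm KA X)| <= e + e.
Proof.
move=> hf iX e0.
have bnd (Y : 'M[U]_p) : exists2 s : R, 0 < s & stm_bound KA Y <= of_real k s.
  have /of_real_pos[s s0 es] : 0 < 1 + stm_bound KA Y.
    by rewrite ltr_pwDl // stm_bound_ge0.
  by exists s => //; rewrite es lerDr ler01.
have [s s0 hs] := bnd X; have [t t0 ht] := bnd (adjm X).
have [r r0 er] := of_real_pos e0.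
pose u := s + t; have u0 : 0 < u by rewrite addr_gt0.
exists (r / Num.sqrt u) => [|g hg gf]; first by rewrite divr_gt0 // sqrtr_gt0.
set d := r / Num.sqrt u in gf.
have d0 : 0 <= d by rewrite divr_ge0 ?sqrtr_ge0 // ltW.
have du : d ^+ 2 * u = r ^+ 2.
  by rewrite exprMn exprVn sqr_sqrtr ?ltW // mulfVK // gt_eqF.
have [q' _ fq'] := fits_ex f p 0; have [q lq gq] := fits_ex g p q'.
have fq := fitsW fq' lq (leqnn p).
have gramf := frame_isometry hf fq; have gramg := frame_isometry hg gq.
rewrite !(@kconj_stm _ q) // -stmB.
set F := frame f q p in gramf; set G := frame g q p in gramg.
pose T := frame (fun v => f v - g v) q p.
have fT : fits (fun v => f v - g v) q p.
  by move=> l lp; rewrite (leq_trans (size_polyD _ _)) // size_polyN geq_max fq ?gq.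
have TE : T = F - G by apply/matrixP => i j; rewrite !mxE coefB.
have Td l l' : `|(T^T *m T) l l'| <= d ^+ 2.
  rewrite frame_gram // (le_trans (ip_le _ _)) // expr2.
  by rewrite ler_pM ?normr_ge0 // distrC gf.
have step (Y : 'M[U]_p) H : H^T *m H = 1%:M -> inideal Y -> stm_bound KA Y <= of_real k u ->
    `|stm KA (rmx A T *m Y *m rmx A H^T)| <= e.
  move=> HH iY hY; rewrite -(@ler_pXn2r _ 2) ?nnegrE ?(ltW e0) ?normr_ge0 //.
  rewrite norm_stm_mul // (le_trans (hnorm_le _ _ Td)) //.
  have -> : e ^+ 2 = of_real k (d ^+ 2) * of_real k u.
    by rewrite -of_realM du [r ^+ 2]expr2 of_realM er -expr2.
  rewrite ler_wpM2l //.
  by rewrite of_real_ge0 sqr_ge0.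
have -> : conjm f q X - conjm g q X =
    rmx A T *m X *m rmx A G^T + adjm (rmx A T *m adjm X *m rmx A F^T).
  rewrite !adjmM adjmK !adjm_rmx trmxK TE !rmxB raddfB rmxB /conjm -/F -/G.
  rewrite !mulmxBl !mulmxBr [RHS]addrC !mulmxA addrA subrK.
  by [].
rewrite stmD (le_trans (ler_normD _ _)) // lerD //.
  apply: step => //; rewrite (le_trans hs) // of_real_le lerDl ltW //.
rewrite stm_adj norm_cadj; apply: step => //; first exact: inideal_adj.
by rewrite (le_trans ht) // of_real_le lerDr ltW.
Qed.

End KconjTheory.

Section JointContinuity.
Variable R : realType.

Lemma licomp_eval m i v : continuous (fun f : lin_isom R m => licomp f i v : Rinf R).
Proof.
move=> f.
pose V : topologicalType := {ptws Rinf R -> Rinf R}.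
pose W : topologicalType := {ptws 'I_m -> V}.
have c1 : continuous (fun f : lin_isom R m => val f : W) by exact: initial_continuous.
have c2 : continuous (fun h : W => h i : V) by exact: proj_continuous.
have c3 : continuous (fun h : V => h v : Rinf R) by exact: proj_continuous.
exact: (cvg_comp _ _ (cvg_comp _ _ (c1 f) (c2 _)) (c3 _)).
Qed.

Variables (k : scalars) (A : cstar R k) (KA : stabilization A).
Local Notation K := (fld R k).

(** All conjugations are isometric, hence equicontinuous, so that x may be replaced by
    a matrix; there only finitely many basis vectors matter. *)
Lemma kconj_joint m (i : 'I_m) (T : Type) (F : set_system T) (FF : Filter F)
    (f : T -> lin_isom R m) (x : T -> KA) f0 x0 :
  f t @[t --> F] --> f0 -> x t @[t --> F] --> x0 ->
  kconj KA (licomp (f t) i) (x t) @[t --> F] --> kconj KA (licomp f0 i) x0.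
Proof.
move=> ff0 xx0; apply/cvgrPdist_lt => e e0.
have e50 : 0 < e / 5 by rewrite divr_gt0.
have hf (g : lin_isom R m) := licomp_isometry g i.
have [p [X x0X]] := stab_near (nbhsx_ballx x0 (e / 5) e50).
rewrite -stm_in -ball_normE /ball_ /= in x0X.
have [d d0 hd] := kconj_near KA (hf f0) (inideal_in X) e50.
have near_basis : \forall t \near F, forall l, (l < p)%N ->
    `|licomp (f t) i 'X^l - licomp f0 i 'X^l : Rinf R| <= d.
  elim: p {X x0X hd} => [|p IH]; first exact: nearW.
  have /cvgrPdist_lt/(_ _ d0) : licomp (f t) i 'X^p @[t --> F] --> (licomp f0 i 'X^p : Rinf R).
    exact: (cvg_comp _ _ ff0 (@licomp_eval m i 'X^p f0)).
  apply: filterS2 IH => t h1 h2 l; rewrite ltnS leq_eqVlt => /orP[/eqP->|]; last exact: h1.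
  by rewrite distrC ltW.
have /cvgrPdist_lt/(_ _ e50) near_x := xx0.
apply: filterS2 near_basis near_x => t hb hx.
set s := stm KA (inmx X) in x0X hd.
(* One summand for replacing x0 by the matrix s, two for changing the isometry on s,
   and two for going from s to x t by way of x0. *)
have -> : e = e / 5 + (e / 5 + e / 5) + (e / 5 + e / 5).
  by field.
rewrite (le_lt_trans (ler_distD (kconj KA (licomp f0 i) s) _ _)) //.
rewrite (kconj_dist _ _ (hf f0)) -addrA ltr_leD //.
rewrite (le_trans (ler_distD (kconj KA (licomp (f t) i) s) _ _)) //.
rewrite lerD //; first exact: hd.
rewrite (kconj_dist _ _ (hf (f t))) (le_trans (ler_distD x0 _ _)) //.
by rewrite lerD // ltW // distrC.
Qed.

End JointContinuity.

(** * Positive definiteness *)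

Section Definite.
Variables (R : realType) (k : scalars) (A : cstar R k) (KA : stabilization A).
Local Notation K := (fld R k).
Local Notation U := (unitization A).

Definition padm n p (X : 'M[U]_p) : 'M[U]_n :=
  rmx A (inclmx R n p) *m X *m rmx A (inclmx R p n).

Lemma inideal_padm n p (X : 'M[U]_p) : inideal X -> inideal (padm n X).
Proof. by move=> iX; apply/inidealMr/inidealMl. Qed.

Lemma padm_gram n p (X : 'M[U]_p) : (p <= n)%N ->
  adjm (padm n X) *m padm n X = padm n (adjm X *m X).
Proof.
move=> pn; rewrite /padm !adjmM !adjm_rmx !inclmxT !mulmxA.
rewrite -(mulmxA _ (rmx A (inclmx R p n))) -rmxM inclmxM // inclmx1 rmx1.
by rewrite mulmx1.
Qed.

Lemma stm_padm n p (X : 'M[U]_p) : (p <= n)%N -> stm KA (padm n X) = stm KA X.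
Proof. exact: stm_corner. Qed.

Lemma padmD n p (X Y : 'M[U]_p) : padm n (X + Y) = padm n X + padm n Y.
Proof. by rewrite /padm mulmxDr mulmxDl. Qed.

(** X^* X + Y^* Y is the Gram matrix of the column of X and Y, which is padded with
    zeros to be square. *)
Lemma gram_add n (X Y : 'M[U]_n) : exists2 Z : 'M[U]_(n + n),
  (inideal X -> inideal Y -> inideal Z) &
  adjm Z *m Z = padm (n + n) (adjm X *m X + adjm Y *m Y).
Proof.
pose I := inclmx R (n + n) n; pose S : 'M[R]_(n + n, n) := col_mx 0 1%:M.
have eI : I = col_mx 1%:M 0.
  apply/matrixP => i j; rewrite !mxE; case: splitP => l el; rewrite el !mxE //.
  by rewrite gtn_eqF // ltn_addr.
have II : I^T *m I = 1%:M by apply: inclmxK; exact: leq_addr.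
have SS : S^T *m S = 1%:M.
  by rewrite /S tr_col_mx mul_row_col trmx0 mul0mx add0r trmx1 mulmx1.
have SI : S^T *m I = 0.
  by rewrite eI /S tr_col_mx mul_row_col trmx0 mul0mx mulmx0 addr0.
have IS : I^T *m S = 0 by rewrite -[LHS]trmxK trmx_mul trmxK SI trmx0.
pose M := rmx A I *m X + rmx A S *m Y.
have MM : adjm M *m M = adjm X *m X + adjm Y *m Y.
  rewrite /M adjmD !adjmM !adjm_rmx mulmxDr !mulmxDl !mulmxA.
  rewrite -!(mulmxA _ (rmx A _^T)) -!rmxM II SS SI IS !rmx1 !rmx0.
  by rewrite !mulmx0 !mulmx1 !mul0mx addr0 add0r.
exists (M *m rmx A I^T).
  by move=> iX iY; apply/inidealMr/inidealD; exact: inidealMl.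
by rewrite adjmM adjm_rmx trmxK !mulmxA -(mulmxA _ (adjm M)) MM /I inclmxT.
Qed.

(** An approximation of the first summand by a matrix is stacked below Y, so that one
    summand fewer remains. *)
Lemma norm_stm_sums (s : seq KA) p (X Y : 'M[U]_p) : inideal X -> inideal Y ->
  `|stm KA X| ^+ 2 <= `|stm KA (adjm X *m X + adjm Y *m Y) +
                        \sum_(x <- s) cmul (cadj x) x|.
Proof.
elim: s => [|x s IH] in p X Y *; move=> iX iY.
  by rewrite big_nil addr0; exact: norm_stm_sum.
rewrite big_cons; apply/ler_addgt0Pr => e e0.
have /cvgrPdist_lt/(_ _ e0) : cmul (cadj y) y @[y --> x] --> cmul (cadj x) x.
  by apply: cmul_cvg; [apply: cadj_cvg|]; exact: cvg_id.
move=> /stab_near[q [W0]]; rewrite -stm_in => hW.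
pose n := (p + q)%N; pose W := inmx W0.
have pn : (p <= n)%N by exact: leq_addr.
have qn : (q <= n)%N by exact: leq_addl.
have [Z iZ eZ] := gram_add (padm n Y) (padm n W).
have n2 : (n <= n + n)%N by exact: leq_addr.
have iW : inideal W by exact: inideal_in.
have iX' : inideal (padm (n + n) (padm n X)) by do 2! apply: inideal_padm.
have iZ' : inideal Z by apply: iZ; exact: inideal_padm.
have := IH _ _ _ iX' iZ'.
rewrite eZ !padm_gram // !stmD !padmD !stmD !stm_padm // => /le_trans; apply.
set a := stm KA (adjm X *m X); set b := stm KA (adjm Y *m Y).
rewrite [stm KA (adjm W *m W)]stmM //; last exact: inideal_adj.
rewrite stm_adj; set w := cmul (cadj (stm KA W)) _ in hW *; set S := \sum_(x <- s) _.
have -> : a + (b + w) + S = (a + b + (cmul (cadj x) x + S)) - (cmul (cadj x) x - w).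
  by rewrite opprB !addrA [in RHS](ACl (1*2*5*4*3*6)%AC) /= addrK.
by rewrite (le_trans (ler_normB _ _)) // lerD // ltW.
Qed.

(** By [norm_stm_sums], adding squares to a square does not lower its norm. *)
Lemma sum_cstar_eq0 (s : seq KA) (x : KA) :
  cmul (cadj x) x + \sum_(y <- s) cmul (cadj y) y = 0 -> x = 0.
Proof.
move=> x0; apply/eqP; rewrite -normr_eq0 -sqrf_eq0 -normr_le0.
rewrite normrX normr_id -cstar_id; apply/ler_addgt0Pr => e e0; rewrite add0r.
have e20 : 0 < e / 2 by rewrite divr_gt0.
have /cvgrPdist_lt/(_ _ e20) : cmul (cadj y) y @[y --> x] --> cmul (cadj x) x.
  by apply: cmul_cvg; [apply: cadj_cvg|]; exact: cvg_id.
move=> /stab_near[p [X hX]]; have iX := inideal_in X; rewrite -stm_in in hX.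
have i0 : inideal (0 : 'M[U]_p) by move=> i j; rewrite mxE.
have := norm_stm_sums s iX i0.
rewrite mulmx0 addr0 stmM //; last exact: inideal_adj.
rewrite stm_adj -cstar_id; set w := cmul (cadj (stm KA _)) _ in hX *; set S := \sum_(y <- s) _ => hw.
have eS : S = - cmul (cadj x) x by apply/eqP; rewrite -addr_eq0 addrC; exact/eqP.
rewrite -[cmul (cadj x) x](subrK w) (le_trans (ler_normD _ _)) // [leRHS]splitr.
rewrite lerD ?(ltW hX) // (le_trans hw) // eS.
by rewrite distrC ltW.
Qed.

(** On the diagonal, X^* X = 0 says that sums of squares vanish.  The scalar parts
    vanish first, after which the remaining summands lie in the stabilization. *)
Lemma definite_stab : definite KA.
Proof.
move=> p q X XX; apply/matrixP => i j; rewrite mxE.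
have := congr1 (fun M : 'M_q => M j j) XX; rewrite !mxE => sum0.
have norm_sconj (c : K) : sconj c * c = `|c| ^+ 2.
  case: k c => /= c; first by rewrite real_normK ?num_real // expr2.
  by rewrite normCK mulrC.
have fst0 l : (X l j).1 = 0.
  have : \sum_l (adjm X j l * X l j).1 = 0 by rewrite -ufst_sum sum0.
  under eq_bigr => l' _ do rewrite adjmE umulE [(_, _).1]/= norm_sconj.
  move=> /eqP; rewrite psumr_eq0 => [/allP/(_ l (mem_index_enum l))|l' _].
    by rewrite sqrf_eq0 normr_eq0 => /eqP.
  by rewrite exprn_ge0.
have : \sum_l (adjm X j l * X l j).2 = 0 by rewrite -usnd_sum sum0.
under eq_bigr => l _ do rewrite adjmE umulE /= fst0 sconj0 !scale0r !add0r.
rewrite (bigD1 i) //= => /= snd0.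
have : cmul (cadj (X i j).2) (X i j).2 +
    \sum_(y <- [seq (X l j).2 | l <- index_enum 'I_p & l != i]) cmul (cadj y) y = 0.
  by rewrite big_map big_filter.
move=> /sum_cstar_eq0 x0.
by rewrite [X i j]surjective_pairing fst0 x0.
Qed.

End Definite.

(** * Tensor products of elements of the unitization *)

Lemma prod_sum_mdigit (S : pzSemiRingType) m (q : 'I_m -> nat)
    (F : forall i, 'I_(q i) -> S) :
  \prod_i \sum_l F i l = \sum_(L < \prod_i q i) \prod_i F i (mdigit L i).
Proof.
pose P i := [ffun l : 'I_(q i) => F i l].
transitivity (\prod_i \sum_(l : 'I_(q i)) P i l).
  by apply: eq_bigr => i _; apply: eq_bigr => l _; rewrite ffunE.
under eq_bigr => i _ do rewrite (big_tag (fun i l => P i l)).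
rewrite bigA_distr_big_dep /= -(@big_fprod _ _ _ _ _ _ _ P).
rewrite (reindex (fun L : 'I_(\prod_i q i) => fprod_of_dffun (mdigit L))) /=.
  by apply: eq_bigr => L _; apply: eq_bigr => i _; rewrite ffunE fprodE.
apply: onW_bij; apply: bij_comp; first exact: fprod_of_dffun_bij.
by exists (@mrank _ _); [exact: mdigitK | exact: mrankK].
Qed.

Section Tensor.
Variables (R : realType) (k : scalars) (A : cstar R k) (KA : stabilization A).
Local Notation K := (fld R k).
Local Notation U := (unitization KA).

Definition tensu m (f : lin_isom R m) (u : 'I_m -> U) : U :=
  (\prod_i (u i).1,
   \sum_i (\prod_(j | j != i) (u j).1) *: kconj KA (licomp f i) (u i).2).

Definition uconj m (f : lin_isom R m) i (u : U) : U := (u.1, kconj KA (licomp f i) u.2).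

Lemma upairP (u v : U) : u.1 = v.1 -> u.2 = v.2 -> u = v.
Proof. by case: u v => [a x] [b y] /= -> ->. Qed.

Section OneIsometry.
Variables (m : nat) (f : lin_isom R m).
Let hf := licomp_isometry f.

Lemma cmul_suml (x : KA) I (r : seq I) (P : pred I) (F : I -> KA) :
  cmul (\sum_(i <- r | P i) F i) x = \sum_(i <- r | P i) cmul (F i) x.
Proof. by apply: (big_morph (fun y => cmul y x)) => [y z|]; rewrite ?cmulDl ?mul0c. Qed.

Lemma cmul_sumr (x : KA) I (r : seq I) (P : pred I) (F : I -> KA) :
  cmul x (\sum_(i <- r | P i) F i) = \sum_(i <- r | P i) cmul x (F i).
Proof. by apply: (big_morph (fun y => cmul x y)) => [y z|]; rewrite ?cmulDr ?cmul0. Qed.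

Lemma kconj_cmul0 i j x y : i != j ->
  cmul (kconj KA (licomp f i) x) (kconj KA (licomp f j) y) = 0.
Proof. by move=> ij; apply: kconj_orthogonal => //; exact: licomp_orthogonal. Qed.

Lemma kconj_cmul_sum i x (c : 'I_m -> K) (y : 'I_m -> KA) :
  cmul (kconj KA (licomp f i) x) (\sum_j c j *: kconj KA (licomp f j) (y j)) =
  c i *: kconj KA (licomp f i) (cmul x (y i)).
Proof.
rewrite cmul_sumr (bigD1 i) //= big1 => [|j ji]; last first.
  by rewrite cmulZr kconj_cmul0 ?scaler0 // eq_sym.
by rewrite addr0 cmulZr kconjM.
Qed.

(** Conjugates of the ideal by different components of f annihilate each other, so
    that in the expansion of the product no mixed terms survive. *)
Lemma tensu_prod u : tensu f u = \prod_i uconj f i (u i).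
Proof.
suff h (r : seq 'I_m) : uniq r -> \prod_(i <- r) uconj f i (u i) =
    (\prod_(i <- r) (u i).1, \sum_(i <- r)
      (\prod_(j <- r | j != i) (u j).1) *: kconj KA (licomp f i) (u i).2).
  by rewrite h ?index_enum_uniq.
elim: r => [|a r IH]; first by rewrite !big_nil.
rewrite /= => /andP[ar ur]; rewrite !big_cons IH // umulE /=.
apply: upairP => //=; rewrite eqxx /=.
have -> : cmul (kconj KA (licomp f a) (u a).2) (\sum_(i <- r)
    (\prod_(j <- r | j != i) (u j).1) *: kconj KA (licomp f i) (u i).2) = 0.
  rewrite cmul_sumr big1_seq // => i /= ir; rewrite cmulZr kconj_cmul0 ?scaler0 //.
  by apply: contraNneq ar => ->.
rewrite addr0.
rewrite addrC; congr (_ *: _ + _).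
  rewrite [LHS]big_seq_cond [RHS]big_seq_cond; apply: eq_bigl => i.
  by case ir: (i \in r) => //=; apply/esym; apply: contraNneq ar => <-.
rewrite scaler_sumr; apply: eq_big_seq => i ir; rewrite big_cons.
have -> : a != i by apply: contraNneq ar => ->.
by rewrite scalerA.
Qed.

Lemma tensuM u v : tensu f u * tensu f v = tensu f (fun i => u i * v i).
Proof.
apply: upairP => /=; first by rewrite big_split.
rewrite cmul_suml.
under [X in _ + X]eq_bigr => i _ do rewrite cmulZl kconj_cmul_sum scalerA.
rewrite !scaler_sumr -!big_split; apply: eq_bigr => i _ /=.
rewrite big_split /= !kconjD // !kconjZ // !scalerDr !scalerA.
have D (w : 'I_m -> U) : \prod_j (w j).1 = (w i).1 * \prod_(j | j != i) (w j).1.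
  exact: bigD1.
rewrite !D; congr (_ *: _ + _ *: _ + _ *: _); ring.
Qed.

Lemma uconjD i u v : uconj f i (u + v) = uconj f i u + uconj f i v.
Proof. by apply: upairP => //=; rewrite kconjD. Qed.

Lemma uconj0 i : uconj f i 0 = 0.
Proof. by apply: upairP => //=; rewrite kconj0. Qed.

Lemma tensu_sum (q : 'I_m -> nat) (u : forall i, 'I_(q i) -> U) :
  tensu f (fun i => \sum_l u i l) =
  \sum_(L < \prod_i q i) tensu f (fun i => u i (mdigit L i)).
Proof.
rewrite tensu_prod.
under eq_bigr => i _ do rewrite (big_morph _ (uconjD i) (uconj0 i)).
by rewrite prod_sum_mdigit; apply: eq_bigr => L _; rewrite tensu_prod.
Qed.

Lemma sconj_prod I (r : seq I) (P : pred I) (F : I -> K) :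
  sconj (\prod_(i <- r | P i) F i) = \prod_(i <- r | P i) sconj (F i).
Proof. exact: (big_morph _ (@sconjM R k) (@sconj1 R k)). Qed.

Lemma tensu_adj u : uadj (tensu f u) = tensu f (fun i => uadj (u i)).
Proof.
apply: upairP => /=; first exact: sconj_prod.
rewrite (big_morph _ (@cadjD _ _ KA) (cadj0 KA)); apply: eq_bigr => i _.
by rewrite cadjZ sconj_prod kconj_adj.
Qed.

Lemma tensu_zero u i : u i = 0 -> tensu f u = 0.
Proof.
move=> ui; apply: upairP => /=; first by rewrite (bigD1 i) //= ui mul0r.
rewrite big1 // => j _; have [->|ji] := eqVneq j i; first by rewrite ui kconj0 ?scaler0.
by rewrite (bigD1 i) 1?eq_sym //= ui mul0r scale0r.
Qed.

Lemma tensu1 : tensu f (fun=> 1) = 1.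
Proof.
by rewrite tensu_prod big1 // => i _; apply: upairP => //=; rewrite kconj0.
Qed.

Lemma tensu_bool (b : 'I_m -> bool) :
  tensu f (fun i => (b i)%:R) = [forall i, b i]%:R.
Proof.
case: (boolP [forall i, b i]) => [/forallP h|].
  transitivity (tensu f (fun=> 1)); last exact: tensu1.
  by congr tensu; apply/funext => i; rewrite h.
by rewrite negb_forall => /existsP[i /negbTE bi]; rewrite (tensu_zero (i := i)) // bi.
Qed.

End OneIsometry.

Lemma tensu_act m n (f : lin_isom R n) (s : ordbij m n) (u : 'I_m -> U) :
  tensu (li_act f s) u = tensu f (fun j => u (ordbij_inv s j)).
Proof.
have sb (P : pred 'I_n) : {on P, bijective s} by exact/onW_bij/ordbij_funP.
apply: upairP => /=.
  by rewrite [RHS](reindex s (sb _)) /=; apply: eq_bigr => i _; rewrite ordbij_inv_funK.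
rewrite [RHS](reindex s (sb _)) /=; apply: eq_bigr => i _; rewrite ordbij_inv_funK.
congr (_ *: _); rewrite [RHS](reindex s (sb _)) /=.
apply: eq_big => j; last by rewrite ordbij_inv_funK.
by rewrite (inj_eq (bij_inj (ordbij_funP s))).
Qed.

Lemma tensu_comp m (n : 'I_m -> nat) (f : lin_isom R m) (g : forall i, lin_isom R (n i))
    (u : 'I_(\sum_i n i) -> U) :
  tensu (li_comp f g) u =
  tensu f (fun i => tensu (g i) (fun j => u (tagnat.Rank i j))).
Proof.
have nest (F : 'I_(\sum_i n i) -> K) :
    \prod_s F s = \prod_i \prod_(j < n i) F (tagnat.Rank i j).
  rewrite (reindex _ (@tagnat.rank_bij_on m n)) /= sig_big_dep /=.
  by apply: eq_bigr => s _; rewrite tagnat.rankE.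
apply: upairP; first exact: nest.
rewrite /tensu [LHS]/= [RHS]/=.
rewrite (reindex _ (@tagnat.rank_bij_on m n)) /=.
under [RHS]eq_bigr => i _ do
  rewrite (kconj_sum _ _ _ (licomp_isometry f i)) scaler_sumr.
rewrite sig_big_dep /=; apply: eq_bigr => -[i j] _ /=.
have eR : tagnat.rank (existT (fun i => 'I_(n i)) i j) = tagnat.Rank i j by [].
rewrite eR kconjZ ?scalerA; last exact: licomp_isometry.
congr (_ *: _).
  rewrite big_mkcond /=.
  rewrite nest (bigD1 i) //= mulrC; congr (_ * _).
    apply: eq_bigr => i' i'i; apply: eq_bigr => j' _.
    by rewrite -val_eqE /= tagnat.eq_Rank (negbTE i'i).
  rewrite [RHS]big_mkcond /=; apply: eq_bigr => j' _.
  by rewrite -val_eqE /= tagnat.eq_Rank eqxx.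
rewrite -kconj_comp; [|exact: licomp_isometry|exact: licomp_isometry].
congr (kconj _ _ _); apply/funext => v /=.
by rewrite /licomp /= /tagnat.sig1 /tagnat.sig2 /tagnat.Rank tagnat.rankK.
Qed.

Lemma tensu_id (u : U) : tensu (li_id R) (fun=> u) = u.
Proof.
apply: upairP => /=; first by rewrite big_ord1.
rewrite big_ord1 big1 ?scale1r; first exact: kconj_id.
by move=> j; rewrite (ord1 j).
Qed.

End Tensor.

Section TensorContinuity.
Variables (R : realType) (k : scalars).
Local Notation K := (fld R k).

Lemma cvg_bigprod (T : Type) (F : set_system T) (FF : Filter F) I (r : seq I) (P : pred I)
    (f : I -> T -> K) (a : I -> K) : (forall i, f i t @[t --> F] --> a i) ->
  \prod_(i <- r | P i) f i t @[t --> F] --> \prod_(i <- r | P i) a i.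
Proof.
move=> fa; elim: r => [|i r IH].
  under eq_cvg do rewrite big_nil.
  by rewrite big_nil; exact: cvg_cst.
under eq_cvg do rewrite big_cons.
by rewrite big_cons; case: (P i) => //; apply: cvgM.
Qed.

Lemma cvg_bigsum (V : normedModType K) (T : Type) (F : set_system T) (FF : Filter F) I
    (r : seq I) (P : pred I) (f : I -> T -> V) (a : I -> V) :
  (forall i, f i t @[t --> F] --> a i) ->
  \sum_(i <- r | P i) f i t @[t --> F] --> \sum_(i <- r | P i) a i.
Proof.
move=> fa; elim: r => [|i r IH].
  under eq_cvg do rewrite big_nil.
  by rewrite big_nil; exact: cvg_cst.
under eq_cvg do rewrite big_cons.
by rewrite big_cons; case: (P i) => //; apply: cvgD.
Qed.

Section Pairs.
Variable B : cstar R k.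
Local Notation U := (unitization B).
Variables (T : Type) (F : set_system T) (FF : Filter F).

Lemma cvg_upair (f : T -> K) (x : T -> B) a b : f t @[t --> F] --> a ->
  x t @[t --> F] --> b -> ((f t, x t) : U) @[t --> F] --> ((a, b) : U).
Proof.
move=> fa xb.
have h : ((f t, x t) : (K^o * B)%type) @[t --> F] --> ((a, b) : (K^o * B)%type).
  by have := @cvg_pair T K B F (nbhs (a : K)) (nbhs b) FF _ _ f x fa xb; apply.
exact: h.
Qed.

Lemma cvg_ufst (u : T -> U) (v : U) : u t @[t --> F] --> v ->
  (u t).1 @[t --> F] --> (v.1 : K).
Proof.
move=> uv; apply: (cvg_comp _ _ uv).
exact: (@cvg_fst K B (nbhs v.1) (nbhs v.2) _).
Qed.

Lemma cvg_usnd (u : T -> U) (v : U) : u t @[t --> F] --> v ->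
  (u t).2 @[t --> F] --> (v.2 : B).
Proof.
move=> uv; apply: (cvg_comp _ _ uv).
exact: (@cvg_snd K B (nbhs v.1) (nbhs v.2) _).
Qed.

Lemma umul_cvg (u v : T -> U) (a b : U) : u t @[t --> F] --> a -> v t @[t --> F] --> b ->
  u t * v t @[t --> F] --> a * b.
Proof.
move=> ua vb; rewrite umulE; under eq_cvg do rewrite umulE.
apply: cvg_upair; first by apply: cvgM; exact: cvg_ufst.
apply: cvgD; last by apply: cmul_cvg; exact: cvg_usnd.
by apply: cvgD; apply: cvgZ; (exact: cvg_ufst || exact: cvg_usnd).
Qed.

Lemma sconj_cvg (f : T -> K) a : f t @[t --> F] --> a -> sconj (f t) @[t --> F] --> sconj a.
Proof.
move=> fa; apply: (@dist_cvg K K T F FF _ _ (fun t => `|a - f t|)) => [t|].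
  have sN (x : K) : `|sconj x| = `|x| by case: k x => //= x; rewrite norm_conjC.
  have -> : sconj a - sconj (f t) = sconj (a - f t).
    by apply: (addIr (sconj (f t))); rewrite -sconjD !subrK.
  by rewrite sN.
rewrite -(normr0 K) -(subrr a); apply: cvg_norm.
by apply: cvgB => //; exact: cvg_cst.
Qed.

Lemma uadj_cvg (u : T -> U) (a : U) : u t @[t --> F] --> a ->
  uadj (u t) @[t --> F] --> uadj a.
Proof.
move=> ua; apply: cvg_upair; first by apply: sconj_cvg; exact: cvg_ufst.
by apply: cadj_cvg; exact: cvg_usnd.
Qed.

End Pairs.

Variables (A : cstar R k) (KA : stabilization A).

Lemma tensu_cvg (T : Type) (F : set_system T) (FF : Filter F) m
    (f : T -> lin_isom R m) f0 (u : T -> 'I_m -> unitization KA) u0 :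
  f t @[t --> F] --> f0 -> (forall i, u t i @[t --> F] --> u0 i) ->
  tensu (f t) (u t) @[t --> F] --> tensu f0 u0.
Proof.
move=> ff uu; apply: cvg_upair.
  by apply: cvg_bigprod => i; exact: cvg_ufst.
apply: cvg_bigsum => i; apply: cvgZ.
  by apply: cvg_bigprod => j; exact: cvg_ufst.
by apply: kconj_joint => //; exact: cvg_usnd.
Qed.

End TensorContinuity.

Section TensorNaturality.
Variables (R : realType) (k : scalars) (A B : cstar R k).
Variables (KA : stabilization A) (KB : stabilization B).
Variables (phi : star_hom A B) (psi : star_hom KA KB).
Hypothesis hpsi : is_induced phi psi.

Lemma mxconj_map f q p (X : 'M[A]_p) :
  map_mx phi (mxconj f q X) = mxconj f q (map_mx phi X).
Proof.
apply/matrixP => i j; rewrite !mxE (big_morph _ (shomD phi) (shom0 phi)).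
apply: eq_bigr => l _; rewrite (big_morph _ (shomD phi) (shom0 phi)).
by apply: eq_bigr => l' _; rewrite shomZ !mxE.
Qed.

Lemma kconj_natural f x : isometry f -> psi (kconj KA f x) = kconj KB f (psi x).
Proof.
move=> hf; have [cpsi epsi] := hpsi.
move: x; apply: stab_ext => [x|x|p X].
- by apply: (cvg_comp _ _ (kconj_cont (KA := KA) hf (x := x))); exact: cpsi.
- by apply: (cvg_comp _ _ (cpsi x)); exact: kconj_cont.
have [q _ h] := fits_ex f p 0.
by rewrite (kconj_in _ _ hf h) !epsi (kconj_in _ _ hf h) mxconj_map.
Qed.

Lemma tensu_natural m (f : lin_isom R m) u :
  umap psi (tensu f u) = tensu f (fun i => umap psi (u i)).
Proof.
apply: upairP => //=; rewrite (big_morph _ (shomD psi) (shom0 psi)).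
by apply: eq_bigr => i _; rewrite shomZ kconj_natural //; exact: licomp_isometry.
Qed.

End TensorNaturality.

(** * Direct sums and tensor products of matrices *)

Section Entries.
Variables (R : realType) (k : scalars) (B : cstar R k).
Local Notation U := (unitization B).

(** Entries addressed by numbers, whose type does not mention the dimensions. *)
Definition ent p q (X : 'M[U]_(p, q)) (i j : nat) : U :=
  if insub i is Some i' then if insub j is Some j' then X i' j' else 0 else 0.

Lemma entE p q (X : 'M[U]_(p, q)) (i : 'I_p) (j : 'I_q) : ent X i j = X i j.
Proof. by rewrite /ent !valK. Qed.

Lemma ent_out p q (X : 'M[U]_(p, q)) (i j : nat) :
  ~~ ((i < p) && (j < q))%N -> ent X i j = 0.
Proof.
rewrite negb_and /ent => /orP[ip|jq]; first by rewrite insubN.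
by case: insubP => // i' _ _; rewrite insubN.
Qed.

Lemma GMx_ent p q p' q' (X : 'M[U]_(p, q)) (Y : 'M[U]_(p', q')) :
  p = p' -> q = q' -> (forall (i : 'I_p) (j : 'I_q), X i j = ent Y i j) -> GMx X = GMx Y.
Proof.
move=> e1 e2; case: p' / e1 Y; case: q' / e2 => Y e.
by congr GMx; apply/matrixP => i j; rewrite e entE.
Qed.

Lemma ent_adjm p q (X : 'M[U]_(p, q)) i j : ent (adjm X) i j = uadj (ent X j i).
Proof.
rewrite /ent; case: insubP => [i' _ _|_]; case: insubP => [j' _ _|_]; rewrite ?uadj0 //.
by rewrite adjmE.
Qed.

End Entries.

(** The second digit as a number: its bound, which depends on the first digit, is
    hidden from its type. *)
Definition sig2n a (p : 'I_a -> nat) (l : 'I_(\sum_x p x)) : nat := tagnat.sig2 l.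

Lemma sig2n_Rank a (p : 'I_a -> nat) x (mu : 'I_(p x)) : sig2n (tagnat.Rank x mu) = mu.
Proof. exact: Rank2_val. Qed.

Lemma sig2n_sum_bij a b (s : ordbij a b) (p : 'I_a -> nat) l :
  sig2n (sum_bij s p l) = sig2n l.
Proof. exact: sum_bij2. Qed.

Section DirectSum.
Variables (R : realType) (k : scalars) (B : cstar R k).
Local Notation U := (unitization B).

Definition oplusm a (p q : 'I_a -> nat) (M : forall x, 'M[U]_(p x, q x)) :
    'M[U]_(\sum_x p x, \sum_x q x) :=
  \mxblock_(x < a, y < a)
    if x == y then conform_mx (0 : 'M_(p x, q y)) (M x) else 0.

Lemma mxoplusE a (p q : 'I_a -> nat) (M : forall x, 'M[U]_(p x, q x)) :
  mxoplus (fun x => GMx (M x)) = GMx (oplusm M).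
Proof. by []. Qed.

Lemma oplusmE a (p q : 'I_a -> nat) (M : forall x, 'M[U]_(p x, q x)) i j :
  oplusm M i j = if tagnat.sig1 i == tagnat.sig1 j
    then ent (M (tagnat.sig1 i)) (sig2n i) (sig2n j) else 0.
Proof.
rewrite /sig2n mxE; case: eqP => [e|_]; last by rewrite mxE.
move: (tagnat.sig1 i) (tagnat.sig2 i) (tagnat.sig1 j) (tagnat.sig2 j) e.
by move=> x mu y nu e; case: y / e nu => nu; rewrite conform_mx_id entE.
Qed.

Lemma oplusm_Rank a (p q : 'I_a -> nat) (M : forall x, 'M[U]_(p x, q x)) x y
    (mu : 'I_(p x)) (nu : 'I_(q y)) :
  oplusm M (tagnat.Rank x mu) (tagnat.Rank y nu) =
  if x == y then ent (M x) mu nu else 0.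
Proof. by rewrite oplusmE !sig2n_Rank !tagnat.Rank1K. Qed.

Lemma oplusm_mul a (p q r : 'I_a -> nat) (M : forall x, 'M[U]_(p x, q x))
    (N : forall x, 'M[U]_(q x, r x)) :
  oplusm M *m oplusm N = oplusm (fun x => M x *m N x).
Proof.
rewrite /oplusm mul_mxblock; apply: eq_mxblock => x y; rewrite (bigD1 x) //= eqxx conform_mx_id.
rewrite big1 ?addr0 => [|z zx]; last by rewrite eq_sym (negbTE zx) mul0mx.
case: eqP => [xy|_]; last by rewrite mulmx0.
by case: y / xy; rewrite !conform_mx_id.
Qed.

Lemma oplusm_adj a (p q : 'I_a -> nat) (M : forall x, 'M[U]_(p x, q x)) :
  adjm (oplusm M) = oplusm (fun x => adjm (M x)).
Proof.
apply/matrixP => i j; rewrite adjmE !oplusmE eq_sym.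
by case: eqP => [->|_]; rewrite ?uadj0 // ent_adjm.
Qed.

Lemma oplusm_perm a b (s : ordbij a b) (p q : 'I_a -> nat)
    (M : forall x, 'M[U]_(p x, q x)) i j :
  oplusm (fun y => M (ordbij_inv s y)) (sum_bij s p i) (sum_bij s q j) = oplusm M i j.
Proof.
rewrite !oplusmE !sum_bij1 !sig2n_sum_bij (inj_eq (bij_inj (ordbij_funP s))).
by rewrite /= ordbij_inv_funK.
Qed.

Lemma oplusm_bijm a (p q : 'I_a -> nat) (t : forall x, ordbij (p x) (q x)) :
  oplusm (fun x => bijm B (t x)) = bijm B (sum_map t).
Proof.
apply/matrixP => i j; rewrite oplusmE mxE.
have -> : (i == sum_map t j) = (tagnat.sig1 i == tagnat.sig1 j) &&
    (tagnat.sig2 i == t _ (tagnat.sig2 j) :> nat).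
  by rewrite -val_eqE -[X in (val X == _) = _]tagnat.sig2K /= tagnat.eq_Rank.
case: eqP => // e; rewrite /sig2n /=.
move: (tagnat.sig1 i) (tagnat.sig2 i) (tagnat.sig1 j) (tagnat.sig2 j) e.
by move=> x mu y nu e; move: nu; rewrite -e => nu; rewrite entE mxE.
Qed.

Lemma oplusm_RankRank m (n : 'I_m -> nat) (p q : 'I_(\sum_i n i) -> nat)
    (M : forall s, 'M[U]_(p s, q s)) x y x' y'
    (mu : 'I_(p (tagnat.Rank x y))) (nu : 'I_(q (tagnat.Rank x' y'))) :
  oplusm (fun i => oplusm (fun j => M (tagnat.Rank i j)))
    (@tagnat.Rank m (fun i => \sum_(j < n i) p (tagnat.Rank i j))%N x
      (@tagnat.Rank _ (fun j => p (tagnat.Rank x j)) y mu))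
    (@tagnat.Rank m (fun i => \sum_(j < n i) q (tagnat.Rank i j))%N x'
      (@tagnat.Rank _ (fun j => q (tagnat.Rank x' j)) y' nu)) =
  if tagnat.Rank x y == tagnat.Rank x' y' then ent (M (tagnat.Rank x y)) mu nu else 0.
Proof.
have -> : (tagnat.Rank x y == tagnat.Rank x' y') = (x == x') && (y == y' :> nat).
  by rewrite -val_eqE /= tagnat.eq_Rank.
rewrite oplusm_Rank; case: (x =P x') => // e; move: y' nu; rewrite -e => y' nu.
by rewrite andTb entE oplusm_Rank.
Qed.

Lemma oplusm_nested m (n : 'I_m -> nat) (p q : 'I_(\sum_i n i) -> nat)
    (M : forall s, 'M[U]_(p s, q s)) :
  GMx (oplusm M) = GMx (oplusm (fun i => oplusm (fun j => M (tagnat.Rank i j)))).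
Proof.
apply: GMx_ent; [exact: sumn_nested|exact: sumn_nested|] => i j.
rewrite -(sum_nest_val i) -(sum_nest_val j) entE oplusm_RankRank oplusmE.
by rewrite /= !tagnat.sig2K.
Qed.

Lemma oplusm_single (p q : nat) (M : 'M[U]_(p, q)) :
  GMx (oplusm (fun _ : 'I_1 => M)) = GMx M.
Proof.
apply: GMx_ent; rewrite ?big_ord1 // => i j.
by rewrite oplusmE !(ord1 (tagnat.sig1 _)) eqxx /sig2n !sum1_val.
Qed.

End DirectSum.

Section TensorProduct.
Variables (R : realType) (k : scalars) (A : cstar R k) (KA : stabilization A).
Local Notation U := (unitization KA).

Definition otimesm m (f : lin_isom R m) (p q : 'I_m -> nat)
    (M : forall i, 'M[U]_(p i, q i)) : 'M[U]_(\prod_i p i, \prod_i q i) :=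
  \matrix_(mu, nu) tensu f (fun i => M i (mdigit mu i) (mdigit nu i)).

Lemma mxotimesE m (f : lin_isom R m) (p q : 'I_m -> nat)
    (M : forall i, 'M[U]_(p i, q i)) :
  mxotimes f (fun i => GMx (M i)) = GMx (otimesm f M).
Proof. by []. Qed.

Lemma otimesmE m (f : lin_isom R m) (p q : 'I_m -> nat)
    (M : forall i, 'M[U]_(p i, q i)) mu nu :
  otimesm f M mu nu = tensu f (fun i => ent (M i) (mdigit mu i) (mdigit nu i)).
Proof. by rewrite mxE; congr tensu; apply/funext => i; rewrite entE. Qed.

Lemma eq_tensu m (f : lin_isom R m) (u v : 'I_m -> U) : u =1 v -> tensu f u = tensu f v.
Proof. by move=> /funext->. Qed.

Lemma otimesm_mul m (f : lin_isom R m) (p q r : 'I_m -> nat)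
    (M : forall i, 'M[U]_(p i, q i)) (N : forall i, 'M[U]_(q i, r i)) :
  otimesm f M *m otimesm f N = otimesm f (fun i => M i *m N i).
Proof.
apply/matrixP => mu nu; rewrite [LHS]mxE [RHS]mxE.
under [RHS]eq_tensu do rewrite mxE.
rewrite tensu_sum; apply: eq_bigr => la _.
by rewrite !mxE tensuM.
Qed.

Lemma otimesm_adj m (f : lin_isom R m) (p q : 'I_m -> nat)
    (M : forall i, 'M[U]_(p i, q i)) :
  adjm (otimesm f M) = otimesm f (fun i => adjm (M i)).
Proof.
apply/matrixP => mu nu; rewrite adjmE !mxE tensu_adj.
by apply: eq_tensu => i; rewrite adjmE.
Qed.

Lemma otimesm_perm m n (f : lin_isom R n) (s : ordbij m n) (p q : 'I_m -> nat)
    (M : forall i, 'M[U]_(p i, q i)) mu nu :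
  otimesm f (fun j => M (ordbij_inv s j)) (prod_perm s p mu) (prod_perm s q nu) =
  otimesm (li_act f s) M mu nu.
Proof.
rewrite !mxE tensu_act; apply: eq_tensu => j.
by rewrite !prod_permE.
Qed.

Lemma otimesm_bijm m (f : lin_isom R m) (p q : 'I_m -> nat)
    (t : forall i, ordbij (p i) (q i)) :
  otimesm f (fun i => bijm KA (t i)) = bijm KA (prod_bij t).
Proof.
apply/matrixP => mu nu; rewrite !mxE.
under eq_tensu do rewrite mxE.
rewrite tensu_bool; congr _%:R; congr nat_of_bool; apply/forallP/eqP => [e|-> i].
  by apply: mdigit_inj => i; rewrite prod_bijE (eqP (e i)).
by rewrite prod_bijE.
Qed.

Lemma otimesm_nested m (n : 'I_m -> nat) (f : lin_isom R m)
    (g : forall i, lin_isom R (n i)) (p q : 'I_(\sum_i n i) -> nat)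
    (M : forall s, 'M[U]_(p s, q s)) :
  GMx (otimesm (li_comp f g) M) =
  GMx (otimesm f (fun i => otimesm (g i) (fun j => M (tagnat.Rank i j)))).
Proof.
apply: GMx_ent; [exact: prodn_nested|exact: prodn_nested|] => mu nu.
rewrite -(prod_nest_val mu) -(prod_nest_val nu) entE !mxE tensu_comp.
apply: eq_tensu => i; rewrite mxE; apply: eq_tensu => j.
by rewrite !prod_nestE.
Qed.

Lemma otimesm_single (p q : nat) (M : 'M[U]_(p, q)) :
  GMx (otimesm (li_id R) (fun=> M)) = GMx M.
Proof.
apply: GMx_ent; rewrite ?big_ord1 // => mu nu.
rewrite -(mcode1_val mu) -(mcode1_val nu) entE mxE -[RHS]tensu_id.
by apply: eq_tensu => i; rewrite (ord1 i).
Qed.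

(** Entries in off-diagonal blocks vanish on both sides: on the right because a tensor
    product with a zero factor is zero. *)
Lemma distr_entry m (f : lin_isom R m) (a : 'I_m -> nat) (p q : forall i, 'I_(a i) -> nat)
    (M : forall i x, 'M[U]_(p i x, q i x)) mu nu :
  oplusm (fun X : 'I_(\prod_i a i) => otimesm f (fun i => M i (mdigit X i)))
    (distr_bij p mu) (distr_bij q nu) =
  otimesm f (fun i => oplusm (M i)) mu nu.
Proof.
rewrite oplusmE mxE.
case: eqP => [e|ne]; last first.
  have [i ni] : exists i, tagnat.sig1 (mdigit mu i) != tagnat.sig1 (mdigit nu i).
    apply/existsP; rewrite -negb_forall; apply: contra_notN ne => /forallP h.
    by apply: mdigit_inj => i; rewrite !distr1 (eqP (h i)).
  by rewrite (@tensu_zero _ _ _ KA _ f _ i) // oplusmE (negbTE ni).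
have key X (u : 'I_(\prod_i p i (mdigit X i))) (v : 'I_(\prod_i q i (mdigit X i))) :
   ent (otimesm f (fun i => M i (mdigit X i))) u v =
   tensu f (fun i => ent (M i (mdigit X i)) (mdigit u i) (mdigit v i)).
  by rewrite entE otimesmE.
rewrite /sig2n; have := distr2 (b := q) nu; have hp := distr2 (b := p) mu.
move: (tagnat.sig2 (distr_bij q nu)); rewrite -e => v hq; rewrite key.
apply: eq_tensu => i; rewrite hp hq oplusmE.
have -> : tagnat.sig1 (mdigit mu i) == tagnat.sig1 (mdigit nu i).
  by rewrite -!distr1 e.
by rewrite /sig2n distr1.
Qed.

End TensorProduct.

(** * Continuity of matrix operations *)

Section MatrixTopology.
Variables (R : realType) (k : scalars) (B : cstar R k).
Local Notation U := (unitization B).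
Implicit Types X Y : gmx B.

Definition gent X (i j : nat) : U := ent (mat X) i j.

Definition samedim X Y : Prop := nrow X = nrow Y /\ ncol X = ncol Y.

(** The dimensions are locally constant, and then the entries decide. *)
Lemma cvg_gmx (T : Type) (F : set_system T) (FF : Filter F) (X : T -> gmx B) X0 :
  F [set t | samedim (X t) X0] ->
  (forall (i j : nat), (i < nrow X0)%N -> (j < ncol X0)%N ->
    gent (X t) i j @[t --> F] --> gent X0 i j) ->
  X t @[t --> F] --> X0.
Proof.
case: X0 => [[p q] M] dimX entX W /= [P M_P PW].
have nP : F [set t | forall i j, P i j (gent (X t) i j)].
  apply: filter_forall => i; apply: filter_forall => j.
  apply: entX => //=; rewrite -[gent _ _ _]/(ent M i j) entE; exact: M_P.
change (F (X @^-1` W)); suff h t : samedim (X t) (GMx M) ->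
    (forall i j, P i j (gent (X t) i j)) -> W (X t) by apply: (@filterS2 _ F FF _ _ _ h dimX nP).
case: (X t) => [[p' q'] N] [/= e1 e2].
rewrite /nrow /ncol /= in e1 e2; case: _ / e1 M P M_P PW {entX nP dimX} => M P M_P PW.
case: _ / e2 M P M_P PW => M P M_P PW hP; apply: PW => i j.
by have := hP i j; rewrite /gent entE.
Qed.

Lemma near_samedim X0 : \forall X \near X0, samedim X X0.
Proof.
case: X0 => [[p q] M].
change (nbhs (M : 'M[U]_(p, q)) (fun N => samedim (GMx N) (GMx M))).
by apply: filterE => N; split.
Qed.

Lemma gent_cont (i j : nat) : continuous (fun X => gent X i j).
Proof.
move=> [[p q] M] W WM; rewrite /nbhs /= /sigT_nbhs /=.
have [/andP[ip jq]|out] := boolP ((i < p) && (j < q))%N; last first.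
  apply: filterE => N /=; rewrite /gent ent_out //; move: WM.
  by rewrite /gent ent_out // => /nbhs_singleton.
pose i' := Ordinal ip; pose j' := Ordinal jq.
have eM (N : 'M[U]_(p, q)) : gent (existT _ (p, q) N) i j = N i' j'.
  exact: (entE N i' j').
rewrite eM in WM.
have c : (fun N : 'M[U]_(p, q) => N i' j') @ M --> M i' j'.
  move=> V VM; exists (fun a b => if (a == i') && (b == j') then V else setT).
    move=> a b; case: andP => [[/eqP-> /eqP->]|_] //.
    exact: filterT.
  by move=> N /(_ i' j'); rewrite !eqxx.
change (nbhs (M : 'M[U]_(p, q)) (fun N => W (gent (GMx N) i j))).
by apply: (@filterS _ (nbhs (M : 'M[U]_(p, q))) _ _ _ _ (c _ WM)) => N /=; rewrite -eM.
Qed.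

Lemma cvg_samedim (T : Type) (F : set_system T) (FF : Filter F) (X : T -> gmx B) X0 :
  X t @[t --> F] --> X0 -> F [set t | samedim (X t) X0].
Proof. by move=> XX0; exact: (XX0 _ (near_samedim X0)). Qed.

Lemma cvg_gent (T : Type) (F : set_system T) (FF : Filter F) (X : T -> gmx B) X0 i j :
  X t @[t --> F] --> X0 -> gent (X t) i j @[t --> F] --> gent X0 i j.
Proof. by move=> XX0; exact: (cvg_comp _ _ XX0 (@gent_cont i j X0)). Qed.

Lemma near_cvg (T : Type) (F : set_system T) (FF : Filter F) (V : topologicalType)
    (f g : T -> V) (a : V) : F [set t | g t = f t] -> f t @[t --> F] --> a -> g t @[t --> F] --> a.
Proof.
move=> fg fa W /fa h; change (F (g @^-1` W)).
by apply: (@filterS2 _ F FF _ _ _ _ fg h) => t /= ->.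
Qed.

Lemma gent_gadj X i j : gent (gadj X) i j = uadj (gent X j i).
Proof. exact: ent_adjm. Qed.

Lemma gadj_cvg (T : Type) (F : set_system T) (FF : Filter F) (X : T -> gmx B) X0 :
  X t @[t --> F] --> X0 -> gadj (X t) @[t --> F] --> gadj X0.
Proof.
move=> XX0; apply: cvg_gmx.
  by apply: filterS (cvg_samedim FF XX0) => t [].
move=> i j _ _; rewrite gent_gadj; under eq_cvg do rewrite gent_gadj.
by apply: uadj_cvg; exact: cvg_gent.
Qed.

Lemma gent_gmul X Y i j : gent (gmul X Y) i j =
  if ncol X == nrow Y then \sum_(l < ncol X) gent X i l * gent Y l j else 0.
Proof.
case: X Y => [[p q] M] [[q' r] N]; rewrite /gent /gmul /mat /nrow /ncol /=.
have [e|ne] := eqVneq q q'; last first.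
  rewrite nonconform_mx; last by rewrite eq_sym ne.
  rewrite mulmx0 /ent; case: insubP => // i' _ _; case: insubP => // j' _ _.
  by rewrite mxE.
case: q' / e N => N; rewrite conform_mx_id /ent.
case: insubP => [i' _ ei|_]; last by rewrite big1 // => l _; rewrite mul0r.
case: insubP => [j' _ ej|_].
  by rewrite mxE; apply: eq_bigr => l _; rewrite valK.
by rewrite big1 // => l _; rewrite valK mulr0.
Qed.

Lemma cvg_gmul (T : Type) (F : set_system T) (FF : Filter F) (X Y : T -> gmx B) X0 Y0 :
  X t @[t --> F] --> X0 -> Y t @[t --> F] --> Y0 ->
  gmul (X t) (Y t) @[t --> F] --> gmul X0 Y0.
Proof.
move=> XX0 YY0; have dX := cvg_samedim FF XX0; have dY := cvg_samedim FF YY0.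
apply: cvg_gmx.
  by apply: (@filterS2 _ F FF _ _ _ _ dX dY) => t [e1 _] [_ e2]; split.
move=> i j _ _; rewrite gent_gmul.
apply: (@near_cvg _ _ _ _ (fun t => if ncol X0 == nrow Y0 then
    \sum_(l < ncol X0) gent (X t) i l * gent (Y t) l j else 0)).
  by apply: (@filterS2 _ F FF _ _ _ _ dX dY) => t [_ e1] [e2 _] /=; rewrite gent_gmul e1 e2.
case: eqP => _; last exact: cvg_cst.
apply: (@cvg_bigsum R k U) => l.
by apply: umul_cvg; exact: cvg_gent.
Qed.

End MatrixTopology.

Section OperationContinuity.
Variables (R : realType) (k : scalars).

Lemma cast_sum a (p p' : 'I_a -> nat) (i : 'I_(\sum_x p x)) : p =1 p' ->
  exists2 i' : 'I_(\sum_x p' x), i' = i :> nat &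
    tagnat.sig1 i' = tagnat.sig1 i /\ sig2n i' = sig2n i.
Proof. by move=> /funext e; case: p' / e; exists i. Qed.

Lemma cast_prod m (p p' : 'I_m -> nat) (i : 'I_(\prod_x p x)) : p =1 p' ->
  exists2 i' : 'I_(\prod_x p' x), i' = i :> nat &
    forall l, mdigit i' l = mdigit i l :> nat.
Proof. by move=> /funext e; case: p' / e; exists i. Qed.

Lemma gent_mxoplus (B : cstar R k) a (p q : 'I_a -> nat) (X : 'I_a -> gmx B)
    (i : 'I_(\sum_x p x)) (j : 'I_(\sum_x q x)) :
  (forall x, nrow (X x) = p x /\ ncol (X x) = q x) ->
  gent (mxoplus X) i j = if tagnat.sig1 i == tagnat.sig1 j
    then gent (X (tagnat.sig1 i)) (sig2n i) (sig2n j) else 0.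
Proof.
move=> dimX.
have [i' ei [<- <-]] := cast_sum i (fun x => esym (dimX x).1).
have [j' ej [<- <-]] := cast_sum j (fun x => esym (dimX x).2).
rewrite -ei -ej; transitivity (oplusm (fun x => mat (X x)) i' j'); last exact: oplusmE.
exact: entE.
Qed.

Lemma gent_mxotimes (A : cstar R k) (KA : stabilization A) m (f : lin_isom R m)
    (p q : 'I_m -> nat) (X : 'I_m -> gmx KA) (i : 'I_(\prod_x p x)) (j : 'I_(\prod_x q x)) :
  (forall x, nrow (X x) = p x /\ ncol (X x) = q x) ->
  gent (mxotimes f X) i j = tensu f (fun x => gent (X x) (mdigit i x) (mdigit j x)).
Proof.
move=> dimX.
have [i' ei di] := cast_prod i (fun x => esym (dimX x).1).
have [j' ej dj] := cast_prod j (fun x => esym (dimX x).2).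
rewrite -ei -ej; transitivity (otimesm f (fun x => mat (X x)) i' j'); first exact: entE.
by rewrite otimesmE; apply: eq_tensu => x; rewrite di dj.
Qed.

Lemma near_samedims (B : cstar R k) (T : Type) (F : set_system T) (FF : Filter F) a
    (X : T -> 'I_a -> gmx B) X0 : (forall x, X t x @[t --> F] --> X0 x) ->
  F [set t | forall x, samedim (X t x) (X0 x)].
Proof. by move=> XX0; apply: filter_forall => x; exact: cvg_samedim. Qed.

Lemma mxoplus_cvg (B : cstar R k) (T : Type) (F : set_system T) (FF : Filter F) a
    (X : T -> 'I_a -> gmx B) X0 : (forall x, X t x @[t --> F] --> X0 x) ->
  mxoplus (X t) @[t --> F] --> mxoplus X0.
Proof.
move=> XX0; have dX := near_samedims FF XX0; apply: cvg_gmx.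
  apply: filterS dX => t dX; split; apply: eq_bigr => x _; [exact: (dX x).1|exact: (dX x).2].
move=> i j ip jq; have -> : i = Ordinal ip by []; have -> : j = Ordinal jq by [].
rewrite (@gent_mxoplus B a (fun x => nrow (X0 x)) (fun x => ncol (X0 x))) //.
apply: (@near_cvg _ _ _ _ (fun t => if tagnat.sig1 (Ordinal ip) == tagnat.sig1 (Ordinal jq)
    then gent (X t (tagnat.sig1 (Ordinal ip))) (sig2n (Ordinal ip)) (sig2n (Ordinal jq)) else 0)).
  by apply: filterS dX => t dX /=; rewrite -gent_mxoplus.
case: ifP => _; last exact: cvg_cst.
exact: cvg_gent.
Qed.

Lemma mxotimes_cvg (A : cstar R k) (KA : stabilization A) (T : Type) (F : set_system T)
    (FF : Filter F) m (f : T -> lin_isom R m) f0 (X : T -> 'I_m -> gmx KA) X0 :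
  f t @[t --> F] --> f0 -> (forall x, X t x @[t --> F] --> X0 x) ->
  mxotimes (f t) (X t) @[t --> F] --> mxotimes f0 X0.
Proof.
move=> ff XX0; have dX := near_samedims FF XX0; apply: cvg_gmx.
  apply: filterS dX => t dX; split; apply: eq_bigr => x _; [exact: (dX x).1|exact: (dX x).2].
move=> i j ip jq; have -> : i = Ordinal ip by []; have -> : j = Ordinal jq by [].
rewrite (@gent_mxotimes A KA m f0 (fun x => nrow (X0 x)) (fun x => ncol (X0 x))) //.
apply: (@near_cvg _ _ _ _ (fun t => tensu (f t) (fun x =>
    gent (X t x) (mdigit (Ordinal ip) x) (mdigit (Ordinal jq) x)))).
  by apply: filterS dX => t dX /=; rewrite -gent_mxotimes.
by apply: tensu_cvg => // x; exact: cvg_gent.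
Qed.

End OperationContinuity.

(** * The Murray-von Neumann category *)

Section GradedMatrices.
Variables (R : realType) (k : scalars) (B : cstar R k).
Local Notation U := (unitization B).
Implicit Types X Y Z P : gmx B.

Lemma gmxP X : exists p q (M : 'M[U]_(p, q)), X = GMx M.
Proof. by case: X => [[p q] M]; exists p, q, M. Qed.

Lemma gmulA X Y Z : ncol X = nrow Y -> ncol Y = nrow Z ->
  gmul X (gmul Y Z) = gmul (gmul X Y) Z.
Proof.
have [p [q [M ->]]] := gmxP X; have [q' [r [N ->]]] := gmxP Y.
have [r' [s [L ->]]] := gmxP Z; move=> e0 e0'; have e : q = q' := e0; have e' : r = r' := e0'; clear e0 e0'.
case: q' / e N => N; case: r' / e' L => L.
by rewrite !gmulE mulmxA.
Qed.

Lemma gadjK X : gadj (gadj X) = X.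
Proof. by have [p [q [M ->]]] := gmxP X; rewrite !gadjE adjmK. Qed.

Lemma gadjM X Y : ncol X = nrow Y -> gadj (gmul X Y) = gmul (gadj Y) (gadj X).
Proof.
have [p [q [M ->]]] := gmxP X; have [q' [r [N ->]]] := gmxP Y.
move=> e0; have e : q = q' := e0; clear e0; case: q' / e N => N.
by rewrite gmulE gadjE adjmM -gmulE.
Qed.

Lemma proj_dim P : is_proj P -> ncol P = nrow P.
Proof. by case=> /(congr1 (@nrow R k B)). Qed.

Lemma pisom_proj P : is_proj P -> is_pisom P.
Proof. by move=> [Pa PP]; split; rewrite Pa PP; split. Qed.

Lemma bijmx_adj p q (s : ordbij p q) X : nrow X = p ->
  gmul (gadj (bijmx B s)) (gmul (bijmx B s) X) = X.
Proof.
have [p' [r [M ->]]] := gmxP X; move=> e0; have e : p' = p := e0; clear e0; case: p / e s => s.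
by rewrite bijmxE gadjE !gmulE mulmxA adjm_bijm mul1mx.
Qed.

Lemma bijmx_ext p q p' q' (s : ordbij p q) (s' : ordbij p' q') : p = p' -> q = q' ->
  (forall (l : 'I_p) (l' : 'I_p'), l = l' :> nat -> s l = s' l' :> nat) ->
  bijmx B s = bijmx B s'.
Proof.
move=> e1 e2; case: p' / e1 s'; case: q' / e2 => s' e.
congr GMx; apply/matrixP => i j; rewrite !mxE; congr (_ == _)%:R.
by apply/val_inj; exact: e.
Qed.

Lemma bijmx_id p q (s : ordbij p q) X : p = q -> nrow X = p ->
  (forall l, s l = l :> nat) -> gmul (bijmx B s) X = X.
Proof.
have [p' [r [M ->]]] := gmxP X; move=> e e0; have e' : p' = p := e0; clear e0.
case: p / e' e s => e; case: q / e => s sE; rewrite bijmxE gmulE; congr GMx.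
suff -> : bijm B s = 1%:M by rewrite mul1mx.
apply/matrixP => i j; rewrite !mxE; congr (_ %:R); congr nat_of_bool.
by rewrite -val_eqE /= sE.
Qed.

Lemma bijmx_comp p q r (t : ordbij q r) (s : ordbij p q) :
  gmul (bijmx B t) (bijmx B s) = bijmx B (ordbij_comp t s).
Proof. by rewrite !bijmxE gmulE bijm_comp. Qed.

Lemma bijmx_inv p q (s : ordbij p q) :
  gmul (bijmx B s) (gadj (bijmx B s)) = GMx (1%:M : 'M_q).
Proof. by rewrite bijmxE gadjE gmulE bijm_adjm. Qed.

Lemma gmulr1 X p : ncol X = p -> gmul X (GMx (1%:M : 'M_p)) = X.
Proof.
have [p' [r [M ->]]] := gmxP X; move=> e0; have e : r = p := e0; clear e0; case: p / e.
by rewrite gmulE mulmx1.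
Qed.

(** The permutation matrix b is unitary, so that b X = Y b means b X b^* = Y. *)
Lemma bijmx_tgt p q (s : ordbij p q) X Y :
  is_proj X -> nrow X = p -> ncol Y = q ->
  gmul (bijmx B s) X = gmul Y (bijmx B s) ->
  gmul (gmul (bijmx B s) X) (gadj (gmul (bijmx B s) X)) = Y.
Proof.
move=> hX dX dY e; have dX' : ncol X = p by rewrite proj_dim.
case: hX => Xa XX; set b := bijmx B s in e *.
have db : ncol b = nrow X by rewrite dX.
have dYb : ncol Y = nrow b by [].
have dXX : ncol X = nrow X by rewrite dX'.
have dbX : ncol (gmul b X) = nrow X by exact: dXX.
have dXb : ncol X = nrow (gadj b) by rewrite dX'.
have dbb : ncol b = nrow (gadj b) by [].
rewrite (gadjM db) Xa (gmulA dbX dXb) -(gmulA db dXX) XX e -(gmulA dYb dbb).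
by rewrite bijmx_inv gmulr1.
Qed.

Hypothesis defB : definite B.

Lemma pisomP X : is_pisom X <-> gmul (gmul X (gadj X)) X = X.
Proof.
have [p [q [M ->]]] := gmxP X; rewrite gadjE !gmulE (is_pisomE defB).
by split=> [->//|]; exact: GMx_inj.
Qed.

Lemma pisom_tgt X : is_pisom X -> gmul (gmul X (gadj X)) X = X.
Proof. by move=> /pisomP. Qed.

Lemma pisom_src X : is_pisom X -> gmul X (gmul (gadj X) X) = X.
Proof. by move=> /pisomP; rewrite gmulA. Qed.

Lemma pisom_adj X : is_pisom X -> is_pisom (gadj X).
Proof. by move=> [h1 h2]; split; rewrite gadjK. Qed.

Lemma pisom_bijmx p q (s : ordbij p q) X : nrow X = p -> is_pisom X ->
  is_pisom (gmul (bijmx B s) X).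
Proof.
move=> e iX; apply/pisomP; rewrite gadjM // -!gmulA // bijmx_adj //.
by rewrite pisom_src.
Qed.

Lemma pisom_mul X Y : is_pisom X -> is_pisom Y ->
  gmul (gadj X) X = gmul Y (gadj Y) -> is_pisom (gmul X Y).
Proof.
move=> iX iY e; have d : ncol X = nrow Y by have := congr1 (@nrow R k B) e.
apply/pisomP; rewrite gadjM // -!gmulA // (gmulA (X := gadj X)) // e.
by rewrite pisom_tgt // pisom_src.
Qed.

End GradedMatrices.

Section Topcat.
Variables (R : realType) (k : scalars) (B : cstar R k).
Hypothesis defB : definite B.
Implicit Types (P Q : pr_ob B) (V W X : pr_mor B).

Lemma obmx_inj : injective (@obmx R k B).
Proof. exact: val_inj. Qed.

Lemma mormx_inj : injective (@mormx R k B).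
Proof. exact: val_inj. Qed.

Lemma obmxP P : is_proj (obmx P).
Proof. exact: set_valP. Qed.

Lemma mormxP X : is_pisom (mormx X).
Proof. exact: set_valP. Qed.

Lemma obmx_dim P : ncol (obmx P) = nrow (obmx P).
Proof. exact/proj_dim/obmxP. Qed.

Definition mkob (X : gmx B) (h : is_proj X) : pr_ob B := SigSub (mem_set h).
Definition mkmor (X : gmx B) (h : is_pisom X) : pr_mor B := SigSub (mem_set h).

Lemma srcE X : obmx (pr_src X) = gmul (gadj (mormx X)) (mormx X).
Proof. by []. Qed.

Lemma tgtE X : obmx (pr_tgt X) = gmul (mormx X) (gadj (mormx X)).
Proof. by []. Qed.

Lemma idE P : mormx (pr_id P) = obmx P.
Proof. by []. Qed.

Lemma cmpE V X : pr_src V = pr_tgt X -> mormx (pr_cmp V X) = gmul (mormx V) (mormx X).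
Proof.
move=> /(congr1 (@obmx _ _ _)); rewrite srcE tgtE => e.
apply: insubdK; apply: mem_set.
by apply: pisom_mul => //; exact: mormxP.
Qed.

Lemma src_tgt_dim V X : pr_src V = pr_tgt X -> ncol (mormx V) = nrow (mormx X).
Proof. by move=> /(congr1 (fun P => nrow (obmx P))). Qed.

Lemma proj_id P : gmul (obmx P) (obmx P) = obmx P.
Proof. by case: (obmxP P). Qed.

Lemma proj_adj P : gadj (obmx P) = obmx P.
Proof. by case: (obmxP P). Qed.

Lemma src_idE P : pr_src (pr_id P) = P.
Proof. by apply: obmx_inj; rewrite srcE idE proj_adj proj_id. Qed.

Lemma tgt_idE P : pr_tgt (pr_id P) = P.
Proof. by apply: obmx_inj; rewrite tgtE idE proj_adj proj_id. Qed.

Lemma src_cmpE V X : pr_src V = pr_tgt X -> pr_src (pr_cmp V X) = pr_src X.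
Proof.
move=> e; have d := src_tgt_dim e; apply: obmx_inj; rewrite !srcE cmpE // gadjM //.
have e' : gmul (gadj (mormx V)) (mormx V) = gmul (mormx X) (gadj (mormx X)).
  exact: (congr1 (@obmx _ _ _) e).
by rewrite -gmulA // (gmulA (X := gadj (mormx V))) // e' pisom_tgt //; exact: mormxP.
Qed.

Lemma tgt_cmpE V X : pr_src V = pr_tgt X -> pr_tgt (pr_cmp V X) = pr_tgt V.
Proof.
move=> e; have d := src_tgt_dim e; apply: obmx_inj; rewrite !tgtE cmpE // gadjM //.
have e' : gmul (gadj (mormx V)) (mormx V) = gmul (mormx X) (gadj (mormx X)).
  exact: (congr1 (@obmx _ _ _) e).
rewrite -gmulA // (gmulA (X := mormx X)) // -e'.
by rewrite gmulA // gmulA // pisom_tgt //; exact: mormxP.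
Qed.

Lemma obmx_cont : continuous (@obmx R k B).
Proof. exact: initial_continuous. Qed.

Lemma mormx_cont : continuous (@mormx R k B).
Proof. exact: initial_continuous. Qed.

Lemma cont_ob (T : topologicalType) (f : T -> pr_ob B) :
  continuous (fun t => obmx (f t)) -> continuous f.
Proof. exact: continuous_comp_initial. Qed.

Lemma cont_mor (T : topologicalType) (f : T -> pr_mor B) :
  continuous (fun t => mormx (f t)) -> continuous f.
Proof. exact: continuous_comp_initial. Qed.

Lemma pr_topcat : is_topcat (pr B).
Proof.
split.
- apply: cont_ob; suff : continuous (fun X => gmul (gadj (mormx X)) (mormx X)) by [].
  move=> X; apply: (@cvg_gmul _ _ B _ (nbhs X) (nbhs_filter X)); last exact: mormx_cont.
  by apply: (@gadj_cvg _ _ B _ (nbhs X) (nbhs_filter X)); exact: mormx_cont.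
- apply: cont_ob; suff : continuous (fun X => gmul (mormx X) (gadj (mormx X))) by [].
  move=> X; apply: (@cvg_gmul _ _ B _ (nbhs X) (nbhs_filter X)); first exact: mormx_cont.
  by apply: (@gadj_cvg _ _ B _ (nbhs X) (nbhs_filter X)); exact: mormx_cont.
- by apply: cont_mor; exact: obmx_cont.
- apply: cont_mor.
  pose g (z : pr_mor B * pr_mor B) := gmul (mormx z.1) (mormx z.2).
  have cg : continuous g.
    move=> z; apply: (@cvg_gmul _ _ B _ (nbhs z) (nbhs_filter z)).
      by apply: (cvg_comp _ _ (cvg_fst (G := nbhs z.2))); exact: mormx_cont.
    by apply: (cvg_comp _ _ (cvg_snd (F := nbhs z.1))); exact: mormx_cont.
  apply: (subspace_eq_continuous (f := g)); last exact: continuous_subspaceT.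
  by move=> z /set_mem /= e; rewrite cmpE.
- exact: src_idE.
- exact: tgt_idE.
- exact: src_cmpE.
- exact: tgt_cmpE.
- move=> X; apply: mormx_inj; rewrite cmpE ?src_idE // idE tgtE pisom_tgt //.
  exact: mormxP.
- move=> X; apply: mormx_inj; rewrite cmpE ?tgt_idE // idE srcE pisom_src //.
  exact: mormxP.
- move=> W V X e e'; have d := src_tgt_dim e; have d' := src_tgt_dim e'.
  apply: mormx_inj; rewrite !cmpE ?gmulA //.
  + by rewrite src_cmpE.
  + by rewrite tgt_cmpE.
Qed.

(** The inverse is the adjoint. *)
Lemma pr_inv (X : cat_mor (pr B)) : exists V : cat_mor (pr B),
  [/\ cat_src V = cat_tgt X, cat_tgt V = cat_src X,
      cat_cmp V X = cat_id (cat_src X) & cat_cmp X V = cat_id (cat_tgt X)].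
Proof.
pose V := mkmor (pisom_adj (mormxP X)); exists V.
have VE : mormx V = gadj (mormx X) by [].
have sV : pr_src V = pr_tgt X by apply: obmx_inj; rewrite srcE tgtE VE gadjK.
have tV : pr_tgt V = pr_src X by apply: obmx_inj; rewrite srcE tgtE VE gadjK.
split=> //; apply: mormx_inj; rewrite [LHS]cmpE ?VE //.
Qed.

End Topcat.

(** * Operad actions from operations on matrices *)

(** Direct sums and tensor products enter the structure in the same way, namely as
    operations on all matrices that are compatible with products and adjoints and
    equivariant up to permutation matrices.  By [pisomP] such an operation restricts
    to projections and partial isometries, and the laws of an operad action follow
    from those of the operation and of the permutations. *)
Section GenericAction.
Variables (R : realType) (k : scalars) (B : cstar R k).
Hypothesis defB : definite B.
Variables (G : operad_data) (dim : forall m, ('I_m -> nat) -> nat).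
Variable op : forall m, G m -> ('I_m -> gmx B) -> gmx B.
Variable perm : forall m n (s : ordbij m n) (p : 'I_m -> nat),
  ordbij (dim p) (dim (fun j => p (ordbij_inv s j))).

Hypothesis op_nrow : forall m (f : G m) X, nrow (op f X) = dim (fun i => nrow (X i)).
Hypothesis op_ncol : forall m (f : G m) X, ncol (op f X) = dim (fun i => ncol (X i)).
Hypothesis op_mul : forall m (f : G m) X Y, (forall i, ncol (X i) = nrow (Y i)) ->
  gmul (op f X) (op f Y) = op f (fun i => gmul (X i) (Y i)).
Hypothesis op_adj : forall m (f : G m) X, gadj (op f X) = op f (fun i => gadj (X i)).
Hypothesis op_perm : forall m n (f : G n) (s : ordbij m n) X,
  gmul (bijmx B (perm s (fun i => nrow (X i)))) (op (op_act f s) X) =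
  gmul (op f (fun j => X (ordbij_inv s j))) (bijmx B (perm s (fun i => ncol (X i)))).
Hypothesis perm_comp : forall m n r (t : ordbij n r) (s : ordbij m n) p l,
  perm t (fun j => p (ordbij_inv s j)) (perm s p l) = perm (ordbij_comp t s) p l :> nat.
Hypothesis perm_id : forall m (p : 'I_m -> nat) l, perm (ordbij_id m) p l = l :> nat.
Hypothesis act_comp : forall m n r (f : G r) (t : ordbij n r) (s : ordbij m n),
  op_act (op_act f t) s = op_act f (ordbij_comp t s).
Hypothesis act_id : forall m (f : G m), op_act f (ordbij_id m) = f.
Hypothesis op_nested : forall m (n : 'I_m -> nat) (f : G m) (g : forall i, G (n i)) X,
  op (op_cmp f g) X = op f (fun i => op (g i) (fun j => X (tagnat.Rank i j))).
Hypothesis op_single : forall X, op (op_id G) (fun=> X) = X.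
Hypothesis op_cvg : forall (T : topologicalType) (t0 : T) m (f : T -> G m)
    (X : T -> 'I_m -> gmx B),
  f t @[t --> t0] --> f t0 -> (forall i, X t i @[t --> t0] --> X t0 i) ->
  op (f t) (X t) @[t --> t0] --> op (f t0) (X t0).

Lemma op_proj m (f : G m) X : (forall i, is_proj (X i)) -> is_proj (op f X).
Proof.
move=> hX; split.
  by rewrite op_adj; congr op; apply/funext => i; case: (hX i).
rewrite op_mul; last by move=> i; exact: proj_dim.
by congr op; apply/funext => i; case: (hX i).
Qed.

Lemma op_pisom m (f : G m) X : (forall i, is_pisom (X i)) -> is_pisom (op f X).
Proof.
move=> hX; apply/(pisomP defB); rewrite op_adj !op_mul //.
by congr op; apply/funext => i; exact: pisom_tgt.
Qed.

Definition act_ob m (f : G m) (P : 'I_m -> pr_ob B) : pr_ob B :=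
  mkob (op_proj f (fun i => obmxP (P i))).

Definition act_mor m (f : G m) (X : 'I_m -> pr_mor B) : pr_mor B :=
  mkmor (op_pisom f (fun i => mormxP (X i))).

Definition act_tau_mx m n (f : G n) (s : ordbij m n) (P : 'I_m -> pr_ob B) : gmx B :=
  gmul (bijmx B (perm s (fun i => nrow (obmx (P i)))))
       (op (op_act f s) (fun i => obmx (P i))).

Lemma act_tau_pisom m n (f : G n) (s : ordbij m n) P : is_pisom (act_tau_mx f s P).
Proof.
apply: pisom_bijmx => //; apply: pisom_proj.
by apply: op_proj => i; exact: obmxP.
Qed.

Definition act_tau m n (f : G n) (s : ordbij m n) (P : 'I_m -> pr_ob B) : pr_mor B :=
  mkmor (act_tau_pisom f s P).

Lemma act_obE m (f : G m) P : obmx (act_ob f P) = op f (fun i => obmx (P i)).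
Proof. by []. Qed.

Lemma act_morE m (f : G m) X : mormx (act_mor f X) = op f (fun i => mormx (X i)).
Proof. by []. Qed.

Lemma act_tauE m n (f : G n) (s : ordbij m n) P : mormx (act_tau f s P) =
  gmul (bijmx B (perm s (fun i => nrow (obmx (P i)))))
       (op (op_act f s) (fun i => obmx (P i))).
Proof. by []. Qed.

Lemma act_src m (f : G m) X : pr_src (act_mor f X) = act_ob f (fun i => pr_src (X i)).
Proof.
by apply: obmx_inj; rewrite srcE act_morE op_adj op_mul // => i; rewrite srcE.
Qed.

Lemma act_tgt m (f : G m) X : pr_tgt (act_mor f X) = act_ob f (fun i => pr_tgt (X i)).
Proof. by apply: obmx_inj; rewrite tgtE act_morE op_adj op_mul. Qed.

Lemma tau_src m n (f : G n) (s : ordbij m n) P :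
  pr_src (act_tau f s P) = act_ob (op_act f s) P.
Proof.
have hP := obmxP (act_ob (op_act f s) P); rewrite act_obE in hP.
apply: obmx_inj; rewrite srcE act_tauE act_obE gadjM; last by rewrite op_nrow.
rewrite -gmulA //; last exact: op_nrow.
by rewrite bijmx_adj ?op_nrow //; case: hP => ->.
Qed.

Lemma bijmx_perm m n (s : ordbij m n) p p' : p =1 p' ->
  bijmx B (perm s p) = bijmx B (perm s p').
Proof. by move=> /funext->. Qed.

Lemma op_perm_ob m n (f : G n) (s : ordbij m n) (P : 'I_m -> pr_ob B) :
  gmul (bijmx B (perm s (fun i => nrow (obmx (P i)))))
    (op (op_act f s) (fun i => obmx (P i))) =
  gmul (op f (fun j => obmx (P (ordbij_inv s j))))
    (bijmx B (perm s (fun i => nrow (obmx (P i))))).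
Proof. by rewrite op_perm; congr gmul; apply: bijmx_perm => i; exact: obmx_dim. Qed.

Lemma tau_tgt m n (f : G n) (s : ordbij m n) P :
  pr_tgt (act_tau f s P) = act_ob f (fun j => P (ordbij_inv s j)).
Proof.
apply: obmx_inj; rewrite tgtE act_tauE act_obE.
have hP := obmxP (act_ob (op_act f s) P); rewrite act_obE in hP.
apply: (bijmx_tgt hP); [by rewrite op_nrow| |exact: op_perm_ob].
by rewrite op_ncol; congr dim; apply/funext => j; exact: obmx_dim.
Qed.

Lemma cont_ops (I : choiceType) (T V W : topologicalType) (h : V -> W) (i : I) :
  continuous h -> continuous (fun z : T * {ptws I -> V} => h (z.2 i)).
Proof.
move=> ch z.
have c1 : z'.2 @[z' --> z] --> (z.2 : {ptws I -> V}) by exact: (cvg_snd (F := nbhs z.1)).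
have c2 : continuous (fun y : {ptws I -> V} => y i) by exact: proj_continuous.
exact: (cvg_comp _ _ (cvg_comp _ _ c1 (c2 z.2)) (ch (z.2 i))).
Qed.

Lemma act_ob_cont m : continuous (fun z : G m * {ptws 'I_m -> pr_ob B} => act_ob z.1 z.2).
Proof.
apply: cont_ob => z; apply: (op_cvg (f := fun z : G m * {ptws 'I_m -> pr_ob B} => z.1)
  (X := fun z i => obmx (z.2 i))) => [|i].
  exact: (cvg_fst (G := nbhs z.2)).
exact: (cont_ops (@obmx_cont R k B)).
Qed.

Lemma act_mor_cont m : continuous (fun z : G m * {ptws 'I_m -> pr_mor B} => act_mor z.1 z.2).
Proof.
apply: cont_mor => z; apply: (op_cvg (f := fun z : G m * {ptws 'I_m -> pr_mor B} => z.1)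
  (X := fun z i => mormx (z.2 i))) => [|i].
  exact: (cvg_fst (G := nbhs z.2)).
exact: (cont_ops (@mormx_cont R k B)).
Qed.

Hypothesis act_cont : forall m n (s : ordbij m n), continuous (fun f : G n => op_act f s).

Lemma near_dims (T : topologicalType) I (z : T * {ptws 'I_I -> pr_ob B}) :
  \forall z' \near z, forall i, nrow (obmx (z'.2 i)) = nrow (obmx (z.2 i)).
Proof.
apply: (@filter_forall _ _ _ _ (nbhs_filter z)) => i.
have c : obmx (z'.2 i) @[z' --> z] --> obmx (z.2 i).
  exact: (cont_ops (@obmx_cont R k B)).
by apply: filterS (cvg_samedim (nbhs_filter z) c) => z' [].
Qed.

(** The permutation matrix depends on the dimensions only, which are locally constant. *)
Lemma act_tau_cont m n (s : ordbij m n) :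
  continuous (fun z : G n * {ptws 'I_m -> pr_ob B} => act_tau z.1 s z.2).
Proof.
apply: cont_mor => z; apply: (@cvg_gmul _ _ B _ (nbhs z) (nbhs_filter z)).
  apply: (@near_cvg _ _ (nbhs_filter z) _ (fun=> bijmx B (perm s (fun i => nrow (obmx (z.2 i))))));
    last exact: cvg_cst.
  by apply: filterS (near_dims z) => z' e; exact: bijmx_perm.
apply: (op_cvg (f := fun z : G n * {ptws 'I_m -> pr_ob B} => op_act z.1 s)
  (X := fun z i => obmx (z.2 i))) => [|i].
  have c1 : z'.1 @[z' --> z] --> z.1 by exact: (cvg_fst (G := nbhs z.2)).
  exact: (cvg_comp (fun z : G n * {ptws 'I_m -> pr_ob B} => z.1) (fun f => op_act f s) c1 (@act_cont m n s z.1)).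
exact: (cont_ops (@obmx_cont R k B)).
Qed.

Lemma tau_nat m n (f : G n) (s : ordbij m n) X :
  pr_cmp (act_tau f s (fun i => pr_tgt (X i))) (act_mor (op_act f s) X) =
  pr_cmp (act_mor f (fun j => X (ordbij_inv s j))) (act_tau f s (fun i => pr_src (X i))).
Proof.
apply: mormx_inj; rewrite !(cmpE defB); [|by rewrite act_src tau_tgt|by rewrite tau_src act_tgt].
rewrite !act_tauE !act_morE -gmulA; [|by rewrite op_nrow|by rewrite op_ncol op_nrow].
rewrite op_mul //.
have -> : (fun i => gmul (obmx (pr_tgt (X i))) (mormx (X i))) = (fun i => mormx (X i)).
  by apply/funext => i; rewrite tgtE pisom_tgt //; exact: mormxP.
rewrite op_perm_ob.
rewrite gmulA; first last.
- by rewrite op_ncol.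
- by rewrite op_ncol op_nrow.
rewrite op_mul //.
have -> : (fun j => gmul (mormx (X (ordbij_inv s j))) (obmx (pr_src (X (ordbij_inv s j))))) =
    (fun j => mormx (X (ordbij_inv s j))).
  by apply/funext => j; rewrite srcE pisom_src //; exact: mormxP.
exact: (op_perm f s (fun i => mormx (X i))).
Qed.

Lemma tau_comp m n r (f : G r) (t : ordbij n r) (s : ordbij m n) P :
  pr_cmp (act_tau f t (fun j => P (ordbij_inv s j))) (act_tau (op_act f t) s P) =
  act_tau f (ordbij_comp t s) P.
Proof.
apply: mormx_inj; rewrite (cmpE defB); last by rewrite tau_src tau_tgt.
rewrite !act_tauE act_comp.
set Y := op _ (fun i => obmx (P i)); set X := op (op_act f t) _.
set bt := bijmx B (perm t _); set bs := bijmx B (perm s _).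
have hY : is_proj Y by apply: op_proj => i; exact: obmxP.
have nY : nrow Y = ncol bs by rewrite op_nrow.
have nX : nrow X = ncol bt by rewrite op_nrow.
have e : gmul X bs = gmul bs Y.
  by rewrite /X /bs -op_perm_ob act_comp.
have cX : ncol X = nrow bs.
  by rewrite op_ncol; congr dim; apply/funext => j; exact: obmx_dim.
have -> : bijmx B (perm (ordbij_comp t s) (fun i => nrow (obmx (P i)))) = gmul bt bs.
  rewrite bijmx_comp; apply: bijmx_ext => // [|l l' ll'].
    by congr dim; apply/funext => z; rewrite ordbij_inv_comp.
  by rewrite -(val_inj ll') -perm_comp.
have tX : ncol bt = nrow X by rewrite nX.
have sY : ncol bs = nrow Y by rewrite nY.
have XsY : ncol X = nrow (gmul bs Y) by rewrite cX.
rewrite -(gmulA tX XsY) (gmulA cX sY) e -(gmulA sY (proj_dim hY)).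
by case: hY => _ ->; rewrite gmulA.
Qed.

Lemma tau_idE m (f : G m) P : act_tau f (ordbij_id m) P = pr_id (act_ob f P).
Proof.
apply: mormx_inj; rewrite act_tauE idE act_id; apply: bijmx_id.
- by congr dim; apply/funext => i; rewrite ordbij_inv_id.
- by rewrite op_nrow.
- exact: perm_id.
Qed.

(** Transparent, so that the components of the action compute to the given formulas. *)
Definition generic_action : gcat G (pr B).
Proof.
exists act_ob act_mor act_tau.
- exact: pr_topcat.
- exact: act_ob_cont.
- exact: act_mor_cont.
- exact: act_src.
- exact: act_tgt.
- by move=> m f P; apply: mormx_inj.
- move=> m f V X e; apply: mormx_inj; rewrite [RHS](cmpE defB); last first.
    by rewrite act_src act_tgt; congr act_ob; apply/funext.
  rewrite !act_morE op_mul => [|i]; last exact/src_tgt_dim/e.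
  by congr op; apply/funext => i; exact: (cmpE defB (e i)).
- exact: act_tau_cont.
- exact: tau_src.
- exact: tau_tgt.
- exact: tau_nat.
- by move=> m n f s P; exact: pr_inv.
- by move=> m n f g P; apply: obmx_inj; rewrite act_obE op_nested.
- by move=> m n f g X; apply: mormx_inj; rewrite act_morE op_nested.
- by move=> P; apply: obmx_inj; rewrite act_obE op_single.
- by move=> X; apply: mormx_inj; rewrite act_morE op_single.
- exact: tau_comp.
- exact: tau_idE.
Defined.

End GenericAction.

(** * Direct sum and tensor product as operad actions *)

Section Families.
Variables (R : realType) (k : scalars) (B : cstar R k).
Local Notation U := (unitization B).

Lemma gfamP (I : Type) (X : I -> gmx B) :
  exists p q (M : forall i, 'M[U]_(p i, q i)), X = fun i => GMx (M i).
Proof.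
exists (fun i => nrow (X i)), (fun i => ncol (X i)), (fun i => mat (X i)).
by apply/funext => i; rewrite matK.
Qed.

Lemma gfam_mulP (I : Type) (X Y : I -> gmx B) : (forall i, ncol (X i) = nrow (Y i)) ->
  exists p q r (M : forall i, 'M[U]_(p i, q i)) (N : forall i, 'M[U]_(q i, r i)),
    X = (fun i => GMx (M i)) /\ Y = (fun i => GMx (N i)).
Proof.
have [p [q [M ->]]] := gfamP X; have [q' [r [N ->]]] := gfamP Y.
move=> e0; have /funext e : q =1 q' by exact: e0.
clear e0; case: q' / e N => N.
by exists p, q, r, M, N.
Qed.

Lemma gmulE_fam (I : Type) (p q r : I -> nat) (M : forall i, 'M[U]_(p i, q i))
    (N : forall i, 'M[U]_(q i, r i)) :
  (fun i => gmul (GMx (M i)) (GMx (N i))) = (fun i => GMx (M i *m N i)).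
Proof. by apply/funext => i; rewrite gmulE. Qed.

End Families.

Section OplusAction.
Variables (R : realType) (k : scalars) (B : cstar R k).

Lemma mxoplus_mul a (X Y : 'I_a -> gmx B) : (forall x, ncol (X x) = nrow (Y x)) ->
  gmul (mxoplus X) (mxoplus Y) = mxoplus (fun x => gmul (X x) (Y x)).
Proof.
move=> /gfam_mulP[p [q [r [M [N [-> ->]]]]]].
by rewrite gmulE_fam !mxoplusE gmulE oplusm_mul.
Qed.

Lemma mxoplus_adj a (X : 'I_a -> gmx B) :
  gadj (mxoplus X) = mxoplus (fun x => gadj (X x)).
Proof.
have [p [q [M ->]]] := gfamP X.
by rewrite mxoplusE gadjE oplusm_adj.
Qed.

Lemma mxoplus_perm a b (s : ordbij a b) (X : 'I_a -> gmx B) :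
  gmul (bijmx B (sum_bij s (fun x => nrow (X x)))) (mxoplus X) =
  gmul (mxoplus (fun y => X (ordbij_inv s y))) (bijmx B (sum_bij s (fun x => ncol (X x)))).
Proof.
have [p [q [M ->]]] := gfamP X.
rewrite !mxoplusE !bijmxE [LHS]gmulE [RHS]gmulE; congr GMx.
by apply: bijm_intertwine => i j; rewrite oplusm_perm.
Qed.

Lemma mxoplus_nested m (n : 'I_m -> nat) (X : 'I_(\sum_i n i) -> gmx B) :
  mxoplus X = mxoplus (fun i => mxoplus (fun j : 'I_(n i) => X (tagnat.Rank i j))).
Proof. by have [p [q [M ->]]] := gfamP X; exact: oplusm_nested. Qed.

Lemma mxoplus_single (X : gmx B) : mxoplus (fun _ : 'I_1 => X) = X.
Proof. by have [p [q [M ->]]] := gmxP X; exact: oplusm_single. Qed.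

Lemma mxoplus_bijmx a (q : 'I_a -> nat) (X : 'I_a -> gmx B)
    (t : forall x, ordbij (nrow (X x)) (q x)) :
  mxoplus (fun x => gmul (bijmx B (t x)) (X x)) =
  gmul (bijmx B (sum_map t)) (mxoplus X).
Proof.
have e : mxoplus (fun x => bijmx B (t x)) = bijmx B (sum_map t).
  by rewrite bijmxE -oplusm_bijm.
by rewrite -mxoplus_mul // e.
Qed.

Hypothesis defB : definite B.

Definition oplus_action : gcat comm_operad (pr B).
Proof.
apply: (@generic_action R k B defB comm_operad (fun m p => \sum_i p i)%N
  (fun m _ X => mxoplus X) (fun m n s p => sum_bij s p)) => //.
- by move=> m _; exact: mxoplus_mul.
- by move=> m _; exact: mxoplus_adj.
- by move=> m n _; exact: mxoplus_perm.
- by move=> m n r t s p l; exact: sum_bij_comp.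
- by move=> m p l; exact: sum_bij_id.
- by move=> m [].
- by move=> m n _ _ X; exact: mxoplus_nested.
- by move=> X; exact: mxoplus_single.
- by move=> T t0 m f X _ XX; exact: mxoplus_cvg.
- by move=> m n s f; exact: cvg_cst.
Defined.

End OplusAction.

Section OtimesAction.
Variables (R : realType) (k : scalars) (A : cstar R k) (KA : stabilization A).

Lemma mxotimes_mul m (f : lin_isom R m) (X Y : 'I_m -> gmx KA) :
  (forall i, ncol (X i) = nrow (Y i)) ->
  gmul (mxotimes f X) (mxotimes f Y) = mxotimes f (fun i => gmul (X i) (Y i)).
Proof.
move=> /gfam_mulP[p [q [r [M [N [-> ->]]]]]].
by rewrite gmulE_fam !mxotimesE gmulE otimesm_mul.
Qed.

Lemma mxotimes_adj m (f : lin_isom R m) (X : 'I_m -> gmx KA) :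
  gadj (mxotimes f X) = mxotimes f (fun i => gadj (X i)).
Proof.
have [p [q [M ->]]] := gfamP X.
by rewrite mxotimesE gadjE otimesm_adj.
Qed.

Lemma mxotimes_perm m n (f : lin_isom R n) (s : ordbij m n) (X : 'I_m -> gmx KA) :
  gmul (bijmx KA (prod_perm s (fun i => nrow (X i)))) (mxotimes (li_act f s) X) =
  gmul (mxotimes f (fun j => X (ordbij_inv s j)))
    (bijmx KA (prod_perm s (fun i => ncol (X i)))).
Proof.
have [p [q [M ->]]] := gfamP X.
rewrite !mxotimesE !bijmxE [LHS]gmulE [RHS]gmulE; congr GMx.
by apply: bijm_intertwine => i j; rewrite otimesm_perm.
Qed.

Lemma mxotimes_nested m (n : 'I_m -> nat) (f : lin_isom R m)
    (g : forall i, lin_isom R (n i)) (X : 'I_(\sum_i n i) -> gmx KA) :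
  mxotimes (li_comp f g) X =
  mxotimes f (fun i => mxotimes (g i) (fun j => X (tagnat.Rank i j))).
Proof. by have [p [q [M ->]]] := gfamP X; exact: otimesm_nested. Qed.

Lemma mxotimes_single (X : gmx KA) : mxotimes (li_id R) (fun=> X) = X.
Proof. by have [p [q [M ->]]] := gmxP X; exact: otimesm_single. Qed.

Lemma mxotimes_bijmx m (f : lin_isom R m) (q : 'I_m -> nat) (X : 'I_m -> gmx KA)
    (t : forall i, ordbij (nrow (X i)) (q i)) :
  mxotimes f (fun i => gmul (bijmx KA (t i)) (X i)) =
  gmul (bijmx KA (prod_bij t)) (mxotimes f X).
Proof.
have e : mxotimes f (fun i => bijmx KA (t i)) = bijmx KA (prod_bij t).
  by rewrite bijmxE -(otimesm_bijm KA f).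
by rewrite -mxotimes_mul // e.
Qed.

Lemma mxotimes_distr m (f : lin_isom R m) (a : 'I_m -> nat)
    (X : forall i, 'I_(a i) -> gmx KA) :
  gmul (bijmx KA (distr_bij (fun i x => nrow (X i x))))
    (mxotimes f (fun i => mxoplus (X i))) =
  gmul (mxoplus (fun Y : 'I_(\prod_i a i) => mxotimes f (fun i => X i (mdigit Y i))))
    (bijmx KA (distr_bij (fun i x => ncol (X i x)))).
Proof.
rewrite !bijmxE [LHS]gmulE [RHS]gmulE; congr GMx.
apply: bijm_intertwine => i j.
exact: (distr_entry f (fun i x => mat (X i x))).
Qed.

Lemma li_act_comp m n r (f : lin_isom R r) (t : ordbij n r) (s : ordbij m n) :
  li_act (li_act f t) s = li_act f (ordbij_comp t s).
Proof. exact/val_inj. Qed.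

Lemma li_act_id m (f : lin_isom R m) : li_act f (ordbij_id m) = f.
Proof. exact/val_inj. Qed.

Lemma li_act_cont m n (s : ordbij m n) : continuous (fun f : lin_isom R n => li_act f s).
Proof.
apply: continuous_comp_initial => f.
pose V : topologicalType := {ptws Rinf R -> Rinf R}.
pose W : topologicalType := {ptws 'I_n -> V}; pose W' : topologicalType := {ptws 'I_m -> V}.
have c1 : continuous (fun f : lin_isom R n => val f : W) by exact: initial_continuous.
have c2 : continuous (fun h : W => (fun i => h (s i)) : W').
  move=> h; have FF : Filter ((fun h : W => (fun i => h (s i)) : W') @ h).
    exact: (@fmap_filter W W' _ (nbhs h) (nbhs_filter h)).
  apply/(cvg_sup _ _ FF) => i.
  have c3 : continuous (fun h : W => h (s i) : V) by exact: proj_continuous.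
  exact: (@continuous_comp_initial W' W V (fun g => g i) (fun h i => h (s i)) c3 h).
exact: (cvg_comp _ _ (c1 f) (c2 _)).
Qed.

Definition otimes_action : gcat (lin_operad R) (pr KA).
Proof.
refine (@generic_action R k KA (@definite_stab R k A KA) (lin_operad R)
  (fun m p => \prod_i p i)%N (fun m (f : lin_isom R m) X => mxotimes f X)
  (fun m n s p => prod_perm s p) _ _ _ _ _ _ _ _ _ _ _ _ _) => //.
- by move=> m f; exact: mxotimes_mul.
- by move=> m f; exact: mxotimes_adj.
- by move=> m n f; exact: mxotimes_perm.
- by move=> m n r t s p l; exact: prod_perm_comp.
- by move=> m p l; exact: prod_perm_id.
- by move=> m n r f t s; exact: li_act_comp.
- by move=> m f; exact: li_act_id.
- by move=> m n f g X; exact: mxotimes_nested.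
- by move=> X; exact: mxotimes_single.
- by move=> T t0 m f X ff XX; exact: mxotimes_cvg.
- by move=> m n s; exact: li_act_cont.
Defined.

End OtimesAction.

(** * The permutative structure *)

Section Composites.
Variables (R : realType) (k : scalars) (B : cstar R k).
Hypothesis defB : definite B.

Lemma bijmx_src p q (s : ordbij p q) (X : gmx B) : is_proj X -> nrow X = p ->
  gmul (gadj (gmul (bijmx B s) X)) (gmul (bijmx B s) X) = X.
Proof.
move=> hX dX; have d : ncol (bijmx B s) = nrow X by rewrite dX.
case: hX => Xa XX.
rewrite (gadjM d) -gmulA //.
by rewrite bijmx_adj // Xa.
Qed.

Lemma tgt_act (X : pr_mor B) : gmul (obmx (pr_tgt X)) (mormx X) = mormx X.
Proof. by rewrite tgtE pisom_tgt //; exact: mormxP. Qed.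

Lemma src_act (X : pr_mor B) : gmul (mormx X) (obmx (pr_src X)) = mormx X.
Proof. by rewrite srcE pisom_src //; exact: mormxP. Qed.

(** All structure maps have the form of V here, so that composites of structure maps
    reduce to compositions of bijections. *)
Lemma cmp_bijmx (V X : pr_mor B) (b : gmx B) : ncol b = nrow (mormx X) ->
  pr_src V = pr_tgt X -> mormx V = gmul b (obmx (pr_tgt X)) ->
  mormx (pr_cmp V X) = gmul b (mormx X).
Proof.
by move=> db e eV; rewrite (cmpE defB e) eV -gmulA // tgt_act.
Qed.

End Composites.

Section Structure.
Variables (R : realType) (k : scalars) (A : cstar R k) (KA : stabilization A).
Let defKA := @definite_stab R k A KA.
Let os : gcat comm_operad (pr KA) := oplus_action defKA.
Let ot : gcat (lin_operad R) (pr KA) := otimes_action KA.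

Section Delta.
Variables (m : nat) (a : 'I_m -> nat).
Implicit Types (f : lin_isom R m) (P : forall i, 'I_(a i) -> pr_ob KA).

Definition delta_bij P := distr_bij (fun i x => nrow (obmx (P i x))).

Definition delta_mx f P : gmx KA :=
  gmul (bijmx KA (delta_bij P)) (mxotimes f (fun i => mxoplus (fun x => obmx (P i x)))).

Lemma delta_pisom f P : is_pisom (delta_mx f P).
Proof.
apply: (pisom_bijmx defKA) => //; apply: pisom_proj.
exact: (obmxP (gob ot f (fun i => gob os tt (P i)))).
Qed.

Definition delta f P : pr_mor KA := mkmor (delta_pisom f P).

Lemma deltaE f P : mormx (delta f P) = gmul (bijmx KA (delta_bij P))
  (mxotimes f (fun i => mxoplus (fun x => obmx (P i x)))).
Proof. by []. Qed.

Lemma delta_src f P : pr_src (delta f P) = gob ot f (fun i => gob os tt (P i)).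
Proof.
apply: obmx_inj; rewrite srcE deltaE bijmx_src //.
exact: (obmxP (gob ot f (fun i => gob os tt (P i)))).
Qed.

Lemma distr_ob f P : gmul (bijmx KA (delta_bij P))
    (mxotimes f (fun i => mxoplus (fun x => obmx (P i x)))) =
  gmul (mxoplus (fun Y : 'I_(\prod_i a i) =>
      mxotimes f (fun i => obmx (P i (mdigit Y i))))) (bijmx KA (delta_bij P)).
Proof.
rewrite (mxotimes_distr f (fun i x => obmx (P i x))); congr gmul.
congr (bijmx KA (distr_bij _)).
by apply: functional_extensionality_dep => i; apply/funext => x; exact: obmx_dim.
Qed.

Lemma delta_tgt f P : pr_tgt (delta f P) =
  gob os tt (fun Y : 'I_(\prod_i a i) => gob ot f (fun i => P i (mdigit Y i))).
Proof.
apply: obmx_inj; rewrite tgtE deltaE; apply: bijmx_tgt; last exact: distr_ob.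
- exact: (obmxP (gob ot f (fun i => gob os tt (P i)))).
- by [].
- apply: eq_bigr => Y _; apply: eq_bigr => i _; exact: obmx_dim.
Qed.

Lemma delta_nat f (X : forall i, 'I_(a i) -> pr_mor KA) :
  pr_cmp (delta f (fun i x => pr_tgt (X i x)))
    (gmor ot f (fun i => gmor os tt (X i))) =
  pr_cmp (gmor os tt (fun Y : 'I_(\prod_i a i) => gmor ot f (fun i => X i (mdigit Y i))))
    (delta f (fun i x => pr_src (X i x))).
Proof.
have et : pr_tgt (gmor ot f (fun i => gmor os tt (X i))) =
    gob ot f (fun i => gob os tt (fun x => pr_tgt (X i x))).
  apply: etrans (gmor_tgt ot f _) _; congr (gob ot f _); apply/funext => i.
  exact: (gmor_tgt os).
have es : pr_src (gmor os tt (fun Y : 'I_(\prod_i a i) =>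
      gmor ot f (fun i => X i (mdigit Y i)))) =
    gob os tt (fun Y => gob ot f (fun i => pr_src (X i (mdigit Y i)))).
  apply: etrans (gmor_src os (tt : comm_operad _) _) _; congr (gob os tt _); apply/funext => Y.
  exact: (gmor_src ot).
apply: mormx_inj; rewrite (@cmp_bijmx _ _ _ defKA _ _ (bijmx KA
  (delta_bij (fun i x => pr_tgt (X i x))))) //; first last.
- by rewrite et.
- by rewrite delta_src et.
rewrite (cmpE defKA); last by rewrite es delta_tgt.
rewrite deltaE distr_ob; set b' := bijmx KA (delta_bij _).
set W := gmor os tt _.
have eW : gmul (mormx W) (mxoplus (fun Y : 'I_(\prod_i a i) =>
    mxotimes f (fun i => obmx (pr_src (X i (mdigit Y i)))))) = mormx W.
  by have := src_act defKA W; rewrite {2}/W es.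
rewrite gmulA // eW.
exact: (mxotimes_distr f (fun i x => mormx (X i x))).
Qed.

Lemma delta_cont : continuous (fun z : lin_isom R m * {ptws {i : 'I_m & 'I_(a i)} -> pr_ob KA} =>
  delta z.1 (fun i x => z.2 (existT _ i x))).
Proof.
apply: cont_mor => z.
have c i x : obmx (z'.2 (existT _ i x)) @[z' --> z] --> obmx (z.2 (existT _ i x)).
  exact: (cont_ops (I := {i : 'I_m & 'I_(a i)}) (@obmx_cont R k KA)).
apply: (@cvg_gmul _ _ KA _ (nbhs z) (nbhs_filter z)).
  apply: (@near_cvg _ _ (nbhs_filter z) _
    (fun=> bijmx KA (delta_bij (fun i x => z.2 (existT _ i x))))); last exact: cvg_cst.
  have h : nbhs z [set z' | forall i x,
      samedim (obmx (z'.2 (existT _ i x))) (obmx (z.2 (existT _ i x)))].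
    apply: (@filter_forall _ _ _ _ (nbhs_filter z)) => i.
    apply: (@filter_forall _ _ _ _ (nbhs_filter z)) => x.
    exact: (cvg_samedim (nbhs_filter z) (c i x)).
  apply: (@filterS _ (nbhs z) (nbhs_filter z) _ _ _ h) => z' e /=.
  congr (bijmx KA (distr_bij _)).
  apply: functional_extensionality_dep => i; apply/funext => x.
  by case: (e i x).
apply: (@mxotimes_cvg _ _ _ KA _ (nbhs z) (nbhs_filter z)).
  exact: (cvg_fst (G := nbhs z.2)).
by move=> i; apply: (@mxoplus_cvg _ _ _ _ (nbhs z) (nbhs_filter z)) => x; exact: c.
Qed.

End Delta.

(** Both matrices are empty. *)
Lemma zero_mx m (f : lin_isom R m) (a : 'I_m -> nat) (X : forall i, 'I_(a i) -> gmx KA)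
    (Y : 'I_0 -> gmx KA) : (exists i, a i = 0%N) ->
  mxotimes f (fun i => mxoplus (X i)) = mxoplus Y.
Proof.
move=> [i ai].
have dim0 (d : forall i, 'I_(a i) -> nat) (e : 'I_0 -> nat) :
    (\prod_i \sum_x d i x = \sum_x e x)%N.
  rewrite big_ord0 (bigD1 i) //= big1 // => x _.
  by suff : false by []; move: (ltn_ord x); rewrite [X in (_ < X)%N]ai.
apply: GMx_ext; [exact: dim0|exact: dim0|] => j l j'.
by suff : false by []; move: (ltn_ord j'); rewrite [X in (_ < X)%N]big_ord0.
Qed.

Lemma zero_ob m (f : lin_isom R m) (a : 'I_m -> nat) (P : forall i, 'I_(a i) -> pr_ob KA)
    (Q : 'I_0 -> pr_ob KA) : (exists i, a i = 0%N) ->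
  gob ot f (fun i => gob os tt (P i)) = gob os tt Q.
Proof. by move=> a0; apply: obmx_inj; exact: (zero_mx f (fun i x => obmx (P i x))). Qed.

Lemma zero_mor m (f : lin_isom R m) (a : 'I_m -> nat) (X : forall i, 'I_(a i) -> pr_mor KA)
    (Y : 'I_0 -> pr_mor KA) : (exists i, a i = 0%N) ->
  gmor ot f (fun i => gmor os tt (X i)) = gmor os tt Y.
Proof. by move=> a0; apply: mormx_inj; exact: (zero_mx f (fun i x => mormx (X i x))). Qed.

(** In this and the next two laws, both sides are permutation matrices times the same
    identity morphism, which leaves an identity between bijections of indices. *)
Lemma delta_oplus m (f : lin_isom R m) (a b : 'I_m -> nat)
    (s : forall i, ordbij (a i) (b i)) (P : forall i, 'I_(a i) -> pr_ob KA) :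
  pr_cmp (gtau os tt (prod_bij s) (fun X => gob ot f (fun i => P i (mdigit X i))))
    (delta f P) =
  pr_cmp (delta f (fun i y => P i (ordbij_inv (s i) y)))
    (gmor ot f (fun i => gtau os tt (s i) (P i))).
Proof.
have et : pr_tgt (gmor ot f (fun i => gtau os tt (s i) (P i))) =
    gob ot f (fun i => gob os tt (fun y => P i (ordbij_inv (s i) y))).
  apply: etrans (gmor_tgt ot f _) _; congr (gob ot f _); apply/funext => i.
  exact: (gtau_tgt os).
apply: mormx_inj.
pose p i x := nrow (obmx (P i x)).
pose b1 := sum_bij (prod_bij s) (fun X => \prod_i p i (mdigit X i))%N.
rewrite (@cmp_bijmx _ _ _ defKA _ _ (bijmx KA b1)) //; first last.
- by rewrite delta_tgt.
- by rewrite delta_tgt; exact: (gtau_src os).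
pose b2 := distr_bij (fun i y => p i (ordbij_inv (s i) y)).
rewrite (@cmp_bijmx _ _ _ defKA _ _ (bijmx KA b2)) //; first last.
- by rewrite et.
- by rewrite et delta_src.
pose b3 := prod_bij (fun i => sum_bij (s i) (p i)).
set Y := mxotimes f (fun i => mxoplus (fun x => obmx (P i x))).
have -> : mormx (gmor ot f (fun i => gtau os tt (s i) (P i))) = gmul (bijmx KA b3) Y.
  exact: (mxotimes_bijmx f (X := fun i => mxoplus (fun x => obmx (P i x)))
    (fun i => sum_bij (s i) (p i))).
rewrite deltaE -/Y [LHS]gmulA // [RHS]gmulA //; congr gmul.
rewrite (bijmx_comp _ b1 (distr_bij p)) (bijmx_comp _ b2 b3).
apply: bijmx_ext => // [|l l' /val_inj->]; last exact: distr_prod_bij.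
apply: eq_bigr => Z _; apply: eq_bigr => i _; congr (p i).
by rewrite -[in RHS](ordbij_inv_funKV (prod_bij s) Z) prod_bijE /= ordbij_inv_funK.
Qed.

Lemma delta_otimes m n (f : lin_isom R n) (s : ordbij m n) (a : 'I_m -> nat)
    (P : forall i, 'I_(a i) -> pr_ob KA) :
  pr_cmp (gtau os tt (prod_perm s a)
      (fun X => gob ot f (fun j => P (ordbij_inv s j) (mdigit X (ordbij_inv s j)))))
    (pr_cmp (gmor os tt (fun X : 'I_(\prod_i a i) => gtau ot f s (fun i => P i (mdigit X i))))
      (delta (li_act f s) P)) =
  pr_cmp (delta f (fun j => P (ordbij_inv s j)))
    (gtau ot f s (fun i => gob os tt (P i))).
Proof.
pose p i x := nrow (obmx (P i x)).
pose V := gmor os tt (fun X : 'I_(\prod_i a i) => gtau ot f s (fun i => P i (mdigit X i))).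
have sV : pr_src V = gob os tt (fun X : 'I_(\prod_i a i) =>
    gob ot (li_act f s) (fun i => P i (mdigit X i))).
  apply: etrans (gmor_src os (tt : comm_operad _) _) _.
  by congr (gob os tt _); apply/funext => X; exact: (gtau_src ot).
have tV : pr_tgt V = gob os tt (fun X : 'I_(\prod_i a i) =>
    gob ot f (fun j => P (ordbij_inv s j) (mdigit X (ordbij_inv s j)))).
  apply: etrans (gmor_tgt os (tt : comm_operad _) _) _.
  by congr (gob os tt _); apply/funext => X; exact: (gtau_tgt ot).
have eV : pr_src V = pr_tgt (delta (li_act f s) P) by rewrite sV delta_tgt.
apply: mormx_inj.
pose b1 := sum_bij (prod_perm s a)
  (fun X => \prod_j p (ordbij_inv s j) (mdigit X (ordbij_inv s j)))%N.
have tc := tgt_cmpE defKA eV.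
rewrite (@cmp_bijmx _ _ _ defKA _ _ (bijmx KA b1)) //; first last.
- by rewrite tc tV.
- by rewrite tc tV; exact: (gtau_src os).
- by rewrite (cmpE defKA eV).
pose b2 := sum_map (fun X : 'I_(\prod_i a i) => prod_perm s (fun i => p i (mdigit X i))).
rewrite (@cmp_bijmx _ _ _ defKA V _ (bijmx KA b2)) //; first last.
- rewrite delta_tgt.
  exact: (mxoplus_bijmx (X := fun X : 'I_(\prod_i a i) =>
      mxotimes (li_act f s) (fun i => obmx (P i (mdigit X i))))
    (fun X => prod_perm s (fun i => p i (mdigit X i)))).
pose W := gtau ot f s (fun i => gob os tt (P i)).
have tW : pr_tgt W = gob ot f (fun j => gob os tt (P (ordbij_inv s j))).
  exact: (gtau_tgt ot).
pose b3 := distr_bij (fun j => p (ordbij_inv s j)).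
rewrite (@cmp_bijmx _ _ _ defKA _ W (bijmx KA b3)) //; first last.
- by rewrite tW.
- by rewrite tW delta_src.
pose b4 := prod_perm s (fun i => \sum_x p i x)%N.
set Y := mxotimes (li_act f s) (fun i => mxoplus (fun x => obmx (P i x))).
have -> : mormx W = gmul (bijmx KA b4) Y by [].
rewrite deltaE -/Y [in LHS]gmulA // [LHS]gmulA // [RHS]gmulA //; congr gmul.
rewrite (bijmx_comp _ b1 b2) (bijmx_comp _ (ordbij_comp b1 b2) (distr_bij p)).
rewrite (bijmx_comp _ b3 b4).
apply: bijmx_ext => // [|l l' /val_inj->]; last exact: distr_prod_perm.
apply: eq_bigr => Z _; apply: eq_bigr => j _; congr p.
by rewrite -[in RHS](ordbij_inv_funKV (prod_perm s a) Z) prod_permE.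
Qed.

Lemma delta_delta m (f : lin_isom R m) (a : 'I_m -> nat)
    (b : forall i, 'I_(a i) -> nat) (P : forall i x, 'I_(b i x) -> pr_ob KA) :
  pr_cmp (gmor os tt (fun X : 'I_(\prod_i a i) => delta f (fun i => P i (mdigit X i))))
    (delta f (fun i x => gob os tt (P i x))) =
  pr_cmp (gtau os tt (distr_bij b)
      (fun K => gob ot f
        (fun i => P i (tagnat.sig1 (mdigit K i)) (tagnat.sig2 (mdigit K i)))))
    (delta f (fun i (z : 'I_(\sum_x b i x)) => P i (tagnat.sig1 z) (tagnat.sig2 z))).
Proof.
pose p i x y := nrow (obmx (P i x y)).
pose D := delta f (fun i x => gob os tt (P i x)).
pose V := gmor os tt (fun X : 'I_(\prod_i a i) => delta f (fun i => P i (mdigit X i))).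
have sV : pr_src V = gob os tt (fun X : 'I_(\prod_i a i) =>
    gob ot f (fun i => gob os tt (P i (mdigit X i)))).
  apply: etrans (gmor_src os (tt : comm_operad _) _) _.
  by congr (gob os tt _); apply/funext => X; exact: delta_src.
apply: mormx_inj.
pose b1 := sum_map (fun X : 'I_(\prod_i a i) => distr_bij (fun i => p i (mdigit X i))).
rewrite (@cmp_bijmx _ _ _ defKA V D (bijmx KA b1)) //; first last.
- rewrite delta_tgt.
  exact: (mxoplus_bijmx (X := fun X : 'I_(\prod_i a i) =>
      mxotimes f (fun i => mxoplus (fun y => obmx (P i (mdigit X i) y))))
    (fun X => distr_bij (fun i => p i (mdigit X i)))).
- by rewrite sV delta_tgt.
pose E := delta f (fun i (z : 'I_(\sum_x b i x)) => P i (tagnat.sig1 z) (tagnat.sig2 z)).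
pose b2 := sum_bij (distr_bij b) (fun K =>
  \prod_i p i (tagnat.sig1 (mdigit K i)) (tagnat.sig2 (mdigit K i)))%N.
rewrite (@cmp_bijmx _ _ _ defKA _ E (bijmx KA b2)) //; first last.
- by rewrite delta_tgt.
- by rewrite delta_tgt; exact: (gtau_src os).
rewrite /D /E !deltaE.
set Y := mxotimes f (fun i => mxoplus (fun x => obmx (gob os tt (P i x)))).
have -> : mxotimes f (fun i => mxoplus (fun z : 'I_(\sum_x b i x) =>
    obmx (P i (tagnat.sig1 z) (tagnat.sig2 z)))) = Y.
  congr mxotimes; apply/funext => i; rewrite mxoplus_nested; congr mxoplus.
  apply/funext => x; rewrite [RHS]/=; congr mxoplus; apply/funext => y.
  by rewrite /tagnat.sig1 /tagnat.sig2 /tagnat.Rank tagnat.rankK.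
have dimY : nrow Y = (\prod_i \sum_x \sum_y p i x y)%N by [].
pose d1 := distr_bij (fun i x => \sum_y p i x y)%N.
pose d2 := distr_bij (fun i (z : 'I_(\sum_x b i x)) =>
  p i (tagnat.sig1 z) (tagnat.sig2 z)).
have eS i : (\sum_x \sum_y p i x y =
    \sum_(z < \sum_x b i x) p i (tagnat.sig1 z) (tagnat.sig2 z))%N.
  rewrite sumn_nested; apply: eq_bigr => x _; apply: eq_bigr => y _.
  by rewrite curry_sig.
have eP : (\prod_i \sum_x \sum_y p i x y = \prod_i
    \sum_(z < \sum_x b i x) p i (tagnat.sig1 z) (tagnat.sig2 z))%N.
  by apply: eq_bigr => i _.
have dimY2 : ncol (bijmx KA d2) = nrow Y by rewrite dimY eP.
rewrite (gmulA (X := bijmx KA b1) (Y := bijmx KA d1)) //.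
rewrite (gmulA (X := bijmx KA b2) (Y := bijmx KA d2)) //; congr gmul.
rewrite (bijmx_comp _ b1 d1) (bijmx_comp _ b2 d2).
apply: bijmx_ext => // [|l l' ll']; last exact: distr_distr.
by rewrite -(ordbij_eq (ordbij_comp b1 d1)) eP (ordbij_eq (ordbij_comp b2 d2)).
Qed.

Definition lperm_structure : lperm R (pr KA).
Proof.
exists os ot (fun m f a P => delta f P).
- by move=> m a; exact: delta_cont.
- by move=> m f a P; exact: delta_src.
- by move=> m f a P; exact: delta_tgt.
- by move=> m f a X; exact: delta_nat.
- by move=> m f a P Q; exact: zero_ob.
- by move=> m f a X Y; exact: zero_mor.
- by move=> m f a b s P; exact: delta_oplus.
- by move=> m n f s a P; exact: delta_otimes.
- by move=> m f a b P; exact: delta_delta.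
Defined.

End Structure.

(** * Naturality *)

Section Naturality.
Variables (R : realType) (k : scalars).

(** Homomorphisms fix the scalar entries. *)
Lemma gmap_bijmx (B B' : cstar R k) (psi : star_hom B B') p q (s : ordbij p q) :
  gmap psi (bijmx B s) = bijmx B' s.
Proof.
congr GMx; apply/matrixP => i j; rewrite !mxE.
by case: (_ == _); congr (_, _); rewrite /= ?shom0.
Qed.

Lemma gmap_mxoplus (B B' : cstar R k) (psi : star_hom B B') a (X : 'I_a -> gmx B) :
  gmap psi (mxoplus X) = mxoplus (fun x => gmap psi (X x)).
Proof.
have [p [q [M ->]]] := gfamP X.
suff e : map_mx (umap psi) (oplusm M) = oplusm (fun x => map_mx (umap psi) (M x)).
  exact: (congr1 (@GMx _ _ _ _ _) e).
apply/matrixP => i j; rewrite mxE !oplusmE.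
case: eqP => _; last by congr (_, _); rewrite /= shom0.
rewrite /ent; case: insubP => [i' _ _|_]; last by congr (_, _); rewrite /= shom0.
case: insubP => [j' _ _|_]; last by congr (_, _); rewrite /= shom0.
by rewrite mxE.
Qed.

Lemma gmap_mxotimes (A B : cstar R k) (KA : stabilization A) (KB : stabilization B)
    (phi : star_hom A B) (psi : star_hom KA KB) : is_induced phi psi ->
  forall m (f : lin_isom R m) (X : 'I_m -> gmx KA),
  gmap psi (mxotimes f X) = mxotimes f (fun i => gmap psi (X i)).
Proof.
move=> h m f X; have [p [q [M ->]]] := gfamP X; rewrite mxotimesE.
congr GMx; apply/matrixP => i j; rewrite !mxE (tensu_natural h).
by apply: eq_tensu => l; rewrite mxE.
Qed.

Lemma gmap_cont (B B' : cstar R k) (psi : star_hom B B') : continuous psi ->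
  continuous (gmap psi).
Proof.
move=> cpsi X.
have e Y i j : gent (gmap psi Y) i j = umap psi (gent Y i j).
  have u0 : umap psi (0 : unitization B) = 0 by exact: umap0.
  rewrite /gent /ent /=; case: insubP => [i' _ _|_]; rewrite ?u0 //.
  by case: insubP => [j' _ _|_]; rewrite ?u0 // mxE.
apply: (@cvg_gmx _ _ _ _ (nbhs X) (nbhs_filter X)).
  by apply: (@filterS _ (nbhs X) (nbhs_filter X) _ _ _ (near_samedim X)) => Y [].
move=> i j _ _; rewrite e; under eq_cvg do rewrite e.
have cX := @gent_cont _ _ B i j X.
apply: (@cvg_upair _ _ B' _ (nbhs X) (nbhs_filter X) (fun Y => (gent Y i j).1)
  (fun Y => psi (gent Y i j).2)).
  exact: (@cvg_ufst _ _ B _ (nbhs X) _ _ cX).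
have c2 : (gent Y i j).2 @[Y --> X] --> (gent X i j).2.
  exact: (@cvg_usnd _ _ B _ (nbhs X) _ _ cX).
exact: (cvg_comp _ _ c2 (cpsi _)).
Qed.

Lemma lperm_natural (A B : cstar R k) (KA : stabilization A) (KB : stabilization B)
    (phi : star_hom A B) (psi : star_hom KA KB) : is_induced phi psi ->
  lperm_morphism (lperm_structure KA) (lperm_structure KB) (pr_map_ob psi) (pr_map_mor psi).
Proof.
move=> h; have cpsi := proj1 h; have hot := gmap_mxotimes h.
have hos := gmap_mxoplus psi; have hb := gmap_bijmx psi.
have hsrc X : pr_src (pr_map_mor psi X) = pr_map_ob psi (pr_src X).
  apply: obmx_inj; apply: etrans (esym (gmapM psi (V := gadj (mormx X)) _)) => //.
  by rewrite gmap_adj.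
have htgt X : pr_tgt (pr_map_mor psi X) = pr_map_ob psi (pr_tgt X).
  apply: obmx_inj; apply: etrans (esym (gmapM psi (U := gadj (mormx X)) _)) => //.
  by rewrite gmap_adj.
split.
- apply: cont_ob; suff : continuous (fun P => gmap psi (obmx P)) by [].
  move=> P; have c2 := @gmap_cont _ _ _ cpsi (obmx P).
  have c1 := @obmx_cont _ _ _ P.
  exact: (@continuous_comp _ _ _ (@obmx R k KA) (gmap psi) P c1 c2).
- apply: cont_mor; suff : continuous (fun X => gmap psi (mormx X)) by [].
  move=> X; have c2 := @gmap_cont _ _ _ cpsi (mormx X).
  have c1 := @mormx_cont _ _ _ X.
  exact: (@continuous_comp _ _ _ (@mormx R k KA) (gmap psi) X c1 c2).
- exact: hsrc.
- exact: htgt.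
- by move=> P; apply: mormx_inj.
- move=> V U eVU; apply: mormx_inj.
  have e' : cat_src (pr_map_mor psi V : cat_mor (pr KB)) = cat_tgt (pr_map_mor psi U : cat_mor (pr KB)).
    by apply: etrans (hsrc V) _; rewrite (eVU : pr_src V = pr_tgt U) -htgt.
  rewrite [RHS](cmpE (@definite_stab _ _ _ KB) e').
  rewrite -[LHS]/(gmap psi (mormx (pr_cmp V U))) (cmpE (@definite_stab _ _ _ KA) eVU).
  by rewrite gmapM // (src_tgt_dim eVU).
- by move=> a P; apply: obmx_inj; exact: hos.
- by move=> a X; apply: mormx_inj; exact: hos.
- move=> a b s P; apply: mormx_inj; apply: etrans (gmapM psi _) _ => //.
  by rewrite hb hos.
- by move=> m f P; apply: obmx_inj; exact: hot.
- by move=> m f X; apply: mormx_inj; exact: hot.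
- move=> m n f s P; apply: mormx_inj; apply: etrans (gmapM psi _) _ => //.
  by rewrite hb hot.
- move=> m f a P; apply: mormx_inj; apply: etrans (gmapM psi _) _ => //.
  rewrite hb hot; congr gmul; congr mxotimes; apply: funext => i; exact: hos.
Qed.

End Naturality.

Theorem theorem3p13 (R : realType) (k : scalars) :
  exists S : forall (A : cstar R k) (KA : stabilization A), lperm R (pr KA),
    (forall (A : cstar R k) (KA : stabilization A),
      [/\ (forall (a : nat) (P : 'I_a -> pr_ob KA),
            obmx (gob (oplus (S A KA)) tt P) = mxoplus (fun x => obmx (P x))) /\
          (forall (a : nat) (U : 'I_a -> pr_mor KA),
            mormx (gmor (oplus (S A KA)) tt U) = mxoplus (fun x => mormx (U x))),
          (forall (a b : nat) (s : ordbij a b) (P : 'I_a -> pr_ob KA),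
            mormx (gtau (oplus (S A KA)) tt s P) =
            gmul (bijmx KA (sum_bij s (fun x => nrow (obmx (P x)))))
                 (mxoplus (fun x => obmx (P x)))),
          (forall (m : nat) (f : lin_isom R m) (P : 'I_m -> pr_ob KA),
            obmx (gob (otimes (S A KA)) f P) = mxotimes f (fun i => obmx (P i))) /\
          (forall (m : nat) (f : lin_isom R m) (U : 'I_m -> pr_mor KA),
            mormx (gmor (otimes (S A KA)) f U) = mxotimes f (fun i => mormx (U i))),
          (forall (m n : nat) (f : lin_isom R n) (s : ordbij m n) (P : 'I_m -> pr_ob KA),
            mormx (gtau (otimes (S A KA)) f s P) =
            gmul (bijmx KA (prod_perm s (fun i => nrow (obmx (P i)))))
                 (mxotimes (li_act f s) (fun i => obmx (P i)))) &
          (forall (m : nat) (f : lin_isom R m) (a : 'I_m -> nat)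
              (P : forall i, 'I_(a i) -> pr_ob KA),
            mormx (ldelta (S A KA) f P) =
            gmul (bijmx KA (distr_bij (fun i x => nrow (obmx (P i x)))))
                 (mxotimes f (fun i => mxoplus (fun x => obmx (P i x)))))]) /\
    (forall (A B : cstar R k) (KA : stabilization A) (KB : stabilization B)
        (phi : star_hom A B) (psi : star_hom KA KB),
      is_induced phi psi ->
      lperm_morphism (S A KA) (S B KB) (pr_map_ob psi) (pr_map_mor psi)).
Proof.
exists (fun A KA => lperm_structure KA); split=> [A KA|A B KA KB phi psi].
  by split.
exact: lperm_natural.
Qed.
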